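(* In the 2D network with the LOS-association-only path-loss model, for all $r>0$ and $\tau>0$, $$g_{\mathsf L}(r)\ge\underline{g_{\mathsf L}}(r)=e^{-\beta r}\exp\Big(-4\lambda\int_0^r\int_0^{\pi/2}t\,e^{-\beta t\sin^2\theta}\,d\theta\,dt\Big)$$ $$\qquad\qquad=\exp\Big(-\beta r-\frac13\,\frac{2\pi\lambda}{\beta}\,r\,e^{-\beta r/2}\big(\beta r\,\mathsf I_0(\beta r/2)+(\beta r+2)\,\mathsf I_1(\beta r/2)\big)\Big),$$ $$A_{\mathsf L}\ge\underline{A_{\mathsf L}}=2\pi\lambda\int_0^\infty\exp\Big(-\beta x-4\lambda\int_0^{\pi/2}\int_0^x e^{-\beta t\sin^2\theta}\,t\,dt\,d\theta\Big)x\,dx,$$ $$\kappa_{\mathsf L|\mathsf L}(r,\tau)\ge\underline{\kappa_{\mathsf L|\mathsf L}}(r,\tau)=\exp\Big(-\int_r^\infty\frac{\lambda e^{-\beta t}}{1+\tau^{-1}\ell_{\mathsf L}(r)/\ell_{\mathsf L}(t)}\,t\,dt\cdot4\int_0^{\pi/2}e^{\beta r\cos^2\theta}\,d\theta\Big)$$ $$\qquad\qquad=\exp\Big(-\int_r^\infty\frac{\lambda e^{-\beta t}}{1+\tau^{-1}\ell_{\mathsf L}(r)/\ell_{\mathsf L}(t)}\,t\,dt\cdot2\pi e^{\beta r/2}\,\mathsf I_0(\beta r/2)\Big),$$ and these lower bounds are the values of $g_{\mathsf L}(r)$, $A_{\mathsf L}$, $\kappa_{\mathsf L|\mathsf L}(r,\tau)$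 in the maximally correlated case.
   Context: 2D network. Base stations have density $\lambda>0$ (homogeneous Poisson point process (PPP) on $\mathbb R^2$), with the typical user at the origin. Blockages form a Boolean model of line segments: centers form a homogeneous PPP of density $\mu>0$, with i.i.d. random lengths $L$ ($0<\mathbb E[L]<\infty$) and independent orientations uniform on $[0,\pi]$; $\beta=2\mu\mathbb E[L]/\pi$. A link of length $r$ from the origin is LoS if no blockage intersects it, with probability $p_{\mathsf L}(r)=e^{-\beta r}$. For two links from the origin of lengths $r_1,r_2$ with directions differing by $\theta\in[0,2\pi]$, $p_{\mathsf L,\mathsf L}(r_1,r_2,\theta)$ is the probability that no blockage intersects either of them. The maximally correlated case (blockages tending to infinite length with $\beta$ fixed) means that $p_{\mathsf L,\mathsf L}(r_1,r_2,\theta)$ is replaced by the upper bound $\exp\big(-\beta r_1-\beta r_2+\tfrac12\min(r_1,r_2)\beta(1+\cos\theta)\big)$. LOS-association-only path-loss (LAP) model: NLoS power $\ell_{\mathsf N}\equiv0$; LoS power $\ell_{\mathsf L}:[0,\infty)\to(0,\infty)$ bounded and nonincreasing. Under the paper's first-order correlation model (only correlation between the serving link and each interfering link is kept) the quantities of interest are $$g_{\mathsf L}(x)=p_{\mathsf L}(x)\exp\Big(-\lambda\int_0^{2\pi}\int_0^x\frac{p_{\mathsf L,\mathsf L}(x,t,\theta)}{p_{\mathsf L}(x)}t\,dt\,d\theta\Big)$$ (probability that a BS at distance $x$ is LoS and serving), the LoS association probability $A_{\mathsf L}=2\pi\lambda\int_0^\infty g_{\mathsf L}(x)\,x\,dx$,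 and $$\kappa_{\mathsf L|\mathsf L}(r,\tau)=\exp\Big(-\int_r^\infty\frac{\lambda}{1+\tau^{-1}\ell_{\mathsf L}(r)/\ell_{\mathsf L}(t)}\int_0^{2\pi}\frac{p_{\mathsf L,\mathsf L}(r,t,\theta)}{p_{\mathsf L}(r)}d\theta\,t\,dt\Big)$$ (Laplace transform at $\tau/\ell_{\mathsf L}(r)$ of the LoS interference given a LoS serving BS at distance $r$). $\mathsf I_n$ is the modified Bessel function of the first kind of order $n$. *)

(* Defs.v *)
From mathcomp Require Export all_boot all_order all_algebra.
From mathcomp Require Export finmap.
From mathcomp Require Export all_classical all_reals all_analysis.
From mathcomp Require Export measurable_realfun.

Set Implicit Arguments.
Unset Strict Implicit.
Unset Printing Implicit Defensive.

Import Order.TTheory GRing.Theory Num.Theory.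
Import numFieldNormedType.Exports.

Local Open Scope classical_set_scope.
Local Open Scope ring_scope.

Section independence.
Context d (Om : measurableType d) (R : realType) (P : probability Om R).

Definition mutually_independent (I : choiceType)
    (F : I -> set_system Om) : Prop :=
  forall (J : {fset I}) (E : I -> set Om),
    (forall j, j \in J -> F j (E j)) ->
    P (\bigcap_(j in [set` J]) E j) = (\prod_(j <- J) P (E j))%E.

Definition sigma_of d' (T : measurableType d') (X : Om -> T) : set_system Om :=
  preimage_set_system setT X measurable.

End independence.

(* The point process on R^2 is given by an enumeration (X_k) of its points: a
   planar Poisson process of positive constant intensity almost surely has
   infinitely many points. *)
Section poisson_point_process.
Context d (Om : measurableType d) (R : realType) (P : probability Om R).

Definition area : set (R * R) -> \bar R :=
  (@lebesgue_measure R \x @lebesgue_measure R)%E.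

Definition nb_points (X : nat -> {RV P >-> (R * R)%type}) (B : set (R * R))
    (w : Om) : \bar R :=
  (\sum_(k <oo) \d_(X k w) B)%E.

(* The Poisson weights are written out because the library's poisson_pmf
   is the constant 1 at rate 0, i.e. on sets of area zero. *)
Definition homogeneous_ppp (mu : R) (X : nat -> {RV P >-> (R * R)%type}) : Prop :=
  (forall B, measurable B -> (area B < +oo)%E -> forall n : nat,
     let a := mu * fine (area B) in
     P [set w | nb_points X B w = n%:R%:E] = (expR (- a) * a ^+ n / n`!%:R)%:E)
  /\ (forall (n : nat) (B : 'I_n -> set (R * R)),
        (forall i, measurable (B i)) -> trivIset setT B ->
        mutually_independent P (fun i => sigma_of (nb_points X (B i)))).

End poisson_point_process.

Section blockages.
Context d (Om : measurableType d) (R : realType) (P : probability Om R).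
Implicit Types (X : nat -> {RV P >-> (R * R)%type}) (L Phi : nat -> {RV P >-> R}).

(* None: the sigma-algebra of the whole sequence of centres; inl k and inr k:
   those of the k-th length and of the k-th orientation. *)
Definition blockage_sigma X L Phi (i : option (nat + nat)) : set_system Om :=
  match i with
  | None => <<s \bigcup_k sigma_of (X k) >>
  | Some (inl k) => sigma_of (L k)
  | Some (inr k) => sigma_of (Phi k)
  end.

Record boolean_model (mu : R) X L Phi : Prop := BooleanModel {
  centers_ppp : homogeneous_ppp mu X;
  lengths_ge0 : forall k w, 0 <= L k w;
  lengths_id : forall k (B : set R), measurable B ->
    distribution P (L k) B = distribution P (L 0%N) B;
  orientations_uniform : forall k (B : set R), measurable B ->
    distribution P (Phi k) B = uniform_prob (pi_gt0 R) B;
  marks_independent : mutually_independent P (blockage_sigma X L Phi) }.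

Definition blockage (c : R * R) (l phi : R) : set (R * R) :=
  [set (c.1 + s * cos phi, c.2 + s * sin phi) | s in `[- (l / 2), l / 2]].

Definition link (psi r : R) : set (R * R) :=
  [set (s * cos psi, s * sin psi) | s in `[0, r]].

Definition los_event X L Phi (psi r : R) : set Om :=
  [set w | forall k, blockage (X k w) (L k w) (Phi k w) `&` link psi r = set0].

(* psi is the direction of the first link. *)
Definition p_L X L Phi (psi r : R) : R := fine (P (los_event X L Phi psi r)).

Definition p_LL X L Phi (psi r1 r2 theta : R) : R :=
  fine (P (los_event X L Phi psi r1 `&` los_event X L Phi (psi + theta) r2)).

End blockages.

Section lap_model.
Context (R : realType).
Local Notation leb := (@lebesgue_measure R).

(* \int here is the real-valued integral, the fine part of the extended-real
   one. The integrands are nonnegative and all the integrals converge when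
   beta > 0, pL r = expR (- (beta * r)) and 0 <= pLL <= p_LL_maxcorr beta. *)

Definition g_L (lambda : R) (pL : R -> R) (pLL : R -> R -> R -> R) (x : R) : R :=
  pL x * expR (- (lambda * \int[leb]_(theta in `[0, 2 * pi])
                             \int[leb]_(t in `[0, x]) (pLL x t theta / pL x * t))).

Definition A_L (lambda : R) (pL : R -> R) (pLL : R -> R -> R -> R) : R :=
  2 * pi * lambda * \int[leb]_(x in `[0, +oo[) (g_L lambda pL pLL x * x).

Definition kappa_LL (lambda : R) (ell : R -> R)
    (pL : R -> R) (pLL : R -> R -> R -> R) (r tau : R) : R :=
  expR (- \int[leb]_(t in `[r, +oo[)
            (lambda / (1 + tau^-1 * ell r / ell t)
             * (\int[leb]_(theta in `[0, 2 * pi]) (pLL r t theta / pL r)) * t)).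

Definition p_LL_maxcorr (beta r1 r2 theta : R) : R :=
  expR (- (beta * r1) - beta * r2
        + 2^-1 * Num.min r1 r2 * beta * (1 + cos theta)).

Definition g_L_low (lambda beta r : R) : R :=
  expR (- (beta * r)) *
  expR (- (4 * lambda * \int[leb]_(t in `[0, r]) \int[leb]_(theta in `[0, pi / 2])
                          (t * expR (- (beta * t * sin theta ^+ 2))))).

Definition A_L_low (lambda beta : R) : R :=
  2 * pi * lambda *
  \int[leb]_(x in `[0, +oo[)
    (expR (- (beta * x)
           - 4 * lambda * \int[leb]_(theta in `[0, pi / 2])
                            \int[leb]_(t in `[0, x])
                              (expR (- (beta * t * sin theta ^+ 2)) * t)) * x).

Definition kappa_LL_low (lambda beta : R) (ell : R -> R) (r tau : R) : R :=
  expR (- ((\int[leb]_(t in `[r, +oo[)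
             (lambda * expR (- (beta * t)) / (1 + tau^-1 * ell r / ell t) * t))
           * (4 * \int[leb]_(theta in `[0, pi / 2])
                    expR (beta * r * cos theta ^+ 2)))).

Definition besselI (n : nat) (x : R) : R :=
  limn (series (fun k : nat =>
    (x / 2) ^+ (2 * k + n) / (k`!%:R * (k + n)`!%:R))).

End lap_model.

(* Main.v *)
Require Import Defs.
From HB Require Import structures.
From mathcomp Require Import ring lra zify.
Set Implicit Arguments.
Unset Strict Implicit.
Unset Printing Implicit Defensive.
Import Order.TTheory GRing.Theory Num.Theory.
Import numFieldNormedType.Exports.
Local Open Scope classical_set_scope.
Local Open Scope ring_scope.

(** Independent marking turns the probability that no blockage meets a set into the mean of
    prod_k (1 - h (X_k)), where h c is the probability that a blockage centred at c meets it.
    For simple h the Poisson counts give exp (- mu \int h); approximation, with a Campbell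
    bound controlling the tails, extends this to integrable h.  By Tonelli, \int h is the mean
    over length and orientation of the area of the centres whose segment meets the set.  In
    direction phi that area is l r |sin (phi - psi)| for one link, which yields exp (- beta r).
    For two links it is at least l times the length of the union of their shadows, two
    intervals with common endpoint 0, and averaging over phi yields the maximally correlated
    bound on the joint probability.
    The bounds on g_L, A_L and kappa_LL follow by monotonicity, the integrals of the bound
    being rewritten by cos^2 + sin^2 = 1 and the double angle formula.  The closed forms come
    from \int_0^(pi/2) exp (z cos 2t) dt = (pi / 2) I_0 z, a termwise integration of the
    exponential series, and from an explicit primitive of t e^(- beta t / 2) I_0 (beta t / 2). *)

(** * Independence and product laws *)

Section independence_theory.
Context d (Om : measurableType d) (R : realType) (P : probability Om R).

(** The [X k] are an arbitrary enumeration of the points: only their counts in sets are known, and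
    they need not be independent of one another. Statements on the centres therefore go through
    finite products over [k < n] and a limit that has to be justified. The marks, in contrast, are
    independent of the whole sequence of centres, so they can be averaged out one blockage at a time
    with the centres kept. The factor 1 + cos theta of the maximally correlated bound comes from a
    sign. When the two links lie on opposite sides of the direction phi, their shadows meet only at
    0 and their lengths add; on the same side only the shadow of the longer link is kept. The sign
    telling these cases apart, multiplied by the sine attached to the shorter link, integrates to 2
    cos theta over [0, pi]. Measurability of the joint probability in length and angle is not
    established. The final comparisons therefore rest on monotonicity of the integral of nonnegative
    functions without measurability, and they check that the larger side is finite, since the
    real-valued integral sends +oo to 0. *)

Lemma independent_sigma_algebra (G : set_system Om) (B : set Om) :
  setI_closed G -> (forall A, G A -> measurable A) -> measurable B ->
  (forall A, G A -> P (A `&` B) = (P A * P B)%E) ->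
  forall A, <<s G >> A -> P (A `&` B) = (P A * P B)%E.
Proof.
move=> GI Gm mB GB.
have sGm A : <<s G >> A -> measurable A.
  by apply: smallest_sub => //; exact: sigma_algebra_measurable.
apply: (@dynkin_induction _ (g_sigma_algebraType G) G) => //.
- by rewrite setTI probability_setT mul1e.
- move=> S /sGm mS PS.
  rewrite (_ : ~` S `&` B = B `\` (B `&` S)); last first.
    by rewrite setDIr setDv set0U setDE setIC.
  rewrite measureD//; [|exact: measurableI|exact: le_lt_trans (probability_le1 _ mB) (ltry _)].
  rewrite setIA setIid [X in (_ - P X)%E]setIC PS probability_setC//.
  by rewrite muleBl ?mul1e ?fin_num_measure ?fin_num_adde_defr//.
- move=> F mF tF IH.
  have mF' n : d.-measurable (F n : set Om) by exact: sGm (mF n).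
  rewrite setI_bigcupl !measure_bigcup//=.
  + under eq_eseriesr do rewrite IH.
    rewrite -(fineK (fin_num_measure P _ mB)) muleC -nneseriesZl//.
    by apply: eq_eseriesr => n _; rewrite muleC.
  + by move=> n _; exact: measurableI.
  + exact: trivIset_setIr.
Qed.

(** Mutual independence speaks of finite families only. Finite intersections of events with indices
    other than [i] form a pi-system, since two index sets can be merged after padding with [setT];
    Dynkin induction then reaches the generated sigma-algebra. *)
Lemma mutually_independent_others (I : choiceType) (F : I -> set_system Om) :
  (forall i, F i setT) -> (forall i, setI_closed (F i)) ->
  (forall i A, F i A -> measurable A) -> mutually_independent P F ->
  forall i A B, <<s \bigcup_(j in [set j | j != i]) F j >> A -> F i B ->
    P (A `&` B) = (P A * P B)%E.
Proof.
move=> FT FI Fm indF i A B sA FB.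
pose G := [set A | exists (J : {fset I}) (E : I -> set Om),
  [/\ i \notin J, forall j, F j (E j) & A = \bigcap_(j in [set` J]) E j]].
have Gm C : G C -> measurable C.
  move=> [J [E [_ FE ->]]]; apply: fin_bigcap_measurable => // j _.
  by apply: Fm (FE j).
have GI : setI_closed G.
  move=> _ _ [J [E [iJ FE ->]]] [J' [E' [iJ' FE' ->]]].
  exists (J `|` J')%fset, (fun j => (if j \in J then E j else setT) `&`
      (if j \in J' then E' j else setT)); split.
  - by rewrite in_fsetU negb_or iJ.
  - by move=> j; apply: FI; case: ifPn.
  - apply/seteqP; split => w.
      move=> [wE wE'] j _; split; case: ifPn => // jJ; [exact: wE|exact: wE'].
    move=> wEE; split => j /= jJ.
      by have [] := wEE j; rewrite /= ?inE ?jJ.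
    by have [] := wEE j; rewrite /= ?inE ?jJ ?orbT.
have GB C : G C -> P (C `&` B) = (P C * P B)%E.
  move=> [J [E [iJ FE ->]]].
  have neq j : j \in J -> (j == i) = false by move=> jJ; apply: contraNF iJ => /eqP <-.
  have /= := indF (i |` J)%fset (fun j => if j == i then B else E j) _.
  rewrite big_fsetU1//= eqxx => IJ.
  have EB : \bigcap_(j in [set` (i |` J)%fset]) (if j == i then B else E j) =
      \bigcap_(j in [set` J]) E j `&` B.
    apply/seteqP; split => w.
      move=> wE; split.
        by move=> j /= jJ; have := wE j; rewrite /= neq// inE jJ orbT; exact.
      by have := wE i; rewrite /= eqxx; apply; rewrite !inE eqxx.
    by move=> [wE wB] j; rewrite /= !inE => /orP[/eqP ->|jJ]; rewrite ?eqxx ?neq//; exact: wE.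
  rewrite -EB IJ; last by move=> j _; case: eqP => // ->.
  rewrite indF// muleC; congr (_ * _)%E.
  by apply: eq_fbigr => j jJ _; rewrite neq.
apply: (independent_sigma_algebra GI Gm (Fm i B FB) GB).
move: A sA; apply: smallest_sub; first exact: smallest_sigma_algebra.
move=> C [j /= ji FC]; apply: sub_sigma_algebra.
exists [fset j]%fset, (fun k => if k == j then C else setT); split.
- by rewrite inE eq_sym.
- by move=> k; case: eqP => // ->.
- apply/seteqP; split => w; first by move=> wC k /=; rewrite inE => ->.
  by move=> /(_ j); rewrite /= inE eqxx; exact.
Qed.

(** By uniqueness of the product measure, independence makes the law of [(U, V)] the product of the
    two laws, and Tonelli applies. *)
Lemma integral_independent d1 d2 (T1 : measurableType d1) (T2 : measurableType d2)
    (U : {mfun Om >-> T1}) (V : {mfun Om >-> T2}) (f : T1 * T2 -> \bar R) :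
  (forall A B, measurable A -> measurable B ->
    P (U @^-1` A `&` V @^-1` B) = (P (U @^-1` A) * P (V @^-1` B))%E) ->
  measurable_fun setT f -> (forall x, 0 <= f x)%E ->
  (\int[P]_w f (U w, V w) =
   \int[P]_w \int[distribution P V]_v f (U w, v))%E.
Proof.
move=> UV mf f0.
pose W w := (U w, V w).
have mW : measurable_fun setT W by exact: measurable_fun_pair.
pose WM : {mfun Om >-> (T1 * T2)%type} := HB.pack W (isMeasurableFun.Build _ _ _ _ W mW).
transitivity (\int[distribution P WM]_x f x)%E.
  by rewrite ge0_integral_pushforward//.
transitivity (\int[(distribution P U \x distribution P V)%E]_x f x)%E.
  apply: eq_measure_integral => A mA _.
  by apply/esym/product_measure_unique => // B C mB mC; exact: UV.
rewrite fubini_tonelli1// ge0_integral_pushforward//; last first.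
- by move=> x _; apply: integral_ge0.
- exact: measurable_fun_fubini_tonelli_F.
Qed.

End independence_theory.

(** * Replacing one independent variable by its mean *)

Section conditioning.
Context d (Om : measurableType d) (R : realType) (P : probability Om R).

Lemma sigma_algebra_setI_closed (F : set_system Om) :
  sigma_algebra setT F -> setI_closed F.
Proof.
move=> sF A B; rewrite -(sigma_algebra_id sF) => FA FB.
exact: (@measurableI _ (g_sigma_algebraType F) A B FA FB).
Qed.

Lemma sigma_algebra_setT (F : set_system Om) : sigma_algebra setT F -> F setT.
Proof. by move=> [F0 FC _]; rewrite -(setD0 setT); exact: FC. Qed.

Context (I : choiceType) (F : I -> set_system Om).
Hypothesis sF : forall i, sigma_algebra setT (F i).
Hypothesis mF : forall i A, F i A -> measurable A.
Hypothesis indF : mutually_independent P F.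

(** The sample space with a coarser sigma-algebra. Being determined by the indices other than [i]
    becomes measurability of a function on this type. *)
Definition others (i : I) := g_sigma_algebraType (\bigcup_(j in [set j | j != i]) F j).

Lemma measurable_others i (A : set Om) : @measurable _ (others i) A -> measurable A.
Proof.
apply: smallest_sub; first exact: sigma_algebra_measurable.
by move=> B [j _]; exact: mF.
Qed.

Lemma measurable_fun_others i j d2 (T2 : measurableType d2) (V : Om -> T2) :
  j != i -> sigma_of V `<=` F j -> measurable_fun setT (V : others i -> T2).
Proof.
move=> ji VF _ B mB; apply: sub_sigma_algebra; exists j => //.
by apply: VF; exists B.
Qed.

(** The variable independent of [V] is the outcome itself, read through the coarser sigma-algebra:
    [U] is the identity from [Om] to [others i]. *)
Lemma integral_mutually_independent i d2 (T2 : measurableType d2)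
    (V : {mfun Om >-> T2}) (f : others i * T2 -> \bar R) :
  sigma_of V `<=` F i -> measurable_fun setT f -> (forall x, 0 <= f x)%E ->
  (\int[P]_w f (w, V w) = \int[P]_w \int[distribution P V]_v f (w, v))%E.
Proof.
move=> VF mf f0.
have mid : measurable_fun setT (id : Om -> others i).
  by move=> _ A mA; rewrite setTI; exact: measurable_others mA.
pose U : {mfun Om >-> others i} := HB.pack (id : Om -> others i)
  (isMeasurableFun.Build _ _ _ _ (id : Om -> others i) mid).
apply: (integral_independent (U := U)) => // A B mA mB.
apply: (mutually_independent_others _ _ _ indF mA).
- by move=> j; exact: sigma_algebra_setT.
- by move=> j; exact: sigma_algebra_setI_closed.
- exact: mF.
- by apply: VF; exists B; rewrite ?setTI.
Qed.

Lemma integral_unit_bounded d2 (T2 : measurableType d2) (nu : probability T2 R) (f : T2 -> R) :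
  measurable_fun setT f -> (forall x, 0 <= f x <= 1) ->
  [/\ (\int[nu]_x (f x)%:E = (\int[nu]_x f x)%:E)%E, 0 <= \int[nu]_x f x & \int[nu]_x f x <= 1].
Proof.
move=> mf f01.
have f0 : (0 <= \int[nu]_x (f x)%:E)%E.
  by apply: integral_ge0 => x _; rewrite lee_fin; have /andP[] := f01 x.
have f1 : (\int[nu]_x (f x)%:E <= 1)%E.
  rewrite -(@probability_setT _ _ _ nu) -[leRHS]mul1e -integral_cst//.
  apply: ge0_le_integral => //.
  - by move=> x _; rewrite lee_fin; have /andP[] := f01 x.
  - exact/measurable_EFinP.
  - by move=> x _; rewrite lee_fin; have /andP[] := f01 x.
have ffin : (\int[nu]_x (f x)%:E)%E \is a fin_num.
  by rewrite ge0_fin_numE// (le_lt_trans f1)// ltry.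
by split; rewrite /Rintegral ?fineK -?lee_fin ?fineK.
Qed.

Lemma measurable_fun_Rintegral d1 d2 (T1 : measurableType d1) (T2 : measurableType d2)
    (nu : probability T2 R) (f : T1 * T2 -> R) :
  measurable_fun setT f -> (forall x, 0 <= f x) ->
  measurable_fun setT (fun x => \int[nu]_y f (x, y)).
Proof.
move=> mf f0; apply: (measurableT_comp (fine_measurable measurableT)).
apply: (@measurable_fun_fubini_tonelli_F _ _ _ _ _ nu (fun xy => (f xy)%:E)).
  exact/measurable_EFinP.
by move=> x; rewrite lee_fin.
Qed.

(** Conditional expectation in elementary form: [Y] and [W] ignore index [i], so the mark [V] can be
    integrated under its law with both frozen. The weight [W] carries the remaining factors of a
    product. *)
Lemma integral_mark i d2 d3 (T2 : measurableType d2) (T3 : measurableType d3)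
    (V : {mfun Om >-> T2}) (nu : probability T2 R) (Y : others i -> T3)
    (W : others i -> R) (u : T3 * T2 -> R) :
  sigma_of V `<=` F i ->
  (forall B, measurable B -> distribution P V B = nu B) ->
  measurable_fun setT Y -> measurable_fun setT W -> (forall w, 0 <= W w) ->
  measurable_fun setT u -> (forall x, 0 <= u x <= 1) ->
  (\int[P]_w (W w * u (Y w, V w))%:E =
   \int[P]_w (W w * \int[nu]_v u (Y w, v))%:E)%E.
Proof.
move=> VF Vnu mY mW W0 mu u01.
have mY' : measurable_fun setT (fun x : others i * T2 => (Y x.1, x.2)).
  apply: measurable_fun_pair; last exact: measurable_snd.
  exact: measurableT_comp mY (@measurable_fst _ _ _ _).
pose f (x : others i * T2) := (W x.1 * u (Y x.1, x.2))%:E.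
have mf : measurable_fun setT f.
  apply/measurable_EFinP/measurable_funM; last exact: measurableT_comp mu mY'.
  exact: measurableT_comp mW (@measurable_fst _ _ _ _).
rewrite (integral_mutually_independent (f := f) VF mf); last first.
  by move=> x; rewrite lee_fin mulr_ge0//; have /andP[] := u01 (Y x.1, x.2).
apply: eq_integral => w _; rewrite (eq_measure_integral nu)//=; last first.
  by move=> A mA _; exact: Vnu.
have mYu : measurable_fun setT (fun v => u (Y w, v)).
  exact: measurableT_comp mu (pair1_measurable _).
rewrite EFinM; have [<- _ _] := integral_unit_bounded nu mYu (fun v => u01 (Y w, v)).
rewrite -ge0_integralZl_EFin// => [v _|]; first by rewrite lee_fin; have /andP[] := u01 (Y w, v).
exact/measurable_EFinP.
Qed.

End conditioning.

(** * Averaging out lengths and orientations *)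

Section marks.
Context d (Om : measurableType d) (R : realType) (P : probability Om R).
Variables (mu : R) (X : nat -> {RV P >-> (R * R)%type}) (L Phi : nat -> {RV P >-> R}).
Hypothesis model : boolean_model mu X L Phi.
Local Notation F := (blockage_sigma X L Phi).

Lemma sigma_algebra_blockage i : sigma_algebra setT (F i).
Proof.
case: i => [[k|k]|] /=.
- exact/sigma_algebra_preimage/sigma_algebra_measurable.
- exact/sigma_algebra_preimage/sigma_algebra_measurable.
- exact: smallest_sigma_algebra.
Qed.

Lemma measurable_blockage i A : F i A -> measurable A.
Proof.
case: i => [[k|k]|] /=.
- by move=> [B mB <-]; exact: measurable_funPT.
- by move=> [B mB <-]; exact: measurable_funPT.
- apply: smallest_sub; first exact: sigma_algebra_measurable.
  by move=> B [k _] [C mC <-]; exact: measurable_funPT.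
Qed.

Let FX := g_sigma_algebraType (\bigcup_k sigma_of (X k)).

Lemma measurable_fun_centers i d2 (T2 : measurableType d2) (W : FX -> T2) :
  i != None -> measurable_fun setT W -> measurable_fun setT (W : others F i -> T2).
Proof.
move=> iN mW _ B mB; apply: sub_sigma_algebra; exists None; first by rewrite /= eq_sym.
exact: mW.
Qed.

Lemma measurable_center k : measurable_fun setT (X k : FX -> R * R).
Proof.
by move=> _ B mB; apply: sub_sigma_algebra; exists k => //; exists B.
Qed.

Lemma measurable_center_others k i : i != None ->
  measurable_fun setT (X k : others F i -> R * R).
Proof. by move=> iN; apply: measurable_fun_centers => //; exact: measurable_center. Qed.

Lemma measurable_length_others k i : i != Some (inl k) ->
  measurable_fun setT (L k : others F i -> R).
Proof. by move=> ik; apply: (measurable_fun_others (j := Some (inl k))); rewrite // eq_sym. Qed.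

Lemma measurable_orientation_others k i : i != Some (inr k) ->
  measurable_fun setT (Phi k : others F i -> R).
Proof. by move=> ik; apply: (measurable_fun_others (j := Some (inr k))); rewrite // eq_sym. Qed.

Variable u : (R * R) * R * R -> R.
Hypothesis mu_ : measurable_fun setT u.
Hypothesis u01 : forall x, 0 <= u x <= 1.

Let mean_Phi cl := \int[distribution P (Phi 0%N)]_p u (cl, p).

Definition mark_mean (c : R * R) : R :=
  \int[distribution P (L 0%N)]_l \int[distribution P (Phi 0%N)]_p u (c, l, p).

Let mmean_Phi : measurable_fun setT mean_Phi.
Proof. by apply: measurable_fun_Rintegral => // x; have /andP[] := u01 x. Qed.

Let mean_Phi01 cl : 0 <= mean_Phi cl <= 1.
Proof.
have mucl : measurable_fun setT (fun p => u (cl, p)).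
  exact: measurableT_comp mu_ (pair1_measurable _).
by have [_ -> ->] := integral_unit_bounded (distribution P (Phi 0%N)) mucl (fun p => u01 (cl, p)).
Qed.

Lemma measurable_mark_mean : measurable_fun setT mark_mean.
Proof. by apply: (measurable_fun_Rintegral _ mmean_Phi) => x; have /andP[] := mean_Phi01 x. Qed.

Lemma mark_mean01 c : 0 <= mark_mean c <= 1.
Proof.
have muc : measurable_fun setT (fun l => mean_Phi (c, l)).
  exact: measurableT_comp mmean_Phi (pair1_measurable _).
by have [_ -> ->] := integral_unit_bounded (distribution P (L 0%N)) muc (fun l => mean_Phi01 (c, l)).
Qed.

(** Integrating out the last orientation and then the last length leaves [mark_mean (X n w)], which
    depends on the centres only and can be absorbed into [W]. The induction is on [n] with [W]
    general for that reason. *)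
Lemma integral_prod_marks n (W : FX -> R) :
  measurable_fun setT W -> (forall w, 0 <= W w) ->
  (\int[P]_w (W w * \prod_(k < n) u (X k w, L k w, Phi k w))%:E =
   \int[P]_w (W w * \prod_(k < n) mark_mean (X k w))%:E)%E.
Proof.
have indF := marks_independent model.
elim: n W => [|n IHn] W mW W0.
  by apply: eq_integral => w _; rewrite !big_ord0.
pose W1 w := W w * \prod_(k < n) u (X k w, L k w, Phi k w).
have W10 w : 0 <= W1 w.
  by rewrite mulr_ge0// prodr_ge0// => k _; have /andP[] := u01 (X k w, L k w, Phi k w).
(* [W1] involves the centres and the marks of index below [n], so it is measurable with respect to
   everything except the [n]-th length, and likewise the [n]-th orientation. *)
have mW1 (i : option (nat + nat)) : i != None ->
    (forall k : 'I_n, i != Some (inl (k : nat)) /\ i != Some (inr (k : nat))) ->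
    measurable_fun setT (W1 : others F i -> R).
  move=> iN ik; apply: measurable_funM; first exact: measurable_fun_centers.
  apply: measurable_prod => k _; have [ikl ikr] := ik k.
  apply: (measurableT_comp mu_); apply: measurable_fun_pair; last exact: measurable_orientation_others.
  by apply: measurable_fun_pair; [exact: measurable_center_others|exact: measurable_length_others].
transitivity (\int[P]_w (W1 w * mean_Phi (X n w, L n w))%:E)%E.
  under eq_integral do rewrite big_ord_recr/= mulrA.
  apply: (integral_mark (nu := distribution P (Phi 0%N)) (i := Some (inr n))
    sigma_algebra_blockage measurable_blockage indF
    (V := Phi n) (Y := fun w : others F (Some (inr n)) => (X n w, L n w)) (W := W1)) => //.
  - by move=> B mB; exact: etrans (orientations_uniform model n mB) (esym (orientations_uniform model 0 mB)).
  - by apply: measurable_fun_pair; [exact: measurable_center_others|exact: measurable_length_others].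
  - by apply: mW1 => // k; split=> //; apply/eqP => -[] /eqP; rewrite gtn_eqF.
transitivity (\int[P]_w (W1 w * mark_mean (X n w))%:E)%E.
  apply: (integral_mark (nu := distribution P (L 0%N)) (i := Some (inl n))
    sigma_algebra_blockage measurable_blockage indF
    (V := L n) (Y := fun w : others F (Some (inl n)) => X n w) (W := W1)) => //.
  - by move=> B mB; rewrite (lengths_id model).
  - exact: measurable_center_others.
  - by apply: mW1 => // k; split=> //; apply/eqP => -[] /eqP; rewrite gtn_eqF.
under eq_integral do rewrite mulrAC.
rewrite (IHn (fun w => W w * mark_mean (X n w))).
- by apply: eq_integral => w _; rewrite big_ord_recr/= mulrAC mulrA.
- by apply: measurable_funM => //; apply: (measurableT_comp measurable_mark_mean); exact: measurable_center.
- by move=> w; rewrite mulr_ge0//; have /andP[] := mark_mean01 (X n w).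
Qed.

End marks.

(** * Mean and generating function of the Poisson counts *)

Section poisson_counts.
Context (R : realType).

Lemma eseries_exp (a : R) : 0 <= a ->
  (\sum_(n <oo) (a ^+ n / n`!%:R)%:E = (expR a)%:E)%E.
Proof.
move=> a0; rewrite /expR -EFin_lim; last exact: is_cvg_series_exp_coeff.
apply: congr_lim; apply/funext => n /=.
by rewrite sumEFin.
Qed.

Lemma eseries_poisson (c a : R) : 0 <= c -> 0 <= a ->
  (\sum_(n <oo) (c * (expR (- a) * a ^+ n / n`!%:R))%:E = c%:E)%E.
Proof.
move=> c0 a0.
under eq_eseriesr do rewrite -!mulrA [X in (X)%:E]mulrA EFinM.
rewrite nneseriesZl; last by move=> n _; rewrite lee_fin divr_ge0// exprn_ge0.
by rewrite eseries_exp// -EFinM -mulrA -expRD addNr expR0 mulr1.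
Qed.

Context d (Om : measurableType d) (P : probability Om R).
Variables (mu : R) (X : nat -> {RV P >-> (R * R)%type}).
Hypothesis mu0 : 0 < mu.
Hypothesis hX : homogeneous_ppp mu X.

Lemma measurable_nb_points B : measurable B -> measurable_fun setT (nb_points X B).
Proof.
move=> mB; apply: ge0_emeasurable_sum => [k w _ _|k _].
  by rewrite diracE lee_fin.
rewrite (_ : (fun w => _) = EFin \o (\1_B \o X k)); last first.
  by apply/funext => w /=; rewrite diracE indicE.
by apply/measurable_EFinP; apply: measurableT_comp => //; exact: measurable_indic.
Qed.

Section one_set.
Variable B : set (R * R).
Hypothesis mB : measurable B.
Hypothesis fB : (area B < +oo)%E.
Let a := mu * fine (area B).

Let a0 : 0 <= a. Proof. by apply: mulr_ge0; [exact: ltW|exact: fine_ge0]. Qed.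

Let E n := [set w | nb_points X B w = n%:R%:E].

Let mE n : measurable (E n).
Proof.
rewrite -[E n]setTI; apply: (measurable_nb_points mB measurableT (Y := [set n%:R%:E])).
exact: emeasurable_set1.
Qed.

Let trivE : trivIset setT E.
Proof.
apply/trivIsetP => i j _ _ ij; apply/seteqP; split => // w [].
by rewrite /E /= => -> [/eqP]; rewrite eqr_nat (negbTE ij).
Qed.

(** The Poisson weights sum to 1, so the events of a finite integer count exhaust the mass and an
    infinite count has probability 0. *)
Lemma nb_points_finite : P (\bigcup_n E n) = 1%E.
Proof.
rewrite measure_bigcup//= -[RHS](eseries_poisson ler01 a0).
under eq_eseriesl do rewrite in_setT.
by apply: eq_eseriesr => n _; rewrite mul1r; exact: (hX.1 B mB fB n).
Qed.

Lemma integral_nb_points (phi : R -> R) :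
  measurable_fun setT phi -> (forall x, 0 <= phi x) ->
  (\int[P]_w (phi (fine (nb_points X B w)))%:E =
   \sum_(n <oo) (phi n%:R * (expR (- a) * a ^+ n / n`!%:R))%:E)%E.
Proof.
move=> mphi phi0.
have mD : measurable (\bigcup_n E n) by exact: bigcup_measurable.
have mf : measurable_fun setT (fun w => (phi (fine (nb_points X B w)))%:E).
  apply/measurable_EFinP; apply: measurableT_comp => //.
  by apply: (measurableT_comp (fine_measurable measurableT)); exact: measurable_nb_points.
have mfD A : measurable_fun A (fun w => (phi (fine (nb_points X B w)))%:E).
  exact: measurable_funTS.
(* [fine] turns an infinite count into 0, but this happens inside the null complement split off
   here. *)
rewrite -(setUv (\bigcup_n E n)) ge0_integral_setU//=; last 3 first.
- exact: measurableC.
- by move=> w _; rewrite lee_fin.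
- by rewrite disj_set2E setICr.
rewrite [X in (_ + X)%E]null_set_integral//; [|exact: measurableC|]; last first.
  by rewrite [LHS]probability_setC// nb_points_finite subee.
rewrite adde0 ge0_integral_bigcup//; last by move=> w _; rewrite lee_fin.
apply: eq_eseriesr => n _.
transitivity (\int[P]_(w in E n) (phi n%:R)%:E)%E.
  by apply: eq_integral => w; rewrite inE => ->.
by rewrite integral_cst// [in RHS]EFinM; congr (_ * _)%E; exact: (hX.1 B mB fB n).
Qed.

Lemma expectation_nb_points : (\int[P]_w (fine (nb_points X B w))%:E = a%:E)%E.
Proof.
(* The absolute value makes the integrated function nonnegative on all of [R], as
   [integral_nb_points] asks. *)
transitivity (\int[P]_w (`|fine (nb_points X B w)|)%:E)%E.
  apply: eq_integral => w _; rewrite ger0_norm// fine_ge0//.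
  by apply: nneseries_ge0 => k _ _; rewrite diracE lee_fin.
rewrite (integral_nb_points (phi := Num.norm))//.
rewrite nneseries_recl//; last first.
  by move=> n _; rewrite lee_fin !mulr_ge0 ?expR_ge0 ?exprn_ge0.
rewrite normr0 mul0r add0e -[RHS](@eseries_poisson a a)//.
rewrite -nneseries_addn; last first.
  by move=> n; rewrite lee_fin !mulr_ge0 ?expR_ge0 ?exprn_ge0.
apply: eq_eseriesr => n _; rewrite addn1 ger0_norm// factS natrM exprS.
have n1 : n.+1%:R != 0 :> R by rewrite pnatr_eq0.
have nf : n`!%:R != 0 :> R by rewrite pnatr_eq0 -lt0n fact_gt0.
by congr (_ %:E); field; rewrite nf nat1r n1.
Qed.

(** Up to a constant factor, the Poisson weights of parameter [a] multiplied by (1 - v)^n are those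
    of parameter [a * (1 - v)]. The real power accepts the exponent [fine _] and agrees with the
    integer power on the counts, also at v = 1, where 0 to the power 0 is 1. *)
Lemma laplace_nb_points (v : R) : 0 <= v <= 1 ->
  (\int[P]_w ((1 - v) `^ fine (nb_points X B w))%:E = (expR (- (mu * (v * fine (area B)))))%:E)%E.
Proof.
move=> /andP[v0 v1].
rewrite (integral_nb_points (phi := powR (1 - v))); last 2 first.
- exact: measurable_powRr.
- by move=> x; exact: powR_ge0.
rewrite -[RHS](@eseries_poisson _ (a * (1 - v))) ?expR_ge0 ?(mulr_ge0 a0) ?subr_ge0//.
have -> : expR (- a) = expR (- (mu * (v * fine (area B)))) * expR (- (a * (1 - v))).
  by rewrite -expRD /a; congr expR; ring.
apply: eq_eseriesr => n _; rewrite powR_mulrn ?subr_ge0// (exprMn n a); congr (_ %:E); ring.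
Qed.

End one_set.
End poisson_counts.

(** * Means of products of independent variables *)

Section independent_products.
Context d (Om : measurableType d) (R : realType) (P : probability Om R).
Context (I : choiceType) d2 (T2 : measurableType d2) (Y : I -> {mfun Om >-> T2}).
Hypothesis indY : mutually_independent P (fun i => sigma_of (Y i)).
Variable phi : I -> T2 -> R.
Hypothesis mphi : forall i, measurable_fun setT (phi i).
Hypothesis phi01 : forall i y, 0 <= phi i y <= 1.

Lemma integral_prod_independent (s : seq I) : uniq s ->
  (\int[P]_w (\prod_(i <- s) phi i (Y i w))%:E =
   (\prod_(i <- s) \int[P]_w phi i (Y i w))%:E)%E.
Proof.
have sY i : sigma_algebra setT (sigma_of (Y i)).
  exact/sigma_algebra_preimage/sigma_algebra_measurable.
have mY i A : sigma_of (Y i) A -> measurable A.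
  by move=> [B mB <-]; exact: measurable_funPT.
have mphiY i : measurable_fun setT (phi i \o Y i) by exact: measurableT_comp.
elim: s => [_|i s IHs /= /andP[iNs us]].
  under eq_integral do rewrite big_nil.
  by rewrite big_nil integral_cst//= [P _]probability_setT mule1.
pose W (w : others (fun i => sigma_of (Y i)) i) := \prod_(j <- s) phi j (Y j w).
transitivity (\int[P]_w (W w * phi i (Y i w))%:E)%E.
  by apply: eq_integral => w _; rewrite big_cons mulrC.
(* [integral_mark] is used with a trivial kept variable, of type [unit]: the factor removed depends
   on [Y i] alone. *)
have phi01' (x : unit * T2) : 0 <= phi i x.2 <= 1 by [].
rewrite (integral_mark sY mY indY (i := i) (V := Y i) (nu := distribution P (Y i))
  (u := fun x : unit * T2 => phi i x.2) (Y := fun=> tt) (W := W))//; last 3 first.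
- apply: measurable_prod => j js; apply: measurableT_comp => //.
  apply: (measurable_fun_others (j := j)) => //.
  by apply: contraNneq iNs => <-.
- by move=> w; apply: prodr_ge0 => j _; have /andP[] := phi01 j (Y j w).
- by apply: measurableT_comp => //; exact: measurable_snd.
have -> /= : \int[distribution P (Y i)]_y phi i y = \int[P]_w phi i (Y i w).
  rewrite /Rintegral ge0_integral_pushforward//.
  - exact/measurable_EFinP.
  - by move=> y _; rewrite lee_fin; have /andP[] := phi01 i y.
under eq_integral do rewrite mulrC EFinM.
rewrite ge0_integralZl_EFin//.
- by rewrite (IHs us) big_cons EFinM.
- move=> w _; rewrite lee_fin; apply: prodr_ge0 => j _; by have /andP[] := phi01 j (Y j w).
- by apply/measurable_EFinP; apply: measurable_prod => j _; exact: mphiY.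
- by rewrite Rintegral_ge0// => w _; have /andP[] := phi01 i (Y i w).
Qed.

End independent_products.

(** * Laplace functional of finite combinations of indicators *)

Section laplace_simple.
Context (R : realType) d (Om : measurableType d) (P : probability Om R).
Variables (mu : R) (X : nat -> {RV P >-> (R * R)%type}).
Hypothesis mu0 : 0 < mu.
Hypothesis hX : homogeneous_ppp mu X.

(** The partial counts are integers converging to an integer; once within distance 1 of it they are
    equal to it. *)
Lemma nb_points_stationary B w m : nb_points X B w = m%:R%:E ->
  \forall n \near \oo, (\sum_(k < n) (X k w \in B) = m)%N.
Proof.
move=> Nm.
have : (fun n => (\sum_(k < n) (X k w \in B))%N%:R%:E : \bar R) @ \oo --> (m%:R%:E : \bar R).
  rewrite -Nm /nb_points.
  rewrite (_ : (fun n => _) = (fun n => \sum_(0 <= k < n) \d_(X k w) B)%E).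
    by apply: is_cvg_nneseries => k _ _; rewrite diracE lee_fin.
  apply/funext => n; rewrite big_mkord natr_sum -sumEFin.
  by apply: eq_bigr => k _; rewrite diracE.
move=> /fine_cvgP[_] /cvgrPdist_lt /(_ 1 ltr01) [n0 _ h].
exists n0 => // n /h /=; rewrite distrC.
set c := (\sum_(k < n) _)%N; rewrite ltr_distlC => /andP[].
rewrite ltrBlDr !natr1 !ltr_nat !ltnS => ? ?.
by lia.
Qed.

Variables (m : nat) (B : 'I_m -> set (R * R)) (v : 'I_m -> R).
Hypothesis mB : forall i, measurable (B i).
Hypothesis fB : forall i, (area (B i) < +oo)%E.
Hypothesis tB : trivIset setT B.
Hypothesis v01 : forall i, 0 <= v i <= 1.

Let g x := \sum_(i < m) v i * \1_(B i) x.

Let onem_g x : 1 - g x = \prod_(i < m) (1 - v i) ^+ (x \in B i).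
Proof.
have [[i xB]|nB] := pselect (exists i, B i x).
  have out j : j != i -> (x \in B j) = false.
    move=> ji; apply/negP; rewrite inE => xBj.
    by move/trivIsetP : tB => /(_ _ _ I I ji); apply/eqP/set0P; exists x.
  rewrite /g (bigD1 i)//= [RHS](bigD1 i)//= !big1 ?addr0 ?mulr1.
  - by rewrite indicE mem_set// mulr1 expr1.
  - by move=> j /out ->.
  - by move=> j /out xj; rewrite indicE xj mulr0.
have out j : (x \in B j) = false by apply/negP; rewrite inE => xBj; apply: nB; exists j.
by rewrite /g !big1 ?subr0// => j _; rewrite ?indicE out// mulr0.
Qed.

(** Each factor 1 - g (X k) is a power of the single 1 - v i whose set contains the point, if any.
    Regrouping by [i] gives the exponent [i] the count in [B i]. Almost surely all counts are
    finite, so the partial products are eventually constant; domination by 1 moves the limit inside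
    the mean, and independence of the counts over disjoint sets factors it. *)
Lemma cvg_laplace_simple :
  (fun n => \int[P]_w (\prod_(k < n) (1 - g (X k w)))%:E)%E @ \oo -->
  (expR (- (mu * \sum_(i < m) v i * fine (area (B i)))))%:E.
Proof.
(* The absolute value keeps each factor in [0, 1] at every extended real, not only at values of a
   count. *)
pose f w := (\prod_(i < m) (1 - v i) `^ `|fine (nb_points X (B i) w)|)%:E.
have onem_v i : 0 <= 1 - v i <= 1.
  by have /andP[? ?] := v01 i; rewrite subr_ge0 lerBlDr lerDl; apply/andP.
have onem_g01 x : 0 <= 1 - g x <= 1.
  rewrite onem_g; apply/andP; split.
    by apply: prodr_ge0 => i _; apply: exprn_ge0; have /andP[] := onem_v i.
  by apply: prodr_ile1 => i _; rewrite exprn_ge0 ?exprn_ile1//; have /andP[] := onem_v i.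
have mN i : measurable_fun setT (nb_points X (B i)) by exact: measurable_nb_points.
have mg : measurable_fun setT g.
  apply: measurable_sum => i; apply: measurable_funM => //; exact: measurable_indic.
have ifE : (\int[P]_w f w)%E = (expR (- (mu * \sum_(i < m) v i * fine (area (B i)))))%:E.
  pose N i : {mfun Om >-> \bar R} := HB.pack (nb_points X (B i))
    (isMeasurableFun.Build _ _ _ _ (nb_points X (B i)) (mN i)).
  have indN : mutually_independent P (fun i => sigma_of (N i)) := hX.2 m B mB tB.
  have mphi i : measurable_fun setT (fun y : \bar R => (1 - v i) `^ `|fine y|).
    apply: (measurableT_comp (measurable_powRr _)).
    by apply: measurableT_comp => //; exact: fine_measurable.
  have phi01 i (y : \bar R) : 0 <= (1 - v i) `^ `|fine y| <= 1.
    rewrite powR_ge0/=; have /andP[z0 z1] := onem_v i.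
    have := ge0_ler_powR (normr_ge0 (fine y)) _ _ z1.
    by rewrite powR1; apply; rewrite nnegrE.
  rewrite /f (integral_prod_independent indN mphi phi01) ?index_enum_uniq//.
  rewrite mulr_sumr -sumrN expR_sum; congr (_ %:E); apply: eq_bigr => i _.
  rewrite /Rintegral; under eq_integral => w _.
    rewrite ger0_norm; last first.
      by rewrite fine_ge0//; apply: nneseries_ge0 => k _ _; rewrite diracE lee_fin.
    over.
  by rewrite (laplace_nb_points mu0 hX).
rewrite -ifE.
have mF n : measurable_fun setT (fun w => (\prod_(k < n) (1 - g (X k w)))%:E).
  apply/measurable_EFinP/measurable_prod => k _.
  by apply: measurable_funB => //; exact: measurableT_comp.
have [||||_ _ //] := @dominated_convergence _ _ _ P setT measurableT _ f (cst 1%:E) mF.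
- apply/measurable_EFinP/measurable_prod => i _.
  apply: (measurableT_comp (measurable_powRr _)); apply: measurableT_comp => //.
  by apply: (measurableT_comp (fine_measurable measurableT)).
- have aeN i : \forall w \ae P, exists n, nb_points X (B i) w = n%:R%:E.
    pose E n := [set w | nb_points X (B i) w = n%:R%:E].
    exists (~` \bigcup_n E n); split.
    + apply: measurableC; apply: bigcup_measurable => n _.
      by rewrite -[E n]setTI; apply: (mN i measurableT [set n%:R%:E]); exact: emeasurable_set1.
    + rewrite [LHS]probability_setC ?(nb_points_finite mu0 hX (mB i) (fB i)) ?subee//.
      apply: bigcup_measurable => n _.
      by rewrite -[E n]setTI; apply: (mN i measurableT [set n%:R%:E]); exact: emeasurable_set1.
    + by move=> w /=; apply: contra_not => -[n _ Ew]; exists n.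
  apply: filterS (filter_forall _ aeN) => w /(_ _)/cid-/all_sig[N EN] _.
  apply: cvg_near_cst; have /filter_forall := fun i => nb_points_stationary (EN i).
  apply: filterS => n cn; congr (_ %:E).
  under eq_bigr do rewrite onem_g.
  rewrite exchange_big; apply: eq_bigr => i _.
  rewrite EN /= ger0_norm// powR_mulrn -?cn; last by have /andP[] := onem_v i.
  by elim/big_rec2 : _ => // k x y _ ->; rewrite exprD.
- by apply: finite_measure_integrable_cst.
- apply: aeW => w n _; rewrite /= lee_fin ger0_norm.
    by apply: prodr_ile1 => k _; exact: onem_g01.
  by apply: prodr_ge0 => k _; have /andP[] := onem_g01 (X k w).
Qed.

End laplace_simple.

(** * Laplace functional of integrable functions *)

Section laplace_functional.
Import HBSimple HBNNSimple.
Context (R : realType) d (Om : measurableType d) (P : probability Om R).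
Variables (mu : R) (X : nat -> {RV P >-> (R * R)%type}).
Hypothesis mu0 : 0 < mu.
Hypothesis hX : homogeneous_ppp mu X.
Local Notation mR := (measurableTypeR R).
Local Notation leb2 := (@lebesgue_measure R \x @lebesgue_measure R)%E.

(** The left side is the mean number of points in [B] among the first [n], and the full count has
    mean mu times the area. *)
Lemma sum_prob_center_le n (B : set (R * R)) : measurable B ->
  (\sum_(k < n) P (X k @^-1` B) <= mu%:E * area B)%E.
Proof.
move=> mB; have [Boo|] := eqVneq (area B) +oo%E.
  by rewrite Boo gt0_muley ?lte_fin// leey.
rewrite -ltey => fB.
have a0 : (0 <= area B)%E by exact: measure_ge0.
have -> : (mu%:E * area B)%E = (\int[P]_w (fine (nb_points X B w))%:E)%E.
  by rewrite (expectation_nb_points mu0 hX mB fB) EFinM fineK// ge0_fin_numE.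
have mXB k : measurable (X k @^-1` B) by rewrite -[X in measurable X]setTI; exact: measurable_funP.
have N0 w : (0 <= nb_points X B w)%E.
  by apply: nneseries_ge0 => k _ _; rewrite diracE lee_fin.
have -> : (\sum_(k < n) P (X k @^-1` B) = \int[P]_w (\sum_(k < n) \d_(X k w) B))%E.
  rewrite ge0_integral_sum//.
  - apply: eq_bigr => k _; rewrite -[in LHS](setIT (X k @^-1` B)) -integral_indic//.
  - move=> k; rewrite (_ : (fun w => _) = EFin \o (\1_B \o X k)); last first.
      by apply/funext => w /=; rewrite diracE indicE.
    by apply/measurable_EFinP; apply: measurableT_comp => //; exact: measurable_indic.
apply: ae_ge0_le_integral => //.
- by move=> w _; apply: sume_ge0 => k _; rewrite diracE lee_fin.
- apply: emeasurable_sum => k; rewrite (_ : (fun w => _) = EFin \o (\1_B \o X k)); last first.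
    by apply/funext => w /=; rewrite diracE indicE.
  by apply/measurable_EFinP; apply: measurableT_comp => //; exact: measurable_indic.
- by move=> w _; rewrite lee_fin fine_ge0.
- apply/measurable_EFinP; apply: (measurableT_comp (fine_measurable measurableT)).
  exact: measurable_nb_points.
pose E m := [set w | nb_points X B w = m%:R%:E].
have mE : measurable (\bigcup_m E m).
  apply: bigcup_measurable => m _; rewrite -[E m]setTI.
  by apply: (measurable_nb_points X mB measurableT (Y := [set m%:R%:E])); exact: emeasurable_set1.
exists (~` \bigcup_m E m); split; first exact: measurableC.
  by rewrite [LHS]probability_setC// (nb_points_finite mu0 hX mB fB) subee.
(* Off the null event the count is finite, hence unchanged by [fine], and it bounds its partial
   sums. *)
move=> w /=; apply: contra_not => -[m _ Em] _.
rewrite fineK; last by rewrite Em.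
rewrite /nb_points -(big_mkord xpredT (fun k => \d_(X k w) B)).
by apply: nneseries_lim_ge => k _ _; rewrite diracE lee_fin.
Qed.

(** The laws of the first [n] centres add up to a measure below mu times the area. The bound is
    uniform in [n], which is what the approximation argument needs. *)
Lemma campbell_le n (f : mR * mR -> R) : measurable_fun setT f -> (forall x, 0 <= f x) ->
  (\sum_(k < n) \int[P]_w (f (X k w))%:E <= mu%:E * \int[leb2]_x (f x)%:E)%E.
Proof.
move=> mf f0.
have mfE : measurable_fun setT (EFin \o f) by exact/measurable_EFinP.
have mX k : measurable_fun setT (X k : Om -> mR * mR) by have := measurable_funP (X k); exact.
pose Y k : {mfun Om >-> (mR * mR)%type} := HB.pack (X k : Om -> mR * mR)
  (isMeasurableFun.Build _ _ _ _ (X k : Om -> mR * mR) (mX k)).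
have -> : (\sum_(k < n) \int[P]_w (f (X k w))%:E =
    \int[msum (fun k => distribution P (Y k)) n]_x (f x)%:E)%E.
  rewrite ge0_integral_measure_sum//; last by move=> x _; rewrite lee_fin.
  apply: eq_bigr => k _; rewrite ge0_integral_pushforward//.
  by move=> x _; rewrite lee_fin.
rewrite -[X in (X%:E * _)%E]/((NngNum (ltW mu0))%:num) -ge0_integral_mscale//; last first.
  by move=> x _; rewrite lee_fin.
apply: ge0_le_measure_integral => // S mS.
exact: sum_prob_center_le.
Qed.

Lemma cvg_laplace_nnsfun (g : {nnsfun (mR * mR)%type >-> R}) (V : R) :
  (forall x, g x <= 1) -> (\int[leb2]_x (g x)%:E = V%:E)%E ->
  (fun n => \int[P]_w (\prod_(k < n) (1 - g (X k w)))%:E)%E @ \oo -->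
  (expR (- (mu * V)))%:E.
Proof.
move=> g1 gV.
(* The value 0 is discarded because its level set may have infinite area; the other level sets have
   finite area since the integral of [g] is finite. *)
pose s := [seq y <- finmap.enum_fset (fset_set (range g)) | y != 0].
have us : uniq s by rewrite filter_uniq//; exact: fset_uniq.
pose v (i : 'I_(size s)) := s`_i.
pose B i := g @^-1` [set v i].
have sP y : reflect (y != 0 /\ exists x, g x = y) (y \in s).
  apply: (iffP idP); rewrite mem_filter in_fset_set//.
    by move=> /andP[-> ]; rewrite inE => -[x _ <-]; split => //; exists x.
  by move=> [-> [x <-]]; rewrite inE; exists x.
have v0 i : 0 < v i.
  have /sP[vi0 [x xvi]] : v i \in s by exact: mem_nth.
  rewrite lt_neqAle eq_sym vi0/= -xvi; exact: fun_ge0.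
have v1 i : v i <= 1.
  by have /sP[_ [x <-]] : v i \in s by exact: mem_nth.
have mB i : measurable (B i) by exact: measurable_sfunP.
have tB : trivIset setT B.
  apply/trivIsetP => i j _ _ ij; apply/seteqP; split => // x [].
  rewrite /B /= => -> vij; case/eqP : ij; apply/val_inj.
  by move/eqP : vij; rewrite /v nth_uniq ?ltn_ord// => /eqP.
have gE x : g x = \sum_i v i * \1_(B i) x.
  have [gx0|gx0] := eqVneq (g x) 0.
    rewrite big1// => i _; rewrite indicE memNset ?mulr0// /B /= gx0 => vi0.
    by have := v0 i; rewrite -vi0 ltxx.
  have xs : g x \in s by apply/sP; split => //; exists x.
  have xi : (index (g x) s < size s)%N by rewrite index_mem.
  have vx : v (Ordinal xi) = g x by rewrite /v /= nth_index.
  rewrite (bigD1 (Ordinal xi))//= big1 ?addr0.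
    by rewrite indicE mem_set ?mulr1.
  move=> i ix; rewrite indicE memNset ?mulr0// /B /= => gxi.
  by case/eqP : ix; apply/val_inj; rewrite /= gxi index_uniq.
have gVE : (\sum_i (v i)%:E * area (B i) = V%:E)%E.
  rewrite -gV; under [RHS]eq_integral do rewrite gE -sumEFin.
  rewrite ge0_integral_sum//.
  - apply: eq_bigr => i _; under eq_integral do rewrite EFinM.
    have mI : measurable_fun setT (fun x : mR * mR => (\1_(B i) x : R)%:E).
      by apply/measurable_EFinP; exact: measurable_indic.
    rewrite (ge0_integralZl_EFin leb2 measurableT _ mI (ltW (v0 i))); last first.
      by move=> x _; rewrite lee_fin.
    by rewrite (integral_indic leb2 measurableT (mB i)) setIT.
  - move=> i; apply/measurable_EFinP; apply: measurable_funM => //; exact: measurable_indic.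
  - by move=> i x _; rewrite lee_fin mulr_ge0// ltW.
have fB i : (area (B i) < +oo)%E.
  rewrite ltey; apply/negP => /eqP Boo; move: gVE; rewrite (bigD1 i)//= Boo gt0_muley ?lte_fin//.
  rewrite addye// -ltNye (lt_le_trans (ltNyr 0))//; apply: sume_ge0 => j _.
  by apply: mule_ge0; [rewrite lee_fin ltW|exact: (measure_ge0 leb2)].
have v01 i : 0 <= v i <= 1 by rewrite ltW/=.
have := cvg_laplace_simple mu0 hX mB fB tB v01.
rewrite (_ : \sum_(i < size s) _ = V); last first.
  apply: EFin_inj; rewrite -gVE -sumEFin; apply: eq_bigr => i _.
  rewrite EFinM fineK// ge0_fin_numE//; exact: (measure_ge0 leb2).
by under eq_fun do under eq_integral do under eq_bigr do rewrite -gE.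
Qed.


(** Factors are replaced one at a time; those left in place lie in [0, 1] and can only shrink the
    difference. *)
Lemma prod_sub_le_sum n (a b : nat -> R) :
  (forall k, 0 <= a k <= b k) -> (forall k, b k <= 1) ->
  \prod_(k < n) b k - \prod_(k < n) a k <= \sum_(k < n) (b k - a k).
Proof.
move=> ab b1; elim: n => [|n IHn]; first by rewrite !big_ord0 subrr.
rewrite !big_ord_recr /=; set B := \prod_(k < n) b k; set A := \prod_(k < n) a k.
have A0 : 0 <= A by apply: prodr_ge0 => k _; have /andP[] := ab k.
have A1 : A <= 1.
  by apply: prodr_ile1 => k _; have /andP[-> /le_trans->] := ab k.
have B0 : 0 <= B by apply: prodr_ge0 => k _; have /andP[/le_trans] := ab k; apply.
have AB : A <= B by apply: ler_prod => k _; exact: ab.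
have /andP[an abn] := ab n; have bn := b1 n.
have -> : B * b n - A * a n = (B - A) * b n + A * (b n - a n) by ring.
rewrite lerD//.
- rewrite (le_trans _ IHn)// ler_piMr ?subr_ge0//.
- by rewrite ler_piMl ?subr_ge0.
Qed.

Lemma expRN_lipschitz (x y : R) : 0 <= x <= y -> 0 <= expR (- x) - expR (- y) <= y - x.
Proof.
move=> /andP[x0 xy]; rewrite subr_ge0 ler_expR lerN2 xy/=.
have -> : - y = - x - (y - x) by ring.
rewrite expRD -[X in X - _]mulr1 -mulrBr.
have ex : expR (- x) <= 1 by rewrite expR_le1 oppr_le0.
have := expR_ge1Dx (- (y - x)) => e1.
have e2 : expR (- (y - x)) <= 1 by rewrite expR_le1 oppr_le0 subr_ge0.
rewrite (le_trans (ler_piMl _ ex)) ?subr_ge0//.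
by rewrite lerBlDr addrC -lerBlDr.
Qed.

Lemma cvg_laplace (h : mR * mR -> R) (V : R) : measurable_fun setT h ->
  (forall x, 0 <= h x <= 1) -> (\int[leb2]_x (h x)%:E = V%:E)%E ->
  (fun n => \int[P]_w (\prod_(k < n) (1 - h (X k w)))%:E)%E @ \oo -->
  (expR (- (mu * V)))%:E.
Proof.
move=> mh h01 hV.
have h0 x : 0 <= h x by have /andP[] := h01 x.
have mX k : measurable_fun setT (X k : Om -> mR * mR) by have := measurable_funP (X k); exact.
pose prd (g : mR * mR -> R) n w := \prod_(k < n) (1 - g (X k w)).
have mprd (g : mR * mR -> R) n : measurable_fun setT g -> measurable_fun setT (prd g n).
  move=> mg; apply: measurable_prod => k _; apply: measurable_funB => //.
  exact: (measurableT_comp mg (mX k)).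
have prd01 (g : mR * mR -> R) n w : (forall x, 0 <= g x <= 1) -> 0 <= prd g n w <= 1.
  move=> g01; have g01' x : 0 <= 1 - g x <= 1.
    by have /andP[? ?] := g01 x; rewrite subr_ge0 lerBlDr lerDl; apply/andP.
  apply/andP; split; last by apply: prodr_ile1 => k _; exact: g01'.
  by apply: prodr_ge0 => k _; have /andP[] := g01' (X k w).
pose a g n := \int[P]_w prd g n w.
have aE (g : mR * mR -> R) n : measurable_fun setT g -> (forall x, 0 <= g x <= 1) ->
    (\int[P]_w (prd g n w)%:E = (a g n)%:E)%E.
  move=> mg g01; by have [] := integral_unit_bounded P (mprd g n mg) (fun w => prd01 g n w g01).
suff : a h @ \oo --> expR (- (mu * V)).
  move=> ah; rewrite (_ : (fun n => _) = EFin \o a h); last first.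
    by apply/funext => n; exact: aE.
  by apply/cvg_EFin => //; exact: nearW.
apply/cvgrPdist_lt => e e0.
(* With [g] below [h] and integrals this close, passing from [h] to [g] costs at most e / 4 in the
   products, by Campbell, and e / 4 in the limits, by the Lipschitz bound. Convergence for [g] costs
   another e / 4. *)
have e4 : 0 < e / (4 * mu) by rewrite divr_gt0 ?mulr_gt0.
have [g gh [Vg [gVg VgV Vge]]] : exists2 g : {nnsfun (mR * mR)%type >-> R},
    (forall x, g x <= h x) &
    exists Vg, [/\ (\int[leb2]_x (g x)%:E = Vg%:E)%E, Vg <= V & V - e / (4 * mu) < Vg].
  have hsup := ge0_integralTE leb2 (fun x => h0 x : (0 <= (h x)%:E)%E).
  rewrite /= hV in hsup; set S := (X in ereal_sup X) in hsup.
  have Sfin : ereal_sup S \is a fin_num by rewrite -hsup.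
  have [_ [g /= gh <-]] := ub_ereal_sup_adherent e4 Sfin.
  rewrite -hsup -integralT_nnsfun => Vg.
  have gV : (\int[leb2]_x (g x)%:E <= V%:E)%E.
    rewrite -hV; apply: ge0_le_integral => //.
    + by move=> x _; rewrite lee_fin.
    + exact/measurable_EFinP.
    + exact/measurable_EFinP.
  have gfin : (\int[leb2]_x (g x)%:E)%E \is a fin_num.
    rewrite ge0_fin_numE ?(le_lt_trans gV) ?ltry//.
    by apply: integral_ge0 => x _; rewrite lee_fin.
  exists g; first by move=> x; have := gh x; rewrite lee_fin.
  exists (fine (\int[leb2]_x (g x)%:E)%E); rewrite fineK//; split => //.
    by rewrite -lee_fin fineK.
  by rewrite -lte_fin fineK// EFinB.
have g0 x : 0 <= g x by exact: fun_ge0.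
have g01 x : 0 <= g x <= 1.
  by rewrite g0 (le_trans (gh x))//; have /andP[] := h01 x.
have mg : measurable_fun setT g by exact: measurable_funP.
have Vg0 : 0 <= Vg.
  by rewrite -lee_fin -gVg; apply: integral_ge0 => x _; rewrite lee_fin.
have mhg : measurable_fun setT (fun x => h x - g x) by exact: measurable_funB.
have hg0 x : 0 <= h x - g x by rewrite subr_ge0.
have ihg : (\int[leb2]_x (h x - g x)%:E = (V - Vg)%:E)%E.
  have : (\int[leb2]_x (h x)%:E = \int[leb2]_x (g x)%:E + \int[leb2]_x (h x - g x)%:E)%E.
    rewrite -ge0_integralD//.
    + by apply: eq_integral => x _; rewrite -EFinD addrC subrK.
    + by move=> x _; rewrite lee_fin.
    + exact/measurable_EFinP.
    + by move=> x _; rewrite lee_fin.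
    + exact/measurable_EFinP.
  rewrite hV gVg; case: (\int[leb2]_x (h x - g x)%:E)%E => //= r.
  by rewrite -EFinD => -[->]; rewrite addrC addKr.
have hg n : a h n <= a g n <= a h n + mu * (V - Vg).
  rewrite -!lee_fin EFinD -!aE//; apply/andP; split.
    apply: ge0_le_integral => //.
    + by move=> w _; rewrite lee_fin; have /andP[] := prd01 h n w h01.
    + by apply/measurable_EFinP; exact: mprd.
    + by apply/measurable_EFinP; exact: mprd.
    + move=> w _; rewrite lee_fin; apply: ler_prod => k _.
      by rewrite lerD2l lerN2 gh subr_ge0 andbT; have /andP[] := h01 (X k w).
  rewrite EFinM -ihg.
  apply: le_trans (leeD2l _ (campbell_le n mhg hg0)).
  have mhgX k : measurable_fun setT (fun w => (h (X k w) - g (X k w))%:E).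
    by apply/measurable_EFinP; exact: (measurableT_comp mhg (mX k)).
  rewrite -ge0_integral_sum//; last by move=> k w _; rewrite lee_fin.
  rewrite -ge0_integralD//; last 4 first.
  + by move=> w _; rewrite lee_fin; have /andP[] := prd01 h n w h01.
  + by apply/measurable_EFinP; exact: mprd.
  + by move=> w _; apply: sume_ge0 => k _; rewrite lee_fin.
  + exact: emeasurable_sum.
  apply: ge0_le_integral => //.
  + by move=> w _; rewrite lee_fin; have /andP[] := prd01 g n w g01.
  + by apply/measurable_EFinP; exact: mprd.
  + apply: emeasurable_funD; last exact: emeasurable_sum.
    by apply/measurable_EFinP; exact: mprd.
  move=> w _; rewrite sumEFin -EFinD lee_fin -lerBlDl.
  have := @prod_sub_le_sum n (fun k => 1 - h (X k w)) (fun k => 1 - g (X k w)).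
  have -> : \sum_(k < n) (h (X k w) - g (X k w)) =
      \sum_(k < n) (1 - g (X k w) - (1 - h (X k w))).
    by apply: eq_bigr => k _; ring.
  apply=> k; last by rewrite gerBl.
  by rewrite lerD2l lerN2 gh subr_ge0 andbT; have /andP[] := h01 (X k w).
have /cvgrPdist_lt/(_ (e / 4)) : a g @ \oo --> expR (- (mu * Vg)).
  suff : EFin \o a g @ \oo --> (expR (- (mu * Vg)))%:E by move/fine_cvgP => [].
  have := cvg_laplace_nnsfun (fun x => (elimT andP (g01 x)).2) gVg.
  have <- : (fun n => \int[P]_w (prd g n w)%:E)%E = EFin \o a g by apply/funext => k; exact: aE.
  exact.
have e40 : 0 < e / 4 by rewrite divr_gt0.
move=> /(_ e40) [n0 _ an]; exists n0 => // n /an; rewrite /= !ltr_distl => /andP[].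
have /andP[] := hg n.
have muV : 0 <= mu * Vg <= mu * V by rewrite mulr_ge0 ?(ltW mu0)//= ler_pM2l.
have /andP[] := expRN_lipschitz muV.
have : mu * (V - Vg) < e / 4.
  by rewrite mulrC -ltr_pdivlMr// ltrBlDl -ltrBlDr (le_lt_trans _ Vge)// invfM mulrA.
rewrite mulrBr => *.
by apply/andP; split; lra.
Qed.

End laplace_functional.

(** * Void probability of the marked process *)

Section void_probability.
Context (R : realType) d (Om : measurableType d) (P : probability Om R).
Variables (mu : R) (X : nat -> {RV P >-> (R * R)%type}) (L Phi : nat -> {RV P >-> R}).
Hypothesis mu0 : 0 < mu.
Hypothesis model : boolean_model mu X L Phi.
Local Notation mR := (measurableTypeR R).
Local Notation leb2 := (@lebesgue_measure R \x @lebesgue_measure R)%E.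

Lemma mark_mean_onem (u : (R * R) * R * R -> R) c : measurable_fun setT u ->
  (forall x, 0 <= u x <= 1) ->
  mark_mean L Phi (fun x => 1 - u x) c = 1 - mark_mean L Phi u c.
Proof.
move=> mu_ u01; rewrite /mark_mean.
have onem (nu : probability R R) (f : R -> R) : measurable_fun setT f -> (forall x, 0 <= f x <= 1) ->
    \int[nu]_x (1 - f x) = 1 - \int[nu]_x f x.
  move=> mf f01; apply: EFin_inj.
  have [fE _ _] := integral_unit_bounded nu mf f01.
  have mf' : measurable_fun setT (fun x => 1 - f x) by exact: measurable_funB.
  have f01' x : 0 <= 1 - f x <= 1.
    by have /andP[? ?] := f01 x; rewrite subr_ge0 lerBlDr lerDl; apply/andP.
  have [fE' _ _] := integral_unit_bounded nu mf' f01'.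
  have : (\int[nu]_x (1 - f x)%:E + \int[nu]_x (f x)%:E = 1)%E.
    rewrite -ge0_integralD//.
    - under eq_integral do rewrite -EFinD subrK.
      by rewrite integral_cst//= [nu _]probability_setT mule1.
    - by move=> x _; rewrite lee_fin; have /andP[] := f01' x.
    - exact/measurable_EFinP.
    - by move=> x _; rewrite lee_fin; have /andP[] := f01 x.
    - exact/measurable_EFinP.
  by rewrite fE fE' -EFinD => -[h]; congr EFin; apply/eqP; rewrite eq_sym subr_eq h.
have mucl cl : measurable_fun setT (fun p => u (cl, p)).
  exact: measurableT_comp mu_ (pair1_measurable _).
rewrite -onem.
- by congr Rintegral; apply/funext => l; rewrite onem.
- have := @measurable_fun_Rintegral _ _ _ _ _ (distribution P (Phi 0%N)) u mu_ _.
  move=> h; apply: (measurableT_comp (h _) (pair1_measurable c)) => x.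
  by have /andP[] := u01 x.
- by move=> l; have [_ -> ->] := integral_unit_bounded
    (distribution P (Phi 0%N)) (mucl (c, l)) (fun p => u01 (c, l, p)).
Qed.

Theorem void_probability (H : set ((R * R) * R * R)) (V : R) : measurable H ->
  (\int[leb2]_c \int[distribution P (L 0%N)]_l \int[distribution P (Phi 0%N)]_p
     (\1_H (c, l, p))%:E = V%:E)%E ->
  P [set w | forall k, ~ H (X k w, L k w, Phi k w)] = (expR (- (mu * V)))%:E.
Proof.
move=> mH HV.
have mI : measurable_fun setT (\1_H : _ -> R) by exact: measurable_indic.
have I01 x : 0 <= (\1_H x : R) <= 1 by rewrite indicE; case: (_ \in _); rewrite ?lexx ?ler01.
pose u x : R := 1 - \1_H x.
have mu_ : measurable_fun setT u by exact: measurable_funB.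
have u01 x : 0 <= u x <= 1.
  by have /andP[? ?] := I01 x; rewrite subr_ge0 lerBlDr lerDl; apply/andP.
pose h c := mark_mean L Phi (\1_H) c.
have mh : measurable_fun setT (h : mR * mR -> R) by exact: measurable_mark_mean.
have h01 c : 0 <= h c <= 1 by exact: mark_mean01.
have hV : (\int[leb2]_c (h c)%:E = V%:E)%E.
  rewrite -HV; apply: eq_integral => c _.
  have mIcl cl : measurable_fun setT (fun p => \1_H (cl, p) : R).
    exact: measurableT_comp mI (pair1_measurable _).
  pose k (cl : R * R * R) := \int[distribution P (Phi 0%N)]_p \1_H (cl, p).
  have mk : measurable_fun setT k.
    by apply: measurable_fun_Rintegral => // x; have /andP[] := I01 x.
  have k01 cl : 0 <= k cl <= 1.
    by have [_ -> ->] := integral_unit_bounded (distribution P (Phi 0%N)) (mIcl cl) (fun p => I01 (cl, p)).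
  have mkc : measurable_fun setT (fun l => k (c, l)).
    exact: measurableT_comp mk (pair1_measurable _).
  have [<- _ _] := integral_unit_bounded (distribution P (L 0%N)) mkc (fun l => k01 (c, l)).
  apply: eq_integral => l _.
  by have [] := integral_unit_bounded (distribution P (Phi 0%N)) (mIcl (c, l)) (fun p => I01 (c, l, p)).
(* These events involve finitely many blockages, as averaging the marks requires, and decrease to
   the target event, so continuity from above concludes. *)
pose E n := [set w | forall k, (k < n)%N -> ~ H (X k w, L k w, Phi k w)].
have EI : [set w | forall k, ~ H (X k w, L k w, Phi k w)] = \bigcap_n E n.
  apply/seteqP; split => w; first by move=> Hw n _ k _; exact: Hw.
  by move=> Ew k; exact: (Ew k.+1 I k (ltnSn k)).
have indE n w : \1_(E n) w = \prod_(k < n) u (X k w, L k w, Phi k w) :> R.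
  have uE k : u (X k w, L k w, Phi k w) = (~~ `[< H (X k w, L k w, Phi k w) >])%:R.
    rewrite /u indicE; case: asboolP => Hk; first by rewrite mem_set// subrr.
    by rewrite memNset// subr0.
  have [Ew|nEw] := pselect (E n w).
    rewrite indicE mem_set// big1// => k _; rewrite uE; case: asboolP => //.
    by move=> /Ew; rewrite ltn_ord => /(_ isT).
  rewrite indicE memNset//; have [k [kn Hk]] : exists k, (k < n)%N /\ H (X k w, L k w, Phi k w).
    by apply: contra_notP nEw => nex k kn Hk; apply: nex; exists k.
  by rewrite (bigD1 (Ordinal kn))//= uE asboolT// mul0r.
have mE n : measurable (E n).
  rewrite (_ : E n = ~` \big[setU/set0]_(k < n) [set w | H (X k w, L k w, Phi k w)]).
    apply: measurableC; apply: bigsetU_measurable => k _.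
    rewrite -[X in measurable X]setTI.
    apply: (_ : measurable_fun setT (fun w => (X k w, L k w, Phi k w))) => //.
    by apply: measurable_fun_pair => //; exact: measurable_fun_pair.
  rewrite -(bigcup_mkord n (fun k => [set w | H (X k w, L k w, Phi k w)])).
  apply/seteqP; split => w; first by move=> Ew [k /= kn]; exact: Ew.
  by move=> nE k kn Hk; apply: nE; exists k.
have PE n : P (E n) = (\int[P]_w (\prod_(k < n) (1 - h (X k w)))%:E)%E.
  have := integral_prod_marks model mu_ u01 n (W := fun=> 1) (measurable_cst _) (fun=> ler01).
  under eq_integral do rewrite mul1r -indE.
  under [RHS]eq_integral do rewrite mul1r; rewrite integral_indic// setIT => ->.
  by apply: eq_integral => w _; congr (_ %:E); apply: eq_bigr => k _; exact: mark_mean_onem.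
rewrite EI.
have PEn : P (E n) @[n --> \oo] --> P (\bigcap_n E n).
  apply: nonincreasing_cvg_mu => //.
  - by rewrite (le_lt_trans (probability_le1 _ _)) ?ltry.
  - exact: bigcap_measurable.
  - by move=> m n mn; apply/subsetPset => w Ew k km; apply: Ew; exact: leq_trans mn.
apply: (cvg_unique _ PEn) => //.
have := cvg_laplace mu0 (centers_ppp model) mh h01 hV.
by have <- : (fun n => P (E n)) = _ := funext PE.
Qed.

End void_probability.

(** * Affine change of variable on the line *)

Section affine_change.
Context (R : realType).
Local Notation mR := (measurableTypeR R).
Local Notation leb := (@lebesgue_measure R).

Lemma measurable_affine (k b : R) : measurable_fun setT ((fun x => k * x + b) : mR -> mR).
Proof.
apply: (_ : measurable_fun setT (fun x : R => k * x + b)).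
by apply: measurable_funD => //; exact: measurable_funM.
Qed.

Lemma lebesgue_measure_affine (k b : R) (A : set mR) : k != 0 -> measurable A ->
  (`|k|%:E * leb ((fun x => k * x + b)%R @^-1` A) = leb A)%E.
Proof.
move=> k0 mA.
pose f := (fun x => k * x + b) : mR -> mR.
pose m_ : {measure set mR -> \bar R} := mscale (NngNum (normr_ge0 k)) (pushforward leb f).
pose m := m_ (measurable_affine k b).
suff mE : leb A = m A by rewrite mE.
apply: lebesgue_measure_unique mA => X [[x y]/= _ <-].
rewrite /m /m_ /f /mscale /pushforward /=.
(* Uniqueness is tested on intervals open at the left and closed at the right. A negative slope
   exchanges the ends, hence the two shapes of preimage. *)
have [kneg|kpos|kz] := ltgtP k 0; last by rewrite kz eqxx in k0.
- rewrite [X in (_ * leb X)%E](_ : _ = `[(y - b) / k, (x - b) / k[%classic); last first.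
    apply/seteqP; split => z /=; rewrite !in_itv/= ler_ndivrMr// ltr_ndivlMr// => /andP[? ?];
      apply/andP; split; lra.
  rewrite !lebesgue_measure_itv/= !lte_fin ltr_ndivlMr// divfK// ltrD2r.
  case: ifPn => xy; last by rewrite mule0.
  by rewrite -!EFinB -EFinM ltr0_norm//; congr EFin; field.
- rewrite [X in (_ * leb X)%E](_ : _ = `](x - b) / k, (y - b) / k]%classic); last first.
    apply/seteqP; split => z /=; rewrite !in_itv/= ler_pdivlMr// ltr_pdivrMr// => /andP[? ?];
      apply/andP; split; lra.
  rewrite !lebesgue_measure_itv/= !lte_fin ltr_pdivlMr// divfK// ltrD2r.
  case: ifPn => xy; last by rewrite mule0.
  by rewrite -!EFinB -EFinM gtr0_norm//; congr EFin; field.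
Qed.

Lemma ge0_integral_affine (k b : R) (F : mR -> \bar R) : k != 0 ->
  measurable_fun setT F -> (forall x, 0 <= F x)%E ->
  (`|k|%:E * \int[leb]_x F (k * x + b)%R = \int[leb]_x F x)%E.
Proof.
move=> k0 mF F0.
pose f := (fun x => k * x + b) : mR -> mR.
pose m_ : {measure set mR -> \bar R} := mscale (NngNum (normr_ge0 k)) (pushforward leb f).
pose m := m_ (measurable_affine k b).
transitivity (\int[m]_x F x)%E.
  rewrite ge0_integral_mscale//=; congr (_ * _)%E.
  by rewrite ge0_integral_pushforward//; exact: measurable_affine.
by apply: eq_measure_integral => A mA _; exact: lebesgue_measure_affine.
Qed.

End affine_change.

(** * Area of a sheared strip *)

Section area_strip.
Context (R : realType).
Local Notation mR := (measurableTypeR R).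
Local Notation leb := (@lebesgue_measure R).
Local Notation leb2 := (@lebesgue_measure R \x @lebesgue_measure R)%E.

Lemma measurable_strip (w : R) (S : set R) (m : R -> R) :
  measurable S -> measurable_fun setT m ->
  measurable [set x : R * R | S x.2 /\ `|x.1 - m x.2| <= w].
Proof.
move=> mS mm.
have m2 : measurable_fun setT (fun x : R * R => m x.2).
  exact: measurableT_comp mm measurable_snd.
have mle : measurable_fun setT (fun x : R * R => `|x.1 - m x.2| <= w).
  apply: measurable_fun_ler => //; apply: measurableT_comp => //.
  by apply: measurable_funB => //; exact: measurable_fst.
rewrite (_ : [set _ | _] = snd @^-1` S `&` (fun x : R * R => `|x.1 - m x.2| <= w) @^-1` [set true]).
  apply: measurableI; rewrite -[X in measurable X]setTI; first exact: measurable_snd.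
  exact: mle.
by apply/seteqP; split.
Qed.

(** Cavalieri: for a fixed first coordinate, [q] is affine in the second one with slope [- c], so
    |c| times the area is computed in the coordinates (a, q). There the fibre over q in [S] is an
    interval of length 2 w |c|, wherever its midpoint [m q] lies, and |c| cancels. The freedom in
    [m] is what later treats two links at once. *)
Lemma area_strip (s c w : R) (S : set R) (m : R -> R) : c != 0 -> 0 <= w ->
  measurable S -> measurable_fun setT m ->
  let q (x : R * R) := x.1 * s - x.2 * c in
  area [set x | S (q x) /\ `|x.1 - m (q x)| <= w * `|c|] = ((2 * w)%:E * leb S)%E.
Proof.
move=> c0 w0 mS mm q.
pose B := [set x : R * R | S x.2 /\ `|x.1 - m x.2| <= w * `|c|].
have mB : measurable B by exact: measurable_strip.
pose G (x : mR * mR) := (\1_B x : R)%:E.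
have mG : measurable_fun setT G by apply/measurable_EFinP; exact: measurable_indic.
have G0 x : (0 <= G x)%E by rewrite lee_fin.
set A := [set x | _].
have mq : measurable_fun setT (fun x : R * R => (x.1, q x)).
  apply: measurable_fun_pair; first exact: measurable_fst.
  by apply: measurable_funB; exact: measurable_funM.
have mA : measurable A.
  by rewrite (_ : A = (fun x => (x.1, q x)) @^-1` B)// -[X in measurable X]setTI; exact: mq.
have c0' : - c != 0 by rewrite oppr_eq0.
have nc0 : (`|c|%:E != 0)%E by rewrite eqe normr_eq0.
have key : (`|c|%:E * area A = `|c|%:E * ((2 * w)%:E * leb S))%E.
  transitivity (\int[leb]_a \int[leb]_b G (a, b))%E.
    rewrite -[area A]/(leb2 A) -[A]setIT -integral_indic//.
    rewrite fubini_tonelli1//; last first.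
      by apply/measurable_EFinP; exact: measurable_indic.
    rewrite -ge0_integralZl//.
    - apply: eq_integral => a _; rewrite /fubini_F.
      have mGa : measurable_fun setT (fun b : mR => G (a, b)).
        exact: measurableT_comp mG (pair1_measurable a).
      rewrite -(ge0_integral_affine (a * s) c0' mGa)// normrN; congr (_ * _)%E.
      apply: eq_integral => b _; rewrite (_ : - c * b + a * s = q (a, b))// /q/=; ring.
    - apply: measurable_fun_fubini_tonelli_F => //.
      by apply/measurable_EFinP; exact: measurable_indic.
    - by move=> a _; apply: integral_ge0 => b _; rewrite lee_fin.
  rewrite fubini_tonelli//.
  transitivity (\int[leb]_q ((2 * w * `|c|)%:E * (\1_S q : R)%:E))%E.
    apply: eq_integral => x _.
    have [xS|xS] := boolP (x \in S).
      rewrite [in RHS]indicE xS mule1.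
      transitivity (\int[leb]_a (\1_(`[m x - w * `|c|, m x + w * `|c|]%classic) a : R)%:E)%E.
        apply: eq_integral => a _; rewrite /G !indicE; congr (_%:R%:E); congr nat_of_bool.
        apply/idP/idP; rewrite !inE /B/= in_itv/= ler_distl.
          by move=> [_]; lra.
        by rewrite inE in xS; split => //; lra.
      rewrite integral_indic// setIT [LHS]lebesgue_measure_itv/= lte_fin.
      have wc : 0 <= w * `|c| by rewrite mulr_ge0.
      case: ifPn => [_|]; first by rewrite -EFinB; congr EFin; ring.
      by rewrite -leNgt => h; congr EFin; lra.
    rewrite [in RHS]indicE (negbTE xS) mule0 integral0_eq// => a _.
    by rewrite /G indicE memNset// => -[] /mem_set; rewrite (negbTE xS).
  rewrite ge0_integralZl_EFin//.
  - by rewrite integral_indic// setIT muleA -EFinM mulrC.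
  - by apply/measurable_EFinP; exact: measurable_indic.
  - by rewrite mulr_ge0 ?mulr_ge0.
have : (`|c|^-1%:E * (`|c|%:E * area A) = `|c|^-1%:E * (`|c|%:E * ((2 * w)%:E * leb S)))%E.
  by rewrite key.
by rewrite !muleA -!EFinM mulVf ?normr_eq0// mul1r mul1e.
Qed.

End area_strip.

(** * Blockages that meet a link *)

Section hit_set.
Context (R : realType).
Implicit Types (psi r a b l p : R).

Definition hit_set psi r : set ((R * R) * R * R) :=
  [set x | blockage x.1.1 x.1.2 x.2 `&` link psi r !=set0].

(** The two supporting lines cross at one point, whose parameters [t] on the link and [s] on the
    blockage are given by Cramer's rule. The constraints on them are multiplied by sin^2 or |sin| to
    clear denominators without a case split on the sign. *)
Lemma hit_set_transverse psi r a b l p : sin (p - psi) != 0 ->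
  hit_set psi r ((a, b), l, p) <->
  0 <= (a * sin p - b * cos p) * sin (p - psi) <= r * sin (p - psi) ^+ 2 /\
  `|a * sin psi - b * cos psi| <= l / 2 * `|sin (p - psi)|.
Proof.
rewrite /hit_set /blockage /link /=; have := sinB p psi.
set D := sin (p - psi); set sp := sin p; set cp := cos p.
set ss := sin psi; set cs := cos psi => DE D0; split.
- move=> [_ [[s /= + <-] [t /=]]]; rewrite !in_itv/= => /andP[s1 s2] /andP[t0 tr] [ea eb].
  have {}ea : a = t * cs - s * cp by lra.
  have {}eb : b = t * ss - s * sp by lra.
  have -> : a * sp - b * cp = t * D by rewrite ea eb DE; ring.
  have -> : a * ss - b * cs = s * D by rewrite ea eb DE; ring.
  rewrite -mulrA -expr2 mulr_ge0 ?sqr_ge0//= ler_wpM2r ?sqr_ge0//; split => //.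
  by rewrite normrM ler_wpM2r// ler_norml; apply/andP; split; lra.
- move=> [/andP[q0 qr] hs]; pose t := (a * sp - b * cp) / D; pose s := (a * ss - b * cs) / D.
  have D2 : 0 < D ^+ 2 by rewrite exprn_even_gt0.
  exists (t * cs, t * ss); split.
    exists s; first by rewrite /= in_itv/= -ler_norml /s normrM normfV ler_pdivrMr ?normr_gt0.
    congr pair; apply: (mulIf D0).
      have -> : (a + s * cp) * D = a * D + s * D * cp by ring.
      have -> : t * cs * D = t * D * cs by ring.
      by rewrite !divfK// DE; ring.
    have -> : (b + s * sp) * D = b * D + s * D * sp by ring.
    have -> : t * ss * D = t * D * ss by ring.
    by rewrite !divfK// DE; ring.
  exists t => //=; rewrite in_itv/=; have tD : t * D = a * sp - b * cp by rewrite divfK.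
  apply/andP; split; rewrite -(ler_pM2r D2) ?mul0r// expr2 mulrA tD//.
Qed.

Lemma hit_set_parallel psi r a b l p : sin (p - psi) = 0 -> 0 <= r ->
  hit_set psi r ((a, b), l, p) <->
  [/\ a * sin p - b * cos p = 0, 0 <= l, - (l / 2) <= a * cos psi + b * sin psi
    & a * cos psi + b * sin psi <= r + l / 2].
Proof.
rewrite /hit_set /blockage /link /= => D0 r0; have := sinB p psi.
pose C := cos (p - psi).
have C2 : C ^+ 2 = 1 by rewrite -(cos2Dsin2 (p - psi)) D0 expr0n addr0.
have cpE : cos p = C * cos psi.
  by rewrite -[in LHS](subrK psi p) cosD D0 mul0r subr0.
have spE : sin p = C * sin psi.
  by rewrite -[in LHS](subrK psi p) sinD D0 mul0r add0r.
have u2 := cos2Dsin2 psi.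
rewrite D0 cpE spE; set ss := sin psi in u2 *; set cs := cos psi in u2 * => _; split.
- move=> [_ [[s /= + <-] [t /=]]]; rewrite !in_itv/= => /andP[s1 s2] /andP[t0 tr] [ea eb].
  have {}ea : a = t * cs - s * (C * cs) by lra.
  have {}eb : b = t * ss - s * (C * ss) by lra.
  have -> : a * cs + b * ss = (t - s * C) * (cs ^+ 2 + ss ^+ 2) by rewrite ea eb; ring.
  have : `|s * C| <= l / 2.
    have C1 : `|C| = 1 by apply/eqP; rewrite -sqrp_eq1// real_normK ?num_real// C2.
    by rewrite normrM C1 mulr1 ler_norml; apply/andP; split; lra.
  rewrite u2 mulr1 ler_norml => /andP[? ?]; split; [|lra|lra|lra].
  by rewrite ea eb; ring.
- move=> [q0 l0 t1 t2]; set tau := a * cs + b * ss in t1 t2.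
  (* The projection of [tau], the coordinate of the centre along the link, onto [0, r]: the point of
     the link nearest to the centre. *)
  pose t := Num.max 0 (Num.min r tau).
  have tP : [/\ 0 <= t, t <= r & `|t - tau| <= l / 2].
    rewrite /t; case: (leP r tau) => h1; [case: (leP 0 r) => h2|case: (leP 0 tau) => h2];
      by split; rewrite ?ler_distl; try (apply/andP; split); lra.
  have [t0 tr tt] := tP.
  have C0 : C != 0 by apply: contra_eq_neq C2 => ->; rewrite expr0n eq_sym oner_eq0.
  have q1 : a * ss = b * cs.
    by apply: (mulfI C0); apply/eqP; rewrite -subr_eq0 -q0; apply/eqP; ring.
  exists (t * cs, t * ss); split; last by exists t => //=; rewrite in_itv/= t0.
  exists (C * (t - tau)).
    have C1 : `|C| = 1 by apply/eqP; rewrite -sqrp_eq1// real_normK ?num_real// C2.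
    by rewrite /= in_itv/= -ler_norml normrM C1 mul1r.
  congr pair.
    have -> : a + C * (t - tau) * (C * cs) = a + C ^+ 2 * ((t - tau) * cs) by ring.
    have ->: a = a * (cs ^+ 2 + ss ^+ 2) by rewrite u2 mulr1.
    have -> : a * (cs ^+ 2 + ss ^+ 2) = a * cs ^+ 2 + (a * ss) * ss by ring.
    by rewrite C2 q1 /tau; ring.
  have -> : b + C * (t - tau) * (C * ss) = b + C ^+ 2 * ((t - tau) * ss) by ring.
  have ->: b = b * (cs ^+ 2 + ss ^+ 2) by rewrite u2 mulr1.
  have -> : b * (cs ^+ 2 + ss ^+ 2) = (b * cs) * cs + b * ss ^+ 2 by ring.
  by rewrite C2 -q1 /tau; ring.
Qed.

(** As defined, the set is a projection, quantified over points of two segments. The transverse and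
    parallel criteria eliminate the quantifiers and leave a boolean combination of inequalities
    between measurable functions. *)
Lemma measurable_hit_set psi r : 0 <= r -> measurable (hit_set psi r).
Proof.
move=> r0.
have ma : measurable_fun setT (fun x : (R * R) * R * R => x.1.1.1).
  exact: measurableT_comp measurable_fst (measurableT_comp measurable_fst measurable_fst).
have mb : measurable_fun setT (fun x : (R * R) * R * R => x.1.1.2).
  exact: measurableT_comp measurable_snd (measurableT_comp measurable_fst measurable_fst).
have ml : measurable_fun setT (fun x : (R * R) * R * R => x.1.2).
  exact: measurableT_comp measurable_snd measurable_fst.
have mp : measurable_fun setT (fun x : (R * R) * R * R => x.2) by exact: measurable_snd.
have msin : measurable_fun setT (@sin R).
  by apply: continuous_measurable_fun; exact: continuous_sin.
have mcos : measurable_fun setT (@cos R).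
  by apply: continuous_measurable_fun; exact: continuous_cos.
have msp : measurable_fun setT (fun x : (R * R) * R * R => sin x.2) by exact: measurableT_comp.
have mcp : measurable_fun setT (fun x : (R * R) * R * R => cos x.2) by exact: measurableT_comp.
have mD : measurable_fun setT (fun x : (R * R) * R * R => sin (x.2 - psi)).
  by apply: measurableT_comp => //; exact: measurable_funB.
have mq : measurable_fun setT (fun x : (R * R) * R * R => x.1.1.1 * sin x.2 - x.1.1.2 * cos x.2).
  by apply: measurable_funB; exact: measurable_funM.
pose f (x : (R * R) * R * R) :=
  if sin (x.2 - psi) == 0 then
    [&& x.1.1.1 * sin x.2 - x.1.1.2 * cos x.2 == 0, 0 <= x.1.2,
      - (x.1.2 / 2) <= x.1.1.1 * cos psi + x.1.1.2 * sin psi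
    & x.1.1.1 * cos psi + x.1.1.2 * sin psi <= r + x.1.2 / 2]
  else [&& 0 <= (x.1.1.1 * sin x.2 - x.1.1.2 * cos x.2) * sin (x.2 - psi),
      (x.1.1.1 * sin x.2 - x.1.1.2 * cos x.2) * sin (x.2 - psi) <= r * sin (x.2 - psi) ^+ 2 &
      `|x.1.1.1 * sin psi - x.1.1.2 * cos psi| <= x.1.2 / 2 * `|sin (x.2 - psi)| ].
have mtau : measurable_fun setT (fun x : (R * R) * R * R => x.1.1.1 * cos psi + x.1.1.2 * sin psi).
  by apply: measurable_funD; exact: measurable_funM.
have ml2 : measurable_fun setT (fun x : (R * R) * R * R => x.1.2 / 2) by exact: measurable_funM.
have mf : measurable_fun setT f.
  apply: measurable_fun_ifT; first exact: measurable_fun_eqr.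
    do 3?apply: measurable_and; first exact: measurable_fun_eqr.
    - exact: measurable_fun_ler.
    - by apply: measurable_fun_ler => //; exact: measurableT_comp.
    - by apply: measurable_fun_ler => //; exact: measurable_funD.
  have mqD := measurable_funM mq mD.
  do 2?apply: measurable_and; first exact: measurable_fun_ler.
  - by apply: measurable_fun_ler => //; apply: measurable_funM => //; exact: measurable_funX.
  - apply: measurable_fun_ler.
      by apply: measurableT_comp => //; apply: measurable_funB; exact: measurable_funM.
    by apply: measurable_funM => //; exact: measurableT_comp.
rewrite (_ : hit_set psi r = f @^-1` [set true]).
  by rewrite -[X in measurable X]setTI; exact: mf.
apply/seteqP; split => -[[[a b] l] p].
  rewrite /preimage /= /f; case: eqP => [D0 /(hit_set_parallel _ _ _ D0 r0)[-> -> -> ->]|/eqP D0].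
    by rewrite eqxx.
  by move=> /(hit_set_transverse _ _ _ _ D0)[/andP[-> ->] ->].
rewrite /preimage /= /f; case: eqP => [D0|/eqP D0].
  move=> /and4P[/eqP ? ? ? ?]; exact/(hit_set_parallel _ _ _ D0 r0).
by move=> /and3P[h1 h2 h3]; apply/(hit_set_transverse _ _ _ _ D0); rewrite h1 h2.
Qed.

End hit_set.

(** * Sigma-finiteness of the area *)

Section plane_measure.
Context (R : realType).
Local Notation mR := (measurableTypeR R).
Local Notation leb := (@lebesgue_measure R).

(** A name for the product measure to which a sigma-finite structure can be attached, as Tonelli
    between the plane and the laws of the marks requires. The squares [F n] times [F n] exhaust the
    plane. *)
Definition plane_measure : set (mR * mR) -> \bar R := (leb \x leb)%E.

HB.instance Definition _ := Measure.copy plane_measure (leb \x leb)%E.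

Let plane_measure_sigma_finite : sigma_finite setT plane_measure.
Proof.
pose F (n : nat) : set R := `](- n%:R), n%:R]%classic.
exists (fun n => F n `*` F n).
  apply/esym/seteqP; split => // -[a b] _.
  pose m := Num.max `|a| `|b|.
  have [n mn] : exists n : nat, m < n%:R.
    by exists (Num.truncn m).+1; exact: truncnS_gt.
  have : `|a| < n%:R /\ `|b| < n%:R by split; apply: le_lt_trans mn; rewrite le_max lexx ?orbT.
  rewrite !ltr_norml => -[/andP[? ?] /andP[? ?]].
  by exists n => //; split; rewrite /F /= in_itv/=; apply/andP; split => //; exact: ltW.
move=> n; split; first by apply: measurableX; exact: measurable_itv.
have FE : (leb (F n) < +oo)%E.
  by rewrite /F lebesgue_measure_itv/= -EFinB; case: ifP; rewrite ltry.
rewrite [ltLHS]product_measure1E; do 2?exact: measurable_itv.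
have F0 : (0 <= leb (F n))%E by exact: measure_ge0.
by apply: lte_mul_pinfty; [exact: F0|rewrite ge0_fin_numE; [exact: FE|exact: F0]|exact: FE].
Qed.

HB.instance Definition _ := Measure_isSigmaFinite.Build _ _ _ plane_measure plane_measure_sigma_finite.

End plane_measure.

(** * Mean area over orientation and length *)

Section mean_volume.
Context (R : realType) d (Om : measurableType d) (P : probability Om R).
Variables (mu : R) (X : nat -> {RV P >-> (R * R)%type}) (L Phi : nat -> {RV P >-> R}).
Hypothesis model : boolean_model mu X L Phi.
Local Notation mR := (measurableTypeR R).
Local Notation leb := (@lebesgue_measure R).
Local Notation leb2 := (@plane_measure R).

Definition mean_area (H : set ((R * R) * R * R)) (l : R) : \bar R :=
  ((pi : R)^-1%:E * \int[leb]_(p in `[0%R, pi]) area [set c : R * R | H (c, l, p)])%E.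

Let indicH (H : set ((R * R) * R * R)) (x : (mR * mR) * mR * mR) : \bar R := (\1_H x : R)%:E.

Let mindicH H : measurable H -> measurable_fun setT (indicH H).
Proof. by move=> mH; apply/measurable_EFinP; exact: measurable_indic. Qed.

Let area_section H l p : measurable H ->
  (\int[leb2]_c indicH H (c, l, p) = area [set c : R * R | H (c, l, p)])%E.
Proof.
move=> mH; have mS : measurable [set c : mR * mR | H (c, l, p)].
  rewrite -[X in measurable X]setTI.
  have : measurable_fun setT (fun c : mR * mR => (c, l, p)).
    by apply: measurable_fun_pair => //; exact: measurable_fun_pair.
  by move=> /(_ measurableT H mH).
by rewrite -[area _]/(leb2 _) -[in RHS](setIT [set c | _]) -integral_indic.
Qed.

Let swap3 (H : set ((R * R) * R * R)) (x : (mR * mR) * (mR * mR)) : \bar R :=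
  indicH H (x.2, x.1.1, x.1.2).

Let mswap3 H : measurable H -> measurable_fun setT (swap3 H).
Proof.
move=> mH; apply: (measurableT_comp (mindicH mH)).
apply: measurable_fun_pair; last exact: measurableT_comp measurable_snd measurable_fst.
by apply: measurable_fun_pair; [exact: measurable_snd|exact: measurableT_comp measurable_fst measurable_fst].
Qed.

Let swap30 H x : (0 <= swap3 H x)%E. Proof. by rewrite lee_fin. Qed.

Lemma measurable_area_section (H : set ((R * R) * R * R)) : measurable H ->
  measurable_fun setT (fun lp : mR * mR => area [set c : R * R | H (c, lp.1, lp.2)]).
Proof.
move=> mH; have := measurable_fun_fubini_tonelli_F (m2 := leb2) _ (mswap3 mH) (@swap30 H).
congr (measurable_fun _ _); apply/funext => -[l p].
by rewrite /fubini_F -area_section.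
Qed.

Lemma mean_area_ge0 H l : (0 <= mean_area H l)%E.
Proof.
apply: mule_ge0; first by rewrite lee_fin invr_ge0 pi_ge0.
by apply: integral_ge0 => p _; exact: (measure_ge0 leb2).
Qed.

Let mean_areaE H l : measurable H ->
  (mean_area H l = \int[distribution P (Phi 0%N)]_p area [set c : R * R | H (c, l, p)])%E.
Proof.
move=> mH.
have mA : measurable_fun setT (fun p : mR => area [set c : R * R | H (c, l, p)]).
  exact: measurableT_comp (measurable_area_section mH) (pair1_measurable l).
have mPhi : measurable_fun setT (Phi 0%N : Om -> mR) by have := measurable_funP (Phi 0%N); exact.
pose Y : {mfun Om >-> mR} := HB.pack (Phi 0%N : Om -> mR)
  (isMeasurableFun.Build _ _ _ _ (Phi 0%N : Om -> mR) mPhi).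
have A0 p : (0 <= area [set c : R * R | H (c, l, p)])%E by exact: (measure_ge0 leb2).
transitivity (\int[distribution P Y]_p area [set c : R * R | H (c, l, p)])%E.
  rewrite (eq_measure_integral (uniform_prob (pi_gt0 R))); last first.
    by move=> B mB _; exact: (orientations_uniform model).
  by rewrite integral_uniform ?subr0.
by rewrite !ge0_integral_pushforward.
Qed.

Lemma measurable_mean_area H : measurable H -> measurable_fun setT (mean_area H : mR -> _).
Proof.
move=> mH.
have := measurable_fun_fubini_tonelli_F (m2 := distribution P (Phi 0%N)) _ (measurable_area_section mH)
  (fun x => measure_ge0 leb2 _).
by congr (measurable_fun _ _); apply/funext => l; rewrite mean_areaE.
Qed.

Lemma mean_volumeE (H : set ((R * R) * R * R)) : measurable H ->
  (\int[leb2]_c \int[distribution P (L 0%N)]_l \int[distribution P (Phi 0%N)]_p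
     (\1_H (c, l, p))%:E = \int[P]_w mean_area H (L 0%N w))%E.
Proof.
move=> mH.
pose k (cl : (mR * mR) * mR) := (\int[distribution P (Phi 0%N)]_p indicH H (cl, p))%E.
have mk : measurable_fun setT k.
  apply: (measurable_fun_fubini_tonelli_F (m2 := distribution P (Phi 0%N)) _ (mindicH mH)) => x.
  by rewrite lee_fin.
have k0 cl : (0 <= k cl)%E by apply: integral_ge0 => p _; rewrite lee_fin.
rewrite (fubini_tonelli (m1 := leb2) (m2 := distribution P (L 0%N)) k)//.
transitivity (\int[distribution P (L 0%N)]_l mean_area H l)%E.
  apply: eq_integral => l _; rewrite mean_areaE//.
  have mf : measurable_fun setT (fun cp : (mR * mR) * mR => indicH H (cp.1, l, cp.2)).
    apply: (measurableT_comp (mindicH mH)); apply: measurable_fun_pair; last exact: measurable_snd.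
    by apply: measurable_fun_pair => //; exact: measurable_fst.
  rewrite (fubini_tonelli (m1 := leb2) (m2 := distribution P (Phi 0%N)) _ mf); last
    by move=> x; rewrite lee_fin.
  by apply: eq_integral => p _; rewrite area_section.
rewrite ge0_integral_pushforward//.
- exact: measurable_mean_area.
- by move=> l _; exact: mean_area_ge0.
Qed.

End mean_volume.

(** * Integrals of signed sines over orientations *)

Section angular_integrals.
Context (R : realType).
Local Notation mR := (measurableTypeR R).
Local Notation leb := (@lebesgue_measure R).

Lemma Rintegral_FTC (f F : R -> R) (a b : R) : a <= b ->
  (forall x : R, is_derive x (1 : R) F (f x)) -> continuous f ->
  \int[leb]_(x in `[a, b]) f x = F b - F a.
Proof.
move=> ab dF cf; have [->|nab] := eqVneq a b.
  by rewrite set_itv1 Rintegral_set1 subrr.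
have {nab}ab : a < b by rewrite lt_neqAle nab.
have cF : continuous F.
  move=> x; apply: differentiable_continuous; apply/derivable1_diffP.
  exact: (@ex_derive _ _ _ _ _ _ _ (dF x)).
rewrite /Rintegral (@continuous_FTC2 R f F)//.
- exact: continuous_subspaceT.
- split; [by move=> x _; exact: (@ex_derive _ _ _ _ _ _ _ (dF x))| |].
  + exact/cvg_at_right_filter/cF.
  + exact/cvg_at_left_filter/cF.
- by move=> x _; rewrite derive1E; exact: (@derive_val _ _ _ _ _ _ _ (dF x)).
Qed.

Lemma continuous_sin_shift (a : R) : continuous (fun x : R => sin (x - a)).
Proof.
move=> x; apply: continuous_comp; last exact: continuous_sin.
by apply: cvgB; [exact: cvg_id|exact: cvg_cst].
Qed.

Lemma integral_sin_shift (a x y : R) : x <= y ->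
  \int[leb]_(p in `[x, y]) sin (p - a) = cos (x - a) - cos (y - a).
Proof.
move=> xy.
have dF (p : R) : is_derive p (1 : R) (fun p => - cos (p - a)) (sin (p - a)).
  by apply: is_derive_eq; ring.
by rewrite (Rintegral_FTC xy dF (@continuous_sin_shift a)) opprK addrC.
Qed.

(** One function covers both needs: on the diagonal it is |sin|, the projected length of a link; off
    the diagonal its sign records whether two links lie on the same side of the direction [p]. *)
Definition sgsin (b a p : R) : R := Num.sg (sin (p - b)) * sin (p - a).

Lemma sgsin_diag a p : sgsin a a p = `|sin (p - a)|.
Proof. by rewrite /sgsin normrEsg. Qed.

Lemma measurable_sin_shift (a : R) : measurable_fun setT (fun p : R => sin (p - a)).
Proof. by apply: continuous_measurable_fun; exact: continuous_sin_shift. Qed.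

Lemma measurable_sgsin b a : measurable_fun setT (sgsin b a).
Proof.
apply: measurable_funM; last exact: measurable_sin_shift.
apply: measurable_fun_ifT => //.
  by apply: measurable_fun_eqr => //; exact: measurable_sin_shift.
apply: measurable_fun_ifT => //.
by apply: measurable_fun_ltr => //; exact: measurable_sin_shift.
Qed.

Lemma integrable_sgsin b a (x y : R) : leb.-integrable `[x, y] (EFin \o sgsin b a).
Proof.
apply: measurable_bounded_integrable => //.
- by rewrite [ltLHS]lebesgue_measure_itv/=; case: ifP => _; rewrite ?ltry// -EFinB ltry.
- apply: measurable_funTS; exact: measurable_sgsin.
exists 1; split => // M M1 p _ /=; rewrite normrM.
have s1 : `|sin (p - a)| <= 1 by rewrite ler_norml sin_geN1 sin_le1.
have s2 : `|Num.sg (sin (p - b))| <= 1 by rewrite normr_sg lern1 leq_b1.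
by rewrite (le_trans _ (ltW M1))// -[leRHS]mulr1 ler_pM.
Qed.

(** On [0, pi] the sign changes only at [b]. The two pieces are integrated over open intervals,
    where the sign is constant and nonzero. *)
Let integral_sgsin_pi (b a : R) : 0 <= b <= pi ->
  \int[leb]_(p in `[0, pi]) sgsin b a p = 2 * cos (b - a).
Proof.
move=> /andP[b0 bpi].
have h := Rintegral_itvB (x := b) (integrable_sgsin b a 0 pi).
have {h} := h _ _; rewrite !bnd_simp => /(_ b0 bpi) /eqP; rewrite subr_eq => /eqP ->.
rewrite Rintegral_itv_obnd_cbnd; last first.
  by apply: integrableS (integrable_sgsin b a b pi) => //; apply: subset_itvr; rewrite bnd_simp.
have ropen f (x y : R) : leb.-integrable `[x, y] (EFin \o f) ->
    \int[leb]_(p in `[x, y]) f p = \int[leb]_(p in `]x, y[) f p.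
  move=> fi; rewrite -Rintegral_itv_obnd_cbnd; last first.
    by apply: integrableS fi => //; apply: subset_itvr; rewrite bnd_simp.
  rewrite -Rintegral_itv_bndo_bndc//.
  by apply: integrableS fi => //; apply: subset_itv; rewrite bnd_simp.
have isin (x y : R) : leb.-integrable `[x, y] (EFin \o (fun p => sin (p - a))).
  apply: continuous_compact_integrable; first exact: segment_compact.
  exact/continuous_subspaceT/continuous_sin_shift.
have -> : \int[leb]_(p in `[b, pi]) sgsin b a p = cos (b - a) - cos (pi - a).
  rewrite ropen; last exact: integrable_sgsin.
  rewrite -integral_sin_shift// ropen//; apply: eq_Rintegral => p; rewrite inE/= in_itv/= => /andP[bp ppi].
  by rewrite /sgsin gtr0_sg ?mul1r// sin_gt0_pi//; apply/andP; split; lra.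
have -> : \int[leb]_(p in `[0, b]) sgsin b a p = - (cos (0 - a) - cos (b - a)).
  rewrite ropen; last exact: integrable_sgsin.
  rewrite -integral_sin_shift// ropen// -mulN1r -RintegralZl//; last first.
    by apply: integrableS (isin 0 b) => //; apply: subset_itv; rewrite bnd_simp.
  apply: eq_Rintegral => p; rewrite inE/= in_itv/= => /andP[bp ppi].
  rewrite /sgsin ltr0_sg// -oppr_gt0 -sinN opprB.
  by rewrite sin_gt0_pi//; apply/andP; split; lra.
by rewrite sub0r cosN addrC -[pi - a]addrC cosDpi cosN; ring.
Qed.

Lemma integral_sgsin (b a : R) :
  \int[leb]_(p in `[0, pi]) sgsin b a p = 2 * cos (b - a).
Proof.
have c1 : -1 <= cos b <= 1 by rewrite cos_geN1 cos_le1.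
have [sb|sb] := leP 0 (sin b).
  pose c := acos (cos b).
  have cc : cos c = cos b by rewrite acosK// in_itv.
  have sc : sin c = sin b.
    by rewrite sin_acos// -sin2cos2 sqrtr_sqr ger0_norm.
  rewrite (_ : cos (b - a) = cos (c - a)); last by rewrite !cosB cc sc.
  rewrite -integral_sgsin_pi ?acos_ge0 ?acos_lepi//.
  by apply: eq_Rintegral => p _; rewrite /sgsin !(sinB p) cc sc.
(* Here [c] represents b + pi, whose sine is positive. This shift by pi changes the sign of both
   sides. *)
pose c := acos (- cos b).
have c1' : -1 <= - cos b <= 1 by have /andP[? ?] := c1; apply/andP; split; lra.
have cc : cos c = - cos b by rewrite acosK// in_itv.
have sc : sin c = - sin b.
  by rewrite sin_acos// sqrrN -sin2cos2 sqrtr_sqr ltr0_norm.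
rewrite (_ : 2 * cos (b - a) = - (2 * cos (c - a))); last by rewrite !cosB cc sc; ring.
rewrite -integral_sgsin_pi ?acos_ge0 ?acos_lepi//.
rewrite -mulN1r -RintegralZl//; last exact: integrable_sgsin.
apply: eq_Rintegral => p _; rewrite /sgsin mulN1r.
have -> : sin (p - c) = - sin (p - b) by rewrite !(sinB p) cc sc; ring.
by rewrite sgrN mulNr opprK.
Qed.

(* sin (. - a) has at most one zero in [0, pi[. *)
Lemma negligible_sin_zero (a : R) :
  leb.-negligible [set p | p \in `[0, pi] /\ sin (p - a) = 0].
Proof.
have N1 (x : R) : leb.-negligible [set x].
  by exists [set x]; split; rewrite ?lebesgue_measure_set1.
have [[c [/[!in_itv]/= c0pi sc]]|nz] := pselect (exists c, (c \in `[0, pi[) /\ sin (c - a) = 0); last first.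
  apply: (negligibleS _ (N1 pi)).
  move=> p [/[!in_itv]/= /andP[p0 ppi] sp]; apply: contra_notP nz => np.
  exists p; rewrite in_itv/= p0 lt_neqAle ppi andbT; split => //; exact/eqP.
apply: (negligibleS _ (negligibleU (N1 pi) (N1 c))).
move=> p [/[!in_itv]/= /andP[p0 ppi] sp].
have [->|npi] := eqVneq p pi; first by left.
right; have {}ppi : p < pi by rewrite lt_neqAle npi.
have s0 : sin (p - c) = 0.
  have -> : p - c = (p - a) - (c - a) by ring.
  by rewrite sinB sp sc mul0r mulr0 subr0.
have /andP[c0 cpi] := c0pi.
have [pc|cp|//] := ltgtP p c.
  have : 0 < sin (c - p) by rewrite sin_gt0_pi//; apply/andP; split; lra.
  by rewrite -opprB sinN s0 oppr0 ltxx.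
have : 0 < sin (p - c) by rewrite sin_gt0_pi//; apply/andP; split; lra.
by rewrite s0 ltxx.
Qed.

End angular_integrals.

(** * Areas of the hitting centres through shadows *)

Section hit_area.
Context (R : realType).
Local Notation mR := (measurableTypeR R).
Local Notation leb := (@lebesgue_measure R).
Implicit Types (psi r a b l p : R).

(** Lines of direction [p] are the level sets of q = a sin p - b cos p, and the point at distance t
    on the link has q = t sin (p - psi). This is the range of q over the link, multiplied by the
    sine so that both signs are handled at once. *)
Definition shadow psi r p : set R :=
  [set q | 0 <= q * sin (p - psi) <= r * sin (p - psi) ^+ 2].

Lemma shadowE psi r p : 0 <= r -> sin (p - psi) != 0 ->
  shadow psi r p = `[Num.min 0 (r * sin (p - psi)), Num.max 0 (r * sin (p - psi))]%classic.
Proof.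
move=> r0; rewrite /shadow; set D := sin _ => D0.
have [Dn|Dp|De] := ltgtP D 0; last by rewrite De eqxx in D0.
- have rD : r * D <= 0 by rewrite nmulr_lle0.
  rewrite min_r ?max_l//; apply/seteqP; split => q /=; rewrite in_itv/= expr2 mulrA.
    by rewrite nmulr_lge0// ler_nM2r// => /andP[-> ->].
  by rewrite nmulr_lge0// ler_nM2r// => /andP[-> ->].
- have rD : 0 <= r * D by rewrite pmulr_lge0.
  rewrite min_l ?max_r//; apply/seteqP; split => q /=; rewrite in_itv/= expr2 mulrA.
    by rewrite pmulr_lge0// ler_pM2r// => /andP[-> ->].
  by rewrite pmulr_lge0// ler_pM2r// => /andP[-> ->].
Qed.

Lemma measurable_shadow psi r p : 0 <= r -> sin (p - psi) != 0 ->
  measurable (shadow psi r p).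
Proof. by move=> r0 D0; rewrite shadowE//; exact: measurable_itv. Qed.

(** The line at level q crosses the link at abscissa q cos psi / sin (p - psi), and moving by at
    most l / 2 along direction [p] changes the abscissa by at most l |cos p| / 2. This is the shape
    measured by [area_strip]. *)
Lemma hit_set_shadow psi r a b l p : cos p != 0 -> sin (p - psi) != 0 ->
  let q := a * sin p - b * cos p in
  hit_set psi r ((a, b), l, p) <->
  shadow psi r p q /\ `|a - q * (cos psi / sin (p - psi))| <= l / 2 * `|cos p|.
Proof.
move=> c0 D0 q; apply: (iff_trans (hit_set_transverse _ _ _ _ D0)).
rewrite /shadow /= -/q.
have -> : (`|a * sin psi - b * cos psi| <= l / 2 * `|sin (p - psi)|) =
    (`|a - q * (cos psi / sin (p - psi))| <= l / 2 * `|cos p|) => //.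
rewrite -(ler_pM2r (_ : 0 < `|cos p|)) ?normr_gt0// -normrM.
rewrite -[RHS](ler_pM2r (_ : 0 < `|sin (p - psi)|)) ?normr_gt0// -normrM.
rewrite mulrAC; congr (_ <= _); rewrite -[LHS]normrN; congr (`|_|).
by rewrite [in RHS]mulrBl -!mulrA mulVf// mulr1 /q sinB; ring.
Qed.

Lemma area_hit_set psi r l p : 0 <= r -> 0 <= l -> cos p != 0 -> sin (p - psi) != 0 ->
  area [set c : R * R | hit_set psi r (c, l, p)] = (l * (r * `|sin (p - psi)|))%:E.
Proof.
move=> r0 l0 c0 D0.
have mm : measurable_fun setT (fun q : R => q * (cos psi / sin (p - psi))) by exact: measurable_funM.
have l20 : 0 <= l / 2 by rewrite divr_ge0.
have := area_strip (sin p) c0 l20 (measurable_shadow r0 D0) mm.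
rewrite /= (_ : [set x | _] = [set c : R * R | hit_set psi r (c, l, p)]); last first.
  by apply/seteqP; split => -[a b] /(hit_set_shadow _ _ _ _ c0 D0).
move=> ->; rewrite shadowE// lebesgue_measure_itv/= lte_fin mulrC divfK//.
set x := r * sin _.
have -> : r * `|sin (p - psi)| = `|x| by rewrite normrM ger0_norm.
have [xn|xp] := ltP x 0; rewrite ?min_r ?max_l ?min_l ?max_r ?ltW//.
  by rewrite xn -EFinB -EFinM ltr0_norm// sub0r.
case: ifPn => [_|]; first by rewrite -EFinB -EFinM ger0_norm// subr0.
rewrite -leNgt => x0; have -> : x = 0 by lra. by rewrite normr0 mulr0 mule0.
Qed.

(** For sines of opposite signs the bracket is r1 |sin (p - psi1)| + r2 |sin (p - psi2)|, the length
    of two shadows on either side of 0. For equal signs it reduces to r2 |sin (p - psi2)|, one of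
    two nested shadows. *)
Lemma area_hit_setU_ge psi1 r1 psi2 r2 l p : 0 <= r1 -> 0 <= r2 -> 0 <= l ->
  cos p != 0 -> sin (p - psi1) != 0 -> sin (p - psi2) != 0 ->
  ((l * (r2 * `|sin (p - psi2)| + r1 / 2 * (`|sin (p - psi1)| - sgsin psi2 psi1 p)))%:E <=
   area [set c : R * R | (hit_set psi1 r1 `|` hit_set psi2 r2) (c, l, p)])%E.
Proof.
move=> r10 r20 l0 c0 D1 D2.
pose S1 := shadow psi1 r1 p; pose S2 := shadow psi2 r2 p.
have mS1 : measurable S1 by exact: measurable_shadow.
have mS2 : measurable S2 by exact: measurable_shadow.
(* One crossing is selected at each level: that of the first link when its shadow contains q,
   otherwise that of the second. The strip around this selection is contained in the union. *)
pose m (q : R) := if (0 <= q * sin (p - psi1)) && (q * sin (p - psi1) <= r1 * sin (p - psi1) ^+ 2)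
  then q * (cos psi1 / sin (p - psi1)) else q * (cos psi2 / sin (p - psi2)).
have mm : measurable_fun setT m.
  apply: measurable_fun_ifT; [|exact: measurable_funM|exact: measurable_funM].
  by apply: measurable_and; apply: measurable_fun_ler => //; exact: measurable_funM.
have l20 : 0 <= l / 2 by rewrite divr_ge0.
pose A := [set x : R * R | (S1 `|` S2) (x.1 * sin p - x.2 * cos p) /\
  `|x.1 - m (x.1 * sin p - x.2 * cos p)| <= l / 2 * `|cos p| ].
have AE : area A = ((2 * (l / 2))%:E * leb (S1 `|` S2))%E :=
  area_strip (sin p) c0 l20 (measurableU _ _ mS1 mS2) mm.
have mH : measurable [set c : R * R | (hit_set psi1 r1 `|` hit_set psi2 r2) (c, l, p)].
  rewrite -[X in measurable X]setTI.
  have : measurable_fun setT (fun c : R * R => (c, l, p)).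
    by apply: measurable_fun_pair => //; exact: measurable_fun_pair.
  by apply => //; apply: measurableU; exact: measurable_hit_set.
have mA : measurable A.
  rewrite (_ : A = (fun x : R * R => (x.1, x.1 * sin p - x.2 * cos p)) @^-1`
      [set x : R * R | (S1 `|` S2) x.2 /\ `|x.1 - m x.2| <= l / 2 * `|cos p|])//.
  rewrite -[X in measurable X]setTI.
  have : measurable_fun setT (fun x : R * R => (x.1, x.1 * sin p - x.2 * cos p)).
    apply: measurable_fun_pair; first exact: measurable_fst.
    by apply: measurable_funB; exact: measurable_funM.
  by apply => //; apply: measurable_strip => //; exact: measurableU.
have AH : A `<=` [set c : R * R | (hit_set psi1 r1 `|` hit_set psi2 r2) (c, l, p)].
  move=> -[a b] [Sq /=]; rewrite /m; case: ifPn => [q1 am|nq1 am].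
    by left; apply/(hit_set_shadow _ _ _ _ c0 D1); split.
  right; apply/(hit_set_shadow _ _ _ _ c0 D2); split => //.
  by case: Sq => //; rewrite /S1 /shadow /= => q1; rewrite q1 in nq1.
apply: (@le_trans _ _ (area A)); last first.
  by apply: (le_measure (@plane_measure R)); rewrite ?inE.
rewrite AE [2 * _]mulrC divfK// EFinM lee_wpmul2l ?lee_fin//.
pose x1 := r1 * sin (p - psi1); pose x2 := r2 * sin (p - psi2).
(* Both shadows contain 0, so their union contains the whole interval spanned by 0, [x1] and
   [x2]. *)
apply: (@le_trans _ _ (leb `[Num.min 0 (Num.min x1 x2), Num.max 0 (Num.max x1 x2)])); last first.
  apply: le_measure; rewrite ?inE; [exact: measurable_itv|exact: measurableU|].
  rewrite /S1 /S2 !shadowE// -/x1 -/x2 => q /=; rewrite !in_itv/= !ge_min !le_max.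
  case: (leP 0 q) => [q0 /= h|/ltW q0 /= /andP[h _]].
    by case/or3P: h => h; [left|left|right]; rewrite ?q0 ?h ?orbT.
  by case/orP: h => h; [left|right]; rewrite ?q0 ?h ?orbT.
rewrite lebesgue_measure_itv/= lte_fin.
set M := Num.max 0 _; set m0 := Num.min 0 _.
have [M0 M1 M2] : [/\ 0 <= M, x1 <= M & x2 <= M] by rewrite /M !le_max !lexx ?orbT.
have [m00 m1 m2] : [/\ m0 <= 0, m0 <= x1 & m0 <= x2] by rewrite /m0 !ge_min !lexx ?orbT.
apply: (@le_trans _ _ (M - m0)%:E); last by case: ifPn => //; rewrite -leNgt lee_fin => ?; lra.
rewrite lee_fin /sgsin; rewrite /x1 /x2 in M1 M2 m1 m2.
have [s2n|s2p|s20] := ltgtP (sin (p - psi2)) 0; last by rewrite s20 eqxx in D2.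
  rewrite (ltr0_sg s2n) (ltr0_norm s2n).
  have [s1n|s1p|s10] := ltgtP (sin (p - psi1)) 0; last by rewrite s10 eqxx in D1.
    by rewrite (ltr0_norm s1n); lra.
  by rewrite (gtr0_norm s1p); lra.
rewrite (gtr0_sg s2p) (gtr0_norm s2p).
have [s1n|s1p|s10] := ltgtP (sin (p - psi1)) 0; last by rewrite s10 eqxx in D1.
  by rewrite (ltr0_norm s1n); lra.
by rewrite (gtr0_norm s1p); lra.
Qed.

End hit_area.

(** * Single and joint LoS probabilities *)

Section los_probabilities.
Context (R : realType) d (Om : measurableType d) (P : probability Om R).
Variables (mu beta : R) (X : nat -> {RV P >-> (R * R)%type}) (L Phi : nat -> {RV P >-> R}).
Hypothesis mu0 : 0 < mu.
Hypothesis model : boolean_model mu X L Phi.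
Hypothesis EL : ('E_P[L 0%N] < +oo)%E.
Hypothesis betaE : beta = 2 * mu * fine 'E_P[L 0%N] / pi.
Local Notation mR := (measurableTypeR R).
Local Notation leb := (@lebesgue_measure R).
Local Notation EL0 := (fine 'E_P[L 0%N]).
Local Notation aeS := (@filterS _ _ (ae_filter_ringOfSetsType leb) _ _).
Implicit Types (psi r l : R).

Let sin_cos (p : R) : cos p = sin (p - - (pi / 2)).
Proof. by rewrite opprK sinDpihalf. Qed.

(** The area formulas exclude orientations parallel to a link, and those with [cos p = 0], where the
    first coordinate no longer parametrises the blockage. A cosine is a shifted sine, so all of
    these are null by the same argument. *)
Let ae_generic (psis : seq R) :
  {ae leb, forall p, p \in `[0, pi] -> cos p != 0 /\ {in psis, forall psi, sin (p - psi) != 0}}.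
Proof.
elim: psis => [|psi s IHs].
  have [N [mN N0 sN]] := negligible_sin_zero (- (pi / 2) : R).
  exists N; split => // p /= h; apply: sN => /=; apply: contra_notP h => h pi0.
  by split => //; rewrite sin_cos; apply: contra_notN h => /eqP.
have [N [mN N0 sN]] := negligible_sin_zero psi.
have : {ae leb, forall p, p \in `[0, pi] -> sin (p - psi) != 0}.
  exists N; split => // p /= h; apply: sN => /=; apply: contra_notP h => h pi0.
  by apply: contra_notN h => /eqP.
move=> Hpsi; have := @filterI _ _ (ae_filter_ringOfSetsType leb) _ _ IHs Hpsi.
apply: aeS => p [h1 h2] p0; have [c0 hs] := h1 p0; split => // psi'.
by rewrite inE => /predU1P[->|/hs//]; exact: h2.
Qed.

Let measurable_section (H : set ((R * R) * R * R)) l : measurable H ->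
  measurable_fun setT (fun p : mR => area [set c : R * R | H (c, l, p)]).
Proof.
by move=> mH; exact: measurableT_comp (measurable_area_section mH) (pair1_measurable l).
Qed.

Let integral_fin (f : R -> R) : leb.-integrable `[0, pi] (EFin \o f) ->
  (\int[leb]_(p in `[0%R, pi]) (f p)%:E = (\int[leb]_(p in `[0, pi]) f p)%:E)%E.
Proof. by move=> fi; rewrite /Rintegral fineK//; exact: integrable_fin_num. Qed.

Let mpi : measurable (`[0, pi]%classic : set mR). Proof. exact: measurable_itv. Qed.

Let Zi k a b : leb.-integrable `[0, pi] (EFin \o (fun p => k * sgsin a b p)).
Proof. exact: (integrableZl mpi k (integrable_sgsin a b 0 pi)). Qed.

Lemma mean_area_hit psi r l : 0 <= r -> 0 <= l ->
  mean_area (hit_set psi r) l = (l * (2 * r / pi))%:E.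
Proof.
move=> r0 l0; rewrite /mean_area.
pose f (p : R) := (l * r) * sgsin psi psi p.
have fi : leb.-integrable `[0, pi] (EFin \o f).
  exact: Zi.
have -> : (\int[leb]_(p in `[0%R, pi]) area [set c : R * R | hit_set psi r (c, l, p)] =
    \int[leb]_(p in `[0%R, pi]) (f p)%:E)%E.
  apply: ae_eq_integral => //.
  - by apply: measurable_funTS; apply: measurable_section; exact: measurable_hit_set.
  - exact: measurable_int fi.
  apply: aeS (ae_generic [:: psi]) => p h p0; have [c0 /(_ psi)] := h p0.
  rewrite inE eqxx => /(_ isT) D0.
  by rewrite area_hit_set// /f sgsin_diag mulrA.
rewrite integral_fin// RintegralZl//; last exact: integrable_sgsin.
rewrite integral_sgsin subrr cos0 mulr1 -EFinM; congr EFin.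
by ring.
Qed.

Lemma mean_area_hitU_ge psi1 r1 psi2 r2 l : 0 <= r1 -> 0 <= r2 -> 0 <= l ->
  ((l * ((2 * r2 + r1 * (1 - cos (psi2 - psi1))) / pi))%:E <=
   mean_area (hit_set psi1 r1 `|` hit_set psi2 r2) l)%E.
Proof.
move=> r10 r20 l0; rewrite /mean_area.
have mH : measurable (hit_set psi1 r1 `|` hit_set psi2 r2).
  by apply: measurableU; exact: measurable_hit_set.
pose f (p : R) := l * r2 * sgsin psi2 psi2 p +
  (l * (r1 / 2) * sgsin psi1 psi1 p - l * (r1 / 2) * sgsin psi2 psi1 p).
have Bi : leb.-integrable `[0, pi] (EFin \o (fun p => l * (r1 / 2) * sgsin psi1 psi1 p -
    l * (r1 / 2) * sgsin psi2 psi1 p)).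
  exact: (integrableB mpi (Zi (l * (r1 / 2)) psi1 psi1) (Zi (l * (r1 / 2)) psi2 psi1)).
have fi : leb.-integrable `[0, pi] (EFin \o f).
  exact: (integrableD mpi (Zi (l * r2) psi2 psi2) Bi).
have intf : \int[leb]_(p in `[0, pi]) f p = l * (2 * r2 + r1 * (1 - cos (psi2 - psi1))).
  rewrite /f RintegralD//.
  rewrite RintegralB//.
  rewrite !RintegralZl//; do ?exact: integrable_sgsin.
  by rewrite !integral_sgsin !subrr !cos0; field.
apply: (@le_trans _ _ ((pi : R)^-1%:E * \int[leb]_(p in `[0%R, pi]) (f p)%:E)%E).
  by rewrite integral_fin// intf -EFinM lee_fin mulrA mulrC.
rewrite lee_wpmul2l ?lee_fin ?invr_ge0 ?pi_ge0//.
have fE p : f p = l * (r2 * `|sin (p - psi2)| + r1 / 2 * (`|sin (p - psi1)| - sgsin psi2 psi1 p)).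
  by rewrite /f !sgsin_diag; ring.
have f0 p : 0 <= f p.
  rewrite fE mulr_ge0// addr_ge0 ?mulr_ge0// subr_ge0.
  rewrite (le_trans (ler_norm _))// normrM ler_piMl// normr_sg.
  by case: (_ != 0).
apply: ae_ge0_le_integral => //.
- by move=> p _; rewrite lee_fin.
- exact: measurable_int fi.
- by apply: measurable_funTS; exact: measurable_section.
apply: aeS (ae_generic [:: psi1; psi2]) => p h p0; have [c0 hs] := h p0.
by rewrite fE area_hit_setU_ge// hs ?inE ?eqxx ?orbT.
Qed.

Let expectE : (\int[P]_w (L 0%N w)%:E = EL0%:E)%E.
Proof.
have -> : (\int[P]_w (L 0%N w)%:E)%E = 'E_P[L 0%N]%E by rewrite unlock.
by rewrite fineK// ge0_fin_numE// unlock; apply: integral_ge0 => w _; rewrite lee_fin (lengths_ge0 model).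
Qed.

Let integral_length (k : R) : 0 <= k -> (\int[P]_w (L 0%N w * k)%:E = (EL0 * k)%:E)%E.
Proof.
move=> k0; under eq_integral do rewrite mulrC EFinM.
rewrite ge0_integralZl_EFin//; first by rewrite expectE -EFinM mulrC.
- by move=> w _; rewrite lee_fin (lengths_ge0 model).
- exact/measurable_EFinP.
Qed.

Let mmean H : measurable H -> measurable_fun setT (fun w => mean_area H (L 0%N w)).
Proof.
move=> mH; have mL : measurable_fun setT (L 0%N : Om -> mR) by have := measurable_funP (L 0%N); exact.
exact: measurableT_comp (measurable_mean_area model mH) mL.
Qed.

Let volume_hit psi r : 0 <= r ->
  (\int[P]_w mean_area (hit_set psi r) (L 0%N w) = (EL0 * (2 * r / pi))%:E)%E.
Proof.
move=> r0; rewrite -integral_length ?mulr_ge0 ?invr_ge0 ?pi_ge0//.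
by apply: eq_integral => w _; rewrite mean_area_hit// (lengths_ge0 model).
Qed.

Lemma los_eventE psi r : los_event X L Phi psi r =
  [set w | forall k, ~ hit_set psi r (X k w, L k w, Phi k w)].
Proof.
apply/seteqP; split => w /= h k; first by rewrite /hit_set /= h => -[].
by apply/eqP/negPn/negP => /set0P; exact: h.
Qed.

Lemma p_L_exp psi r : 0 <= r -> p_L X L Phi psi r = expR (- (beta * r)).
Proof.
move=> r0; rewrite /p_L los_eventE.
have mH := measurable_hit_set psi r0.
rewrite (void_probability mu0 model mH (V := EL0 * (2 * r / pi))).
  by rewrite /= betaE; congr expR; ring.
exact: etrans (mean_volumeE model mH) (volume_hit psi r0).
Qed.

(** No order between the lengths is assumed; taking the shorter link as the first one later produces
    the minimum. *)
Let p_LL_le psi1 r1 psi2 r2 : 0 <= r1 -> 0 <= r2 ->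
  fine (P (los_event X L Phi psi1 r1 `&` los_event X L Phi psi2 r2)) <=
  expR (- (beta * r1) - beta * r2 + 2^-1 * r1 * beta * (1 + cos (psi2 - psi1))).
Proof.
move=> r10 r20; rewrite !los_eventE.
pose U := hit_set psi1 r1 `|` hit_set psi2 r2.
have mH1 := measurable_hit_set psi1 r10.
have mH2 := measurable_hit_set psi2 r20.
have mU : measurable U by exact: measurableU.
rewrite (_ : _ `&` _ = [set w | forall k, ~ U (X k w, L k w, Phi k w)]); last first.
  apply/seteqP; split => w; first by move=> [h1 h2] k [/h1|/h2].
  by move=> h; split => k hk; apply: (h k); [left|right].
have m0 w H : (0 <= mean_area H (L 0%N w))%E by exact: mean_area_ge0.
(* [void_probability] asks for a finite volume. Subadditivity of the area bounds it by the volumes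
   of the two single links. *)
have Ufin : (\int[P]_w mean_area U (L 0%N w) < +oo)%E.
  apply: (@le_lt_trans _ _ (\int[P]_w (mean_area (hit_set psi1 r1) (L 0%N w) +
      mean_area (hit_set psi2 r2) (L 0%N w)))%E).
    apply: ge0_le_integral => //.
    - exact: mmean.
    - by apply: emeasurable_funD; exact: mmean.
    move=> w _; rewrite /mean_area -muleDr ?ge0_adde_def ?inE//; last 2 first.
    - by apply: integral_ge0 => p _; exact: (measure_ge0 (@plane_measure R)).
    - by apply: integral_ge0 => p _; exact: (measure_ge0 (@plane_measure R)).
    rewrite lee_wpmul2l ?lee_fin ?invr_ge0 ?pi_ge0// -ge0_integralD//.
    have mS (H : set ((R * R) * R * R)) (p : R) : measurable H ->
        measurable [set c : R * R | H (c, L 0%N w, p)].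
      move=> mH; rewrite -[X in measurable X]setTI.
      have : measurable_fun setT (fun c : R * R => (c, L 0%N w, p)).
        by apply: measurable_fun_pair => //; exact: measurable_fun_pair.
      by apply.
    apply: ge0_le_integral => //.
    - by apply: measurable_funTS; exact: measurable_section.
    - by apply: emeasurable_funD; apply: measurable_funTS; exact: measurable_section.
    - move=> p _; apply: (@measureU2 _ _ _ (@plane_measure R)); exact: mS.
    - by apply: measurable_funTS; exact: measurable_section.
    - by apply: measurable_funTS; exact: measurable_section.
  rewrite ge0_integralD//; [|exact: mmean|exact: mmean].
  have lefin (x : \bar R) (y : R) : x = y%:E -> (x < +oo)%E by move=> ->; exact: ltry.
  by apply: lte_add_pinfty; [exact: lefin (volume_hit psi1 r10)|exact: lefin (volume_hit psi2 r20)].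
have Ufin' : (\int[P]_w mean_area U (L 0%N w))%E \is a fin_num.
  by rewrite ge0_fin_numE// integral_ge0.
rewrite (void_probability mu0 model mU (V := fine (\int[P]_w mean_area U (L 0%N w)))%E); last first.
  by rewrite fineK//; exact: (mean_volumeE model mU).
set K := (2 * r2 + r1 * (1 - cos (psi2 - psi1))) / pi.
have K0 : 0 <= K.
  rewrite /K divr_ge0 ?pi_ge0// addr_ge0 ?mulr_ge0// subr_ge0 cos_le1//.
have VK : EL0 * K <= fine (\int[P]_w mean_area U (L 0%N w))%E.
  rewrite -lee_fin fineK// -integral_length//; apply: ge0_le_integral => //.
  - by move=> w _; rewrite lee_fin mulr_ge0// (lengths_ge0 model).
  - by apply/measurable_EFinP; exact: measurable_funM.
  - exact: mmean.
  - by move=> w _; apply: mean_area_hitU_ge => //; exact: (lengths_ge0 model).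
rewrite /= ler_expR.
(* From beta = 2 mu E[L] / pi, the product mu E[L] K equals beta r2 + beta r1 (1 - cos) / 2. *)
have -> : - (beta * r1) - beta * r2 + 2^-1 * r1 * beta * (1 + cos (psi2 - psi1)) =
    - (mu * (EL0 * K)).
  by rewrite betaE /K; lra.
by rewrite lerN2 ler_pM2l.
Qed.

Lemma p_LL_le_maxcorr psi r1 r2 theta : 0 <= r1 -> 0 <= r2 ->
  p_LL X L Phi psi r1 r2 theta <= p_LL_maxcorr beta r1 r2 theta.
Proof.
move=> r10 r20; rewrite /p_LL /p_LL_maxcorr.
(* When the second link is the shorter one, the links are exchanged; the angle changes sign and the
   cosine does not. *)
case: (leP r1 r2) => _.
  by have := p_LL_le psi (psi + theta) r10 r20; rewrite (addrC psi) addrK.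
have := p_LL_le (psi + theta) psi r20 r10.
rewrite setIC opprD addrA subrr sub0r cosN (addrC (- (beta * r2))) => /le_trans.
by apply; rewrite ler_expR; lra.
Qed.

End los_probabilities.

(** * The Bessel function of order 0 as an angular integral *)

Section bessel.
Context (R : realType).
Local Notation leb := (@lebesgue_measure R).

Definition cos_moment (n : nat) : R := \int[leb]_(t in `[0, pi / 2]) cos (2 * t) ^+ n.

Let continuous_cos2 : continuous (fun t : R => cos (2 * t)).
Proof.
by move=> t; apply: continuous_comp; [apply: cvgM; [exact: cvg_cst|exact: cvg_id]|exact: continuous_cos].
Qed.

Let continuous_cos2X n : continuous (fun t : R => cos (2 * t) ^+ n).
Proof. move=> t; apply: (@continuous_comp _ _ _ (fun t : R => cos (2 * t)) (fun x : R => x ^+ n)).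
  exact: continuous_cos2.
exact: exprn_continuous. Qed.

Let pi20 : 0 <= pi / 2 :> R. Proof. by rewrite divr_ge0 ?pi_ge0. Qed.

Let pi2K : 2 * (pi / 2) = pi :> R. Proof. by rewrite mulrC divfK. Qed.

Let integrable_cos2X n : leb.-integrable `[0, pi / 2] (EFin \o (fun t : R => cos (2 * t) ^+ n)).
Proof.
apply: continuous_compact_integrable; first exact: segment_compact.
exact/continuous_subspaceT/continuous_cos2X.
Qed.

Lemma cos_moment0 : cos_moment 0 = pi / 2.
Proof.
rewrite /cos_moment; have dF (t : R) : is_derive t (1 : R) (fun t : R => t) (cos (2 * t) ^+ 0).
  by rewrite expr0; exact: is_derive_id.
by rewrite (Rintegral_FTC pi20 dF (@continuous_cos2X 0%N)) subr0.
Qed.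

Lemma cos_moment1 : cos_moment 1 = 0.
Proof.
rewrite /cos_moment; have dF (t : R) : is_derive t (1 : R) (fun t : R => sin (2 * t) / 2) (cos (2 * t) ^+ 1).
  by apply: is_derive_eq; rewrite expr1 /GRing.scale/=; field.
rewrite (Rintegral_FTC pi20 dF (@continuous_cos2X 1%N)) pi2K.
by rewrite mulr0 sin0 sinpi mul0r subrr.
Qed.

(** Wallis recursion: sin (2t) cos (2t)^(n+1) / 2 vanishes at both ends, and its derivative is the
    difference of the two integrands. *)
Lemma cos_momentSS n : n.+2%:R * cos_moment n.+2 = n.+1%:R * cos_moment n.
Proof.
have dc (t : R) : is_derive t (1 : R) (fun t : R => cos (2 * t)) (- 2 * sin (2 * t)).
  by apply: is_derive_eq; rewrite /GRing.scale/=; ring.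
have dX (t : R) : is_derive t (1 : R) (fun t : R => cos (2 * t) ^+ n.+1)
    (n.+1%:R * cos (2 * t) ^+ n * (- 2 * sin (2 * t))).
  by have := is_deriveX n.+1 (dc t); rewrite exprfctE.
have dF (t : R) : is_derive t (1 : R) (fun t : R => sin (2 * t) * cos (2 * t) ^+ n.+1 / 2)
    (n.+2%:R * cos (2 * t) ^+ n.+2 - n.+1%:R * cos (2 * t) ^+ n).
  apply: is_derive_eq; rewrite /GRing.scale/=.
  have s2 : sin (2 * t) ^+ 2 = 1 - cos (2 * t) ^+ 2 by rewrite sin2cos2.
  rewrite -[n.+2%:R]natr1 !exprS.
  have -> : sin (2 * t) * (n.+1%:R * cos (2 * t) ^+ n * (-2 * sin (2 * t))) =
    -2 * n.+1%:R * cos (2 * t) ^+ n * (sin (2 * t) ^+ 2) by ring.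
  by rewrite s2; field.
have cF : continuous (fun t : R => n.+2%:R * cos (2 * t) ^+ n.+2 - n.+1%:R * cos (2 * t) ^+ n).
  by move=> t; apply: cvgB; apply: cvgM; (exact: cvg_cst || exact: continuous_cos2X).
have := Rintegral_FTC pi20 dF cF; rewrite pi2K sinpi mulr0 sin0 !mul0r subrr.
have iZ k m : leb.-integrable `[0, pi / 2] (EFin \o (fun t : R => k * cos (2 * t) ^+ m)).
  exact: (integrableZl _ k (integrable_cos2X m)).
rewrite RintegralB// !RintegralZl// => /eqP; rewrite subr_eq0 => /eqP; exact.
Qed.

Lemma cos_moment_odd k : cos_moment k.*2.+1 = 0.
Proof.
elim: k => [|k IHk]; first exact: cos_moment1.
have := cos_momentSS k.*2.+1; rewrite IHk mulr0 doubleS => /eqP.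
by rewrite mulf_eq0 pnatr_eq0/= => /eqP.
Qed.

Lemma cos_moment_even k :
  cos_moment k.*2 / (k.*2)`!%:R = pi / 2 / (2 ^+ k.*2 * (k`!%:R * k`!%:R)).
Proof.
elim: k => [|k IHk]; first by rewrite cos_moment0 !fact0 expr0 !mulr1 !divr1.
have nz (m : nat) : m`!%:R != 0 :> R by rewrite pnatr_eq0 -lt0n fact_gt0.
have Sz (m : nat) : m.+1%:R != 0 :> R by rewrite pnatr_eq0.
have -> : cos_moment k.+1.*2 = k.*2.+1%:R / k.*2.+2%:R * cos_moment k.*2.
  by apply: (mulfI (Sz k.*2.+1)); rewrite doubleS cos_momentSS mulrA mulrCA divff// mulr1.
rewrite doubleS !factS !natrM !exprS.
have -> : cos_moment k.*2 = pi / 2 / (2 ^+ k.*2 * (k`!%:R * k`!%:R)) * (k.*2)`!%:R by rewrite -IHk divfK.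
have -> : k.*2.+2%:R = 2 * k.+1%:R :> R by rewrite -doubleS -muln2 natrM mulrC.
by field; rewrite !nz !nat1r !Sz expf_neq0.
Qed.

Let sum_cos_moment (z : R) K :
  \sum_(0 <= i < K.*2) exp_coeff z i * cos_moment i =
  pi / 2 * series (fun k => (z / 2) ^+ (2 * k + 0) / (k`!%:R * (k + 0)`!%:R)) K.
Proof.
elim: K => [|K IHK]; first by rewrite /series/= !big_geq// mulr0.
rewrite doubleS !big_nat_recr//= IHK cos_moment_odd mulr0 addr0.
rewrite [in RHS]/series/= [in RHS]big_nat_recr//= mulrDr; congr (_ + _).
rewrite /exp_coeff/= mulrAC -mulrA cos_moment_even !addn0 mul2n expr_div_n.
by rewrite invfM; ring.
Qed.

Lemma integral_exp_cos (z : R) :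
  \int[leb]_(t in `[0, pi / 2]) expR (z * cos (2 * t)) = pi / 2 * besselI 0 z.
Proof.
pose D := (`[0, pi / 2]%classic : set (measurableTypeR R)).
have mD : measurable D by exact: measurable_itv.
pose c (t : R) := z * cos (2 * t).
have mc : measurable_fun setT c.
  by apply: measurable_funM => //; apply: continuous_measurable_fun; exact: continuous_cos2.
have cz t : `|c t| <= `|z|.
  by rewrite normrM ler_piMr// ler_norml cos_geN1 cos_le1.
pose f_ (N : nat) (t : R) := (series (exp_coeff (c t)) N)%:E.
have mf_ N : measurable_fun D (f_ N).
  apply/measurable_EFinP/measurable_funTS; apply: measurable_sum => i.
  by apply: measurable_funM => //; exact: measurable_funX.
have [||||_ _ h] := @dominated_convergence _ _ _ leb D mD f_ (fun t => (expR (c t))%:E)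
    (cst (expR `|z|)%:E) mf_.
- by apply/measurable_EFinP/measurable_funTS; exact: measurableT_comp.
- apply: aeW => t _; apply/cvg_EFin; first exact: nearW.
  exact: is_cvg_series_exp_coeff.
- apply: (@continuous_compact_integrable R (cst (expR `|z|))); first exact: segment_compact.
  by apply: continuous_subspaceT => x; exact: cvg_cst.
- apply: aeW => t N _; rewrite /f_ /= lee_fin.
  apply: (@le_trans _ _ (series (exp_coeff `|z|) N)).
    rewrite /series/= (le_trans (ler_norm_sum _ _ _))// ler_sum// => i _.
    rewrite /exp_coeff/= normrM normrX (ger0_norm (_ : 0 <= _^-1)) ?invr_ge0// ler_wpM2r ?invr_ge0//.
    by rewrite lerXn2r ?nnegrE.
  apply: nondecreasing_cvgn_le; last exact: is_cvg_series_exp_coeff.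
  by apply: nondecreasing_series => i _ _; rewrite /exp_coeff/= divr_ge0// exprn_ge0.
have iT i : leb.-integrable D (EFin \o (fun t => exp_coeff z i * cos (2 * t) ^+ i)).
  exact: (integrableZl _ (exp_coeff z i) (integrable_cos2X i)).
have Ef_ N : (\int[leb]_(t in D) f_ N t = (\sum_(0 <= i < N) exp_coeff z i * cos_moment i)%:E)%E.
  have fE t : f_ N t = (\sum_(0 <= i < N) (exp_coeff z i * cos (2 * t) ^+ i)%:E)%E.
    rewrite /f_ /series/= sumEFin; congr EFin; apply: eq_bigr => i _.
    by rewrite /exp_coeff/= /c exprMn mulrAC.
  under eq_integral do rewrite fE.
  rewrite integral_sum//.
  rewrite -sumEFin; apply: eq_bigr => i _.
  rewrite /cos_moment -RintegralZl//.
  by rewrite /Rintegral fineK//; exact: (integrable_fin_num mD (iT i)).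
have Jfin : (\int[leb]_(t in D) (expR (c t))%:E)%E \is a fin_num.
  apply: (integrable_fin_num mD (f := EFin \o (fun t => expR (c t)))).
  apply: continuous_compact_integrable; first exact: segment_compact.
  apply: continuous_subspaceT => t; apply: continuous_comp; last exact: continuous_expR.
  by apply: cvgM; [exact: cvg_cst|exact: continuous_cos2].
have cS : (fun N => \sum_(0 <= i < N) exp_coeff z i * cos_moment i) @ \oo -->
    \int[leb]_(t in `[0, pi / 2]) expR (z * cos (2 * t)).
  have : (fun N => (\sum_(0 <= i < N) exp_coeff z i * cos_moment i)%:E) @ \oo -->
      (\int[leb]_(t in `[0, pi / 2]) expR (z * cos (2 * t)))%:E.
    have <- : (fun N => \int[leb]_(t in D) f_ N t)%E =
        (fun N => (\sum_(0 <= i < N) exp_coeff z i * cos_moment i)%:E).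
      by apply/funext => N; exact: Ef_.
    by rewrite /Rintegral fineK.
  by move/fine_cvgP => [].
(* Odd moments vanish, so the partial sums at even indices [K.*2] are exactly the first [K] terms of
   the Bessel series. *)
have d2 : (fun K => K.*2) @ \oo --> \oo.
  by move=> A [N _ NA]; exists N => // K /= NK; apply: NA => /=; rewrite -addnn (leq_trans NK)// leq_addr.
have := cvg_comp _ _ d2 cS.
rewrite (_ : _ \o _ = fun K => pi / 2 *
    series (fun k => (z / 2) ^+ (2 * k + 0) / (k`!%:R * (k + 0)`!%:R)) K); last first.
  by apply/funext => K /=; exact: sum_cos_moment.
move=> cJ; have p0 : pi / 2 != 0 :> R by rewrite mulf_neq0// lt0r_neq0// pi_gt0.
have /cvg_lim : series (fun k => (z / 2) ^+ (2 * k + 0) / (k`!%:R * (k + 0)`!%:R)) @ \oo -->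
    (pi / 2)^-1 * \int[leb]_(t in `[0, pi / 2]) expR (z * cos (2 * t)).
  have h' := cvgM (cvg_cst (pi / 2)^-1) cJ.
  set u := series _; have <- : (fun K => (pi / 2)^-1 * (pi / 2 * u K)) = u.
    by apply/funext => K; rewrite mulKf.
  exact: h'.
rewrite -/(besselI 0 z) => ->//.
by rewrite mulVKf.
Qed.

End bessel.

(** * The radial primitive *)

Section bessel_derivatives.
Context (R : realType).
Local Notation leb := (@lebesgue_measure R).

(** In the variable u = (x / 2)^2 one has I_0 x = a u and I_1 x = (x / 2) b u, with m u = u b u. The
    relations a' = b and m' = a, read off the coefficients, play the part of the Bessel recurrences
    without dividing by x. *)
Let ca (k : nat) : R := (k`!%:R * k`!%:R)^-1.
Let cb (k : nat) : R := (k`!%:R * k.+1`!%:R)^-1.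
Let cm (k : nat) : R := k%:R * (k`!%:R * k`!%:R)^-1.
Let a (u : R) : R := limn (pseries ca u).
Let b (u : R) : R := limn (pseries cb u).
Let m (u : R) : R := limn (pseries cm u).

Let fact_neq0 n : n`!%:R != 0 :> R. Proof. by rewrite pnatr_eq0 -lt0n fact_gt0. Qed.
Let fact_ge1 n : 1 <= n`!%:R :> R. Proof. by rewrite ler1n fact_gt0. Qed.
Let fact_gt0R n : 0 < n`!%:R :> R. Proof. by rewrite ltr0n fact_gt0. Qed.

Let is_cvg_pseries_inv_fact (c : nat -> R) K :
  (forall k, 0 <= c k <= (k`!%:R)^-1) -> cvgn (pseries c K).
Proof.
move=> ck; apply: normed_cvg.
apply: (@series_le_cvg _ _ (exp_coeff `|K|)) => [n|n|n|] /=.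
- exact: normr_ge0.
- by rewrite /exp_coeff/= divr_ge0// exprn_ge0.
- have /andP[c0 c1] := ck n.
  by rewrite normrM (ger0_norm c0) normrX mulrC /exp_coeff/= ler_wpM2l// exprn_ge0.
- exact: is_cvg_series_exp_coeff.
Qed.

Let cvg_a K : cvgn (pseries ca K).
Proof.
apply: is_cvg_pseries_inv_fact => k; rewrite invr_ge0 mulr_ge0//= lef_pV2 ?posrE ?mulr_gt0//.
by rewrite ler_peMr.
Qed.

Let cvg_b K : cvgn (pseries cb K).
Proof.
apply: is_cvg_pseries_inv_fact => k; rewrite invr_ge0 mulr_ge0//= lef_pV2 ?posrE ?mulr_gt0//.
by rewrite ler_peMr.
Qed.

Let diffs_ca : pseries_diffs ca = cb.
Proof.
apply/funext => k; rewrite /pseries_diffs /ca /cb factS natrM.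
have Sk : k.+1%:R != 0 :> R by rewrite pnatr_eq0.
by field; rewrite fact_neq0 nat1r Sk.
Qed.

Let diffs_cm : pseries_diffs cm = ca.
Proof.
apply/funext => k; rewrite /pseries_diffs /ca /cm factS natrM.
have Sk : k.+1%:R != 0 :> R by rewrite pnatr_eq0.
by field; rewrite fact_neq0 nat1r Sk.
Qed.

Let cvg_diffs_cb K : cvgn (pseries (pseries_diffs cb) K).
Proof.
apply: is_cvg_pseries_inv_fact => k; rewrite /pseries_diffs /cb.
have Sk : k.+1%:R != 0 :> R by rewrite pnatr_eq0.
have -> : k.+1%:R * (k.+1`!%:R * k.+2`!%:R)^-1 = (k`!%:R * k.+2`!%:R)^-1 :> R.
  by rewrite (factS k) natrM; field; rewrite !fact_neq0 nat1r Sk.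
rewrite invr_ge0 mulr_ge0//= lef_pV2 ?posrE ?mulr_gt0//.
by rewrite ler_peMr.
Qed.

Let cvg_m K : cvgn (pseries cm K).
Proof.
apply: is_cvg_pseries_inv_fact => k; rewrite /cm mulr_ge0 ?invr_ge0 ?mulr_ge0//=.
rewrite invfM mulrA ler_piMl ?invr_ge0// ler_pdivrMr// mul1r ler_nat.
by case: k => // k; rewrite factS leq_pmulr// fact_gt0.
Qed.

Let norm_lt (u : R) : `|u| < `| `|u| + 1 |.
Proof. by rewrite (ger0_norm (addr_ge0 _ _))// ltrDl. Qed.

Let derive_a (u : R) : is_derive u (1 : R) a (b u).
Proof.
rewrite /b -diffs_ca; apply: (pseries_snd_diffs (@cvg_a (`|u| + 1)) _ _ (norm_lt u)).
  by rewrite diffs_ca.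
by rewrite diffs_ca.
Qed.

Let derive_m (u : R) : is_derive u (1 : R) m (a u).
Proof.
rewrite /a -diffs_cm; apply: (pseries_snd_diffs (@cvg_m (`|u| + 1)) _ _ (norm_lt u)).
  by rewrite diffs_cm.
by rewrite diffs_cm diffs_ca.
Qed.

Let mE u : m u = u * b u.
Proof.
have h : u * pseries cb u n @[n --> \oo] --> u * b u.
  by apply: cvgM; [exact: cvg_cst|exact: cvg_b].
(* The coefficient of index 0 in [cm] is zero, so after a shift of one index a factor [u] comes
   out. *)
have h' : pseries cm u n.+1 @[n --> \oo] --> m u.
  by rewrite (cvg_shiftS (pseries cm u)); exact: cvg_m.
have E : (fun n => pseries cm u n.+1) = (fun n => u * pseries cb u n).
  apply/funext => n; rewrite /pseries /series/= big_nat_recl// /cm mul0r mul0r add0r mulr_sumr.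
  apply: eq_bigr => k _; have := congr1 (fun f => f k) diffs_ca.
  by rewrite /pseries_diffs /ca => ->; rewrite exprS; ring.
rewrite E in h'; exact: (cvg_unique _ h' h).
Qed.

Let bessel0E (x : R) : besselI 0 x = a ((x / 2) ^+ 2).
Proof.
apply: cvg_lim => //; set f := series _.
have -> : f = pseries ca ((x / 2) ^+ 2); last exact: cvg_a.
apply/funext => n; rewrite /f /pseries /series/=; apply: eq_bigr => k _.
by rewrite /ca !addn0 exprM mulrC.
Qed.

Let bessel1E (x : R) : besselI 1 x = x / 2 * b ((x / 2) ^+ 2).
Proof.
have h : x / 2 * pseries cb ((x / 2) ^+ 2) n @[n --> \oo] --> x / 2 * b ((x / 2) ^+ 2).
  by apply: cvgM; [exact: cvg_cst|exact: cvg_b].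
apply: cvg_lim => //; set f := series _.
have -> : f = (fun n => x / 2 * pseries cb ((x / 2) ^+ 2) n); last exact: h.
apply/funext => n; rewrite /f /pseries /series/= mulr_sumr; apply: eq_bigr => k _.
by rewrite /cb !addn1 exprS exprM; ring.
Qed.

Lemma continuous_radial_bessel0 (beta : R) :
  continuous (fun t : R => t * (expR (- (beta * t / 2)) * besselI 0 (beta * t / 2))).
Proof.
have ca_ : continuous a.
  move=> x; apply: differentiable_continuous; apply/derivable1_diffP.
  exact: (@ex_derive _ _ _ _ _ _ _ (derive_a x)).
have cl : continuous (fun t : R => beta * t / 2).
  by move=> t; apply: cvgM; [apply: cvgM; [exact: cvg_cst|exact: cvg_id]|exact: cvg_cst].
have -> : (fun t => t * (expR (- (beta * t / 2)) * besselI 0 (beta * t / 2))) =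
    (fun t => t * (expR (- (beta * t / 2)) * a ((beta * t / 2 / 2) * (beta * t / 2 / 2)))).
  by apply/funext => t; rewrite bessel0E expr2.
move=> t; apply: cvgM; first exact: cvg_id.
apply: cvgM.
  apply: (@continuous_comp _ _ _ (fun t : R => - (beta * t / 2)) expR); last exact: continuous_expR.
  by apply: cvgN; exact: cl.
apply: (@continuous_comp _ _ _ (fun t : R => (beta * t / 2 / 2) * (beta * t / 2 / 2)) a); last exact: ca_.
by apply: cvgM; apply: cvgM; (exact: cl || exact: cvg_cst).
Qed.

Lemma integral_bessel0 (beta r : R) : 0 < beta -> 0 <= r ->
  \int[leb]_(t in `[0, r]) (t * (expR (- (beta * t / 2)) * besselI 0 (beta * t / 2))) =
  3^-1 / beta * r * expR (- (beta * r / 2)) *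
    (beta * r * besselI 0 (beta * r / 2) + (beta * r + 2) * besselI 1 (beta * r / 2)).
Proof.
move=> beta0 r0.
have bn0 : beta != 0 by rewrite gt_eqF.
pose u (t : R) := (beta / 4 * t) * (beta / 4 * t).
have uE t : (beta * t / 2 / 2) ^+ 2 = u t by rewrite /u; field.
have du (t : R) : is_derive t (1 : R) u (beta ^+ 2 / 8 * t).
  by apply: is_derive_eq; rewrite /GRing.scale/=; field.
have dau (t : R) : is_derive t (1 : R) (fun t => a (u t)) (b (u t) * (beta ^+ 2 / 8 * t)).
  exact: (is_derive1_comp (f := a) (g := u)).
have dmu (t : R) : is_derive t (1 : R) (fun t => m (u t)) (a (u t) * (beta ^+ 2 / 8 * t)).
  exact: (is_derive1_comp (f := m) (g := u)).
(* The closed form with I_1 rewritten through [m]: since u = (beta t / 4)^2, t^2 b u equals 16 m u /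
   beta^2. Its derivative then needs only a' = b and m' = a. *)
pose G (t : R) := (3 * beta)^-1 * (expR (- (beta * t / 2)) *
  (beta * (t * (t * a (u t))) + 4 * (t * m (u t)) + 8 / beta * m (u t))).
pose g (t : R) := t * (expR (- (beta * t / 2)) * a (u t)).
have dG (t : R) : is_derive t (1 : R) G (g t).
  rewrite /G; apply: is_derive_eq; rewrite /GRing.scale/= /g.
  by rewrite !mE /u; field.
have gE : g = (fun t => t * (expR (- (beta * t / 2)) * besselI 0 (beta * t / 2))).
  by apply/funext => t; rewrite /g bessel0E uE.
have cg : continuous g by rewrite gE; exact: continuous_radial_bessel0.
rewrite -gE (Rintegral_FTC r0 dG cg) bessel0E bessel1E uE /G !mE /u.
by field.
Qed.

End bessel_derivatives.

(** * Comparing, exchanging and folding integrals *)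

Section comparison.
Context (R : realType).
Local Notation mR := (measurableTypeR R).
Local Notation leb := (@lebesgue_measure R).

(* The integral of a nonnegative function is a supremum over simple functions,
   hence it is monotone even when the smaller function is not measurable. *)
Lemma ge0_le_integral_nonmeasurable (D : set mR) (f g : mR -> \bar R) :
  (forall x, D x -> 0 <= f x)%E -> (forall x, D x -> f x <= g x)%E ->
  (\int[leb]_(x in D) f x <= \int[leb]_(x in D) g x)%E.
Proof.
move=> f0 fg; have g0 x : D x -> (0 <= g x)%E by move=> Dx; exact: le_trans (f0 x Dx) (fg x Dx).
rewrite !ge0_integralE//=; apply: ereal_sup_le => _ [h hf <-]; exists h => // x.
apply: (le_trans (hf x)); rewrite /patch; case: ifPn => // /set_mem; exact: fg.
Qed.

(** Finiteness of the larger integral is essential: [fine] would send +oo to 0 and reverse the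
    inequality. *)
Lemma ge0_le_Rintegral_nonmeasurable (D : set mR) (f g : mR -> R) :
  (forall x, D x -> 0 <= f x) -> (forall x, D x -> f x <= g x) ->
  (\int[leb]_(x in D) (g x)%:E < +oo)%E ->
  \int[leb]_(x in D) f x <= \int[leb]_(x in D) g x.
Proof.
move=> f0 fg goo.
have ffg : (\int[leb]_(x in D) (f x)%:E <= \int[leb]_(x in D) (g x)%:E)%E.
  by apply: ge0_le_integral_nonmeasurable => x Dx; rewrite lee_fin; [exact: f0|exact: fg].
have f0' : (0 <= \int[leb]_(x in D) (f x)%:E)%E.
  by apply: integral_ge0 => x Dx; rewrite lee_fin f0.
rewrite /Rintegral fine_le// ge0_fin_numE//; first exact: le_lt_trans goo.
exact: le_trans ffg.
Qed.

Lemma integral_bounded_lty (D : set mR) (f : mR -> R) (M : R) : measurable D ->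
  (leb D < +oo)%E -> (forall x, D x -> 0 <= f x <= M) ->
  (\int[leb]_(x in D) (f x)%:E < +oo)%E.
Proof.
move=> mD Doo fM; apply: (@le_lt_trans _ _ (\int[leb]_(x in D) (cst M%:E) x)%E).
  by apply: ge0_le_integral_nonmeasurable => x Dx; rewrite lee_fin; have /andP[] := fM x Dx.
rewrite integral_cst//.
have [->|/set0P[x Dx]] := eqVneq D set0; first by rewrite measure0 mule0.
have M0 : 0 <= M by have /andP[] := fM x Dx; exact: le_trans.
by rewrite lte_mul_pinfty ?lee_fin.
Qed.

Lemma Rintegral_swap (phi : mR * mR -> R) (A B : set mR) (M : R) :
  measurable A -> measurable B -> (leb A < +oo)%E -> (leb B < +oo)%E ->
  measurable_fun setT phi -> (forall x y, A x -> B y -> 0 <= phi (x, y) <= M) ->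
  \int[leb]_(x in A) \int[leb]_(y in B) phi (x, y) =
  \int[leb]_(y in B) \int[leb]_(x in A) phi (x, y).
Proof.
move=> mA mB Aoo Boo mphi phiM.
(* The sign of [phi] is known on A x B only; the indicators make the function nonnegative
   everywhere, as Tonelli requires. *)
pose f (xy : mR * mR) := ((\1_A xy.1 * (\1_B xy.2 * phi xy)) : R)%:E.
have mf : measurable_fun setT f.
  apply/measurable_EFinP; apply: measurable_funM.
    by apply: measurableT_comp measurable_fst; exact: measurable_indic.
  by apply: measurable_funM => //; apply: measurableT_comp measurable_snd; exact: measurable_indic.
have f0 xy : (0 <= f xy)%E.
  case: xy => x y; rewrite /f lee_fin !indicE /=.
  have [xA|] := boolP (x \in A); last by rewrite mul0r.
  have [yB|] := boolP (y \in B); last by rewrite mul0r mulr0.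
  by rewrite !mul1r; rewrite !inE in xA yB; have /andP[] := phiM x y xA yB.
have E1 : (\int[leb]_x \int[leb]_y f (x, y) =
    \int[leb]_(x in A) (\int[leb]_(y in B) phi (x, y))%:E)%E.
  rewrite [RHS]integral_mkcond; apply: eq_integral => x _; rewrite /patch /f /=.
  case: ifPn => xA; last first.
    by rewrite integral0_eq// => y _; rewrite indicE (negbTE xA) mul0r.
  rewrite inE in xA; rewrite /Rintegral fineK; last first.
    rewrite ge0_fin_numE; last first.
      by apply: integral_ge0 => y By; rewrite lee_fin; have /andP[] := phiM x y xA By.
    by apply: (integral_bounded_lty mB Boo (M := M)) => y By; exact: phiM.
  rewrite [RHS]integral_mkcond; apply: eq_integral => y _; rewrite /patch !indicE mem_set// mul1r.
  by case: ifPn => _; rewrite ?mul1r ?mul0r.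
have E2 : (\int[leb]_y \int[leb]_x f (x, y) =
    \int[leb]_(y in B) (\int[leb]_(x in A) phi (x, y))%:E)%E.
  rewrite [RHS]integral_mkcond; apply: eq_integral => y _; rewrite /patch /f /=.
  case: ifPn => yB; last first.
    by rewrite integral0_eq// => x _; rewrite [\1_B _]indicE (negbTE yB) mul0r mulr0.
  rewrite inE in yB; rewrite /Rintegral fineK; last first.
    rewrite ge0_fin_numE; last first.
      by apply: integral_ge0 => x Ax; rewrite lee_fin; have /andP[] := phiM x y Ax yB.
    by apply: (integral_bounded_lty mA Aoo (M := M)) => x Ax; exact: phiM.
  rewrite [RHS]integral_mkcond; apply: eq_integral => x _; rewrite /patch !indicE (mem_set yB) mul1r.
  by case: ifPn => _; rewrite ?mul1r ?mul0r.
by rewrite [LHS]/Rintegral [RHS]/Rintegral -E1 -E2 fubini_tonelli.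
Qed.

Lemma ge0_integral_affine_set (k b : R) (A : set mR) (F : R -> R) : k != 0 ->
  measurable A -> measurable_fun setT F -> (forall x, 0 <= F x) ->
  (\int[leb]_(x in A) (F x)%:E =
   `|k|%:E * \int[leb]_(x in (fun x => k * x + b)%R @^-1` A) (F (k * x + b)%R)%:E)%E.
Proof.
move=> k0 mA mF F0; pose G (x : mR) : \bar R := ((fun x => (F x)%:E) \_ A) x.
have mG : measurable_fun setT G.
  by apply/(measurable_restrictT _ mA)/measurable_funTS/measurable_EFinP.
have G0 x : (0 <= G x)%E by rewrite /G /patch; case: ifPn; rewrite ?lee_fin.
rewrite [LHS]integral_mkcond -(ge0_integral_affine b k0 mG G0); congr (_ * _)%E.
by rewrite [RHS]integral_mkcond; apply: eq_integral => x _; rewrite /G /patch.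
Qed.

(** The substitution theta = 2t maps the circle to [0, pi] with a factor 2, and the symmetry t -> pi
    - t of cos (2t) folds [0, pi] onto its first half with another factor 2. *)
Lemma integral_full_angle (h : R -> R) : continuous h -> (forall x, 0 <= h x) ->
  \int[leb]_(theta in `[0, 2 * pi]) h (cos theta) =
  4 * \int[leb]_(t in `[0, pi / 2]) h (cos (2 * t)).
Proof.
move=> ch h0.
have chc : continuous (fun x : R => h (cos x)).
  by move=> x; apply: continuous_comp; [exact: continuous_cos|exact: ch].
have cg : continuous (fun t : R => h (cos (2 * t))).
  move=> t; apply: (@continuous_comp _ _ _ (fun t : R => 2 * t) (fun x : R => h (cos x))); last exact: chc.
  by apply: cvgM; [exact: cvg_cst|exact: cvg_id].
have mhc : measurable_fun setT (fun x : R => h (cos x)) by exact: continuous_measurable_fun.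
have mg : measurable_fun setT (fun t : R => h (cos (2 * t))) by exact: continuous_measurable_fun.
pose I := (\int[leb]_(t in `[0%R, (pi / 2)%R]) (h (cos (2 * t)))%:E)%E.
have If : I \is a fin_num.
  have mI : measurable (`[0, pi / 2]%classic : set mR) by exact: measurable_itv.
  apply: (integrable_fin_num mI (f := EFin \o (fun t : R => h (cos (2 * t))))).
  apply: continuous_compact_integrable; first exact: segment_compact.
  exact: continuous_subspaceT.
have pi0 := pi_gt0 R.
have E1 : (\int[leb]_(theta in `[0%R, (2 * pi)%R]) (h (cos theta))%:E =
    2%:E * \int[leb]_(t in `[0%R, pi]) (h (cos (2 * t)))%:E)%E.
  rewrite (@ge0_integral_affine_set 2 0)// normr_nat; congr (_ * _)%E.
  rewrite (_ : _ @^-1` _ = `[0%R, pi]%classic).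
    by apply: eq_integral => t _; rewrite addr0.
  by apply/seteqP; split => t /=; rewrite !in_itv/= addr0 pmulr_rge0// ler_pM2l.
have E2 : (\int[leb]_(t in `](pi / 2)%R, pi]) (h (cos (2 * t)))%:E = I)%E.
  rewrite (@ge0_integral_affine_set (-1) pi)//.
  rewrite normrN1 mul1e /I -integral_itv_bndo_bndc; last first.
    by apply: measurable_funTS; exact/measurable_EFinP.
  rewrite (_ : _ @^-1` _ = `[0%R, (pi / 2)%R[%classic).
    apply: eq_integral => t _.
    have -> : 2 * (-1 * t + pi) = - (2 * t) + pi *+ 2 by rewrite -mulr_natr; ring.
    by rewrite cosD2pi cosN.
  apply/seteqP; split => t /=; rewrite !in_itv/= => /andP[? ?]; apply/andP; split; lra.
have E3 : (\int[leb]_(t in `[0%R, pi]) (h (cos (2 * t)))%:E = I + I)%E.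
  have -> : `[0%R, pi]%classic = `[0%R, (pi / 2)%R]%classic `|` `](pi / 2)%R, pi]%classic :> set R.
    by rewrite -itv_bndbnd_setU// bnd_simp; lra.
  rewrite ge0_integral_setU//=.
  - by rewrite E2.
  - by apply/measurable_funTS/measurable_EFinP.
  - by move=> t _; rewrite lee_fin.
  - by apply/disj_set2P/seteqP; split => // t /=; rewrite !in_itv/=; lra.
rewrite /Rintegral E1 E3 -/I; move: If; clear; case: I => // i _.
by rewrite -EFinD -EFinM /=; ring.
Qed.

Lemma integral_linear_exp_lty (beta r : R) : 0 < beta -> 0 <= r ->
  (\int[leb]_(x in `[r, +oo[) (expR (- (beta * x)) * x)%:E < +oo)%E.
Proof.
move=> b0 r0; have b20 : 0 < beta / 2 by rewrite divr_gt0.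
(* Half of the decay absorbs x, as x exp (- beta x / 2) <= 2 / beta; the other half is 2 / beta
   times the exponential density of rate beta / 2. *)
pose k := (beta / 2)^-1 * (beta / 2)^-1.
have k0 : 0 <= k by rewrite mulr_ge0 ?invr_ge0 ?ltW.
apply: (@le_lt_trans _ _ (\int[leb]_(x in `[r, +oo[) (k%:E * (exponential_pdf (beta / 2) x)%:E))%E).
  apply: ge0_le_integral_nonmeasurable => x /=; rewrite in_itv/= andbT => rx.
    by rewrite lee_fin mulr_ge0 ?expR_ge0// (le_trans r0).
  have x0 : 0 <= x by exact: le_trans rx.
  rewrite -EFinM lee_fin exponential_pdfE// /k.
  have -> : expR (- (beta * x)) = expR (- (beta / 2) * x) * expR (- (beta / 2 * x)).
    by rewrite -expRD; congr expR; field.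
  have xe : x * expR (- (beta / 2 * x)) <= (beta / 2)^-1.
    rewrite expRN -ler_pdivlMr ?invr_gt0 ?expR_gt0// invrK mulrC -ler_pdivrMr ?invr_gt0//.
    by rewrite invrK mulrC (le_trans _ (expR_ge1Dx _))// lerDr.
  have -> : (beta / 2)^-1 * (beta / 2)^-1 * (beta / 2 * expR (- (beta / 2) * x)) =
      expR (- (beta / 2) * x) * (beta / 2)^-1 by field; rewrite gt_eqF.
  by rewrite -mulrA ler_wpM2l ?expR_ge0// mulrC.
have mpdf : measurable_fun setT (exponential_pdf (beta / 2)) by exact: measurable_exponential_pdf.
apply: (@le_lt_trans _ _ (\int[leb]_x (k%:E * (exponential_pdf (beta / 2) x)%:E))%E).
  apply: ge0_subset_integral => //.
  - by apply: measurable_funeM; exact/measurable_EFinP.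
  - by move=> x _; rewrite mule_ge0 ?lee_fin// exponential_pdf_ge0// ltW.
rewrite ge0_integralZl_EFin//.
- by rewrite integral_exponential_pdf// mule1 ltry.
- by move=> x _; rewrite lee_fin exponential_pdf_ge0// ltW.
- exact/measurable_EFinP.
Qed.

End comparison.

(** * Exponents in the maximally correlated case *)

Section maximal_correlation.
Context (R : realType).
Local Notation mR := (measurableTypeR R).
Local Notation leb := (@lebesgue_measure R).
Variable beta : R.
Hypothesis beta0 : 0 < beta.

Let pi20 : 0 <= pi / 2 :> R. Proof. by rewrite divr_ge0 ?pi_ge0. Qed.

Let sin2_half (t : R) : sin t ^+ 2 = 2^-1 - 2^-1 * cos (2 * t).
Proof.
have -> : 2 * t = t *+ 2 by rewrite mulr2n; ring.
by rewrite cos_mulr2n cos2sin2; field.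
Qed.

Lemma cos2_half (t : R) : cos t ^+ 2 = 2^-1 + 2^-1 * cos (2 * t).
Proof. by rewrite cos2sin2 sin2_half; field. Qed.

(** [g_L] integrates over links shorter than the serving one, where the minimum is the integration
    variable; [kappa_LL] integrates over longer ones, where the minimum is the fixed serving length.
    The angular integral therefore factors out in [kappa_LL] only. *)
Lemma maxcorr_ratio_inside (x t theta : R) : t <= x ->
  p_LL_maxcorr beta x t theta / expR (- (beta * x)) =
  expR (- (beta * t / 2)) * expR (beta * t / 2 * cos theta).
Proof.
move=> tx; rewrite /p_LL_maxcorr min_r// -expRN -!expRD; congr expR; by field.
Qed.

Lemma maxcorr_ratio_outside (r t theta : R) : r <= t ->
  p_LL_maxcorr beta r t theta / expR (- (beta * r)) =
  expR (- (beta * t) + beta * r / 2) * expR (beta * r / 2 * cos theta).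
Proof.
move=> rt; rewrite /p_LL_maxcorr min_l// -expRN -!expRD; congr expR; by field.
Qed.

Let continuous_exp_cos (z : R) : continuous (fun t : R => expR (z * cos (2 * t))).
Proof.
move=> t.
apply: (@continuous_comp _ _ _ (fun t : R => z * cos (2 * t)) expR); last exact: continuous_expR.
apply: cvgM; first exact: cvg_cst.
apply: (@continuous_comp _ _ _ (fun t : R => 2 * t) cos); last exact: continuous_cos.
by apply: cvgM; [exact: cvg_cst|exact: cvg_id].
Qed.

Lemma integral_scaled_exp_cos (k z : R) :
  \int[leb]_(t in `[0, pi / 2]) (k * expR (z * cos (2 * t))) = k * (pi / 2 * besselI 0 z).
Proof.
rewrite -integral_exp_cos RintegralZl//.
apply: continuous_compact_integrable; first exact: segment_compact.
exact/continuous_subspaceT/continuous_exp_cos.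
Qed.

Lemma integral_full_exp_cos (k z : R) : 0 <= k ->
  \int[leb]_(theta in `[0, 2 * pi]) (k * expR (z * cos theta)) = 2 * pi * (k * besselI 0 z).
Proof.
move=> k0; rewrite (@integral_full_angle _ (fun c => k * expR (z * c))).
- by rewrite integral_scaled_exp_cos; field.
- move=> c; apply: cvgM; first exact: cvg_cst.
  apply: (@continuous_comp _ _ _ (fun c : R => z * c) expR); last exact: continuous_expR.
  by apply: cvgM; [exact: cvg_cst|exact: cvg_id].
- by move=> c; rewrite mulr_ge0 ?expR_ge0.
Qed.

Let radial (t : R) := t * (expR (- (beta * t / 2)) * besselI 0 (beta * t / 2)).

Let integrable_radial r : leb.-integrable `[0, r] (EFin \o radial).
Proof.
apply: continuous_compact_integrable; first exact: segment_compact.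
exact/continuous_subspaceT/continuous_radial_bessel0.
Qed.

Let finite_itv (x y : R) : (leb `[x, y] < +oo)%E.
Proof. by rewrite lebesgue_measure_itv/=; case: ifP => _; rewrite ?ltry// -EFinB ltry. Qed.

Let mitv (x y : R) : measurable (`[x, y]%classic : set mR).
Proof. exact: measurable_itv. Qed.

Definition exponent_low (r : R) : R :=
  \int[leb]_(t in `[0, r]) \int[leb]_(theta in `[0, pi / 2])
    (t * expR (- (beta * t * sin theta ^+ 2))).

Lemma exponent_lowE r : exponent_low r = pi / 2 * \int[leb]_(t in `[0, r]) radial t.
Proof.
rewrite /exponent_low -RintegralZl//.
apply: eq_Rintegral => t _.
rewrite (@eq_Rintegral _ _ _ leb _ 
    (fun th => t * expR (- (beta * t / 2)) * expR (beta * t / 2 * cos (2 * th)))).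
  by rewrite integral_scaled_exp_cos /radial; ring.
move=> th _; rewrite -[in RHS]mulrA -[in RHS]expRD sin2_half; congr (_ * expR _); by field.
Qed.

Lemma exponent_low_closed r : 0 <= r -> exponent_low r =
  pi / 2 * (3^-1 / beta * r * expR (- (beta * r / 2)) *
    (beta * r * besselI 0 (beta * r / 2) + (beta * r + 2) * besselI 1 (beta * r / 2))).
Proof. by move=> r0; rewrite exponent_lowE integral_bessel0. Qed.

Let measurable_cont2 (f g : R -> R) : continuous f -> continuous g ->
  measurable_fun setT (fun x : mR * mR => f x.1 * g x.2).
Proof.
move=> cf cg; apply: measurable_funM.
  by apply: measurableT_comp measurable_fst; exact: continuous_measurable_fun.
by apply: measurableT_comp measurable_snd; exact: continuous_measurable_fun.
Qed.

Let mexpR : measurable_fun setT (@expR R).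
Proof. by apply: continuous_measurable_fun; exact: continuous_expR. Qed.

Lemma exponent_low_swap r : 0 <= r ->
  \int[leb]_(theta in `[0, pi / 2]) \int[leb]_(t in `[0, r])
    (expR (- (beta * t * sin theta ^+ 2)) * t) = exponent_low r.
Proof.
move=> r0.
pose phi (x : mR * mR) := expR (- (beta * x.2 * sin x.1 ^+ 2)) * x.2.
have mphi : measurable_fun setT phi.
  have -> : phi = (fun x : mR * mR => expR (- ((sin x.1 ^+ 2) * (beta * x.2))) * x.2).
    by apply/funext => x; rewrite /phi [_ * sin _ ^+ 2]mulrC.
  apply: measurable_funM; last exact: measurable_snd.
  apply: (measurableT_comp mexpR); apply: measurableT_comp => //.
  apply: (measurable_cont2 (f := fun x => sin x ^+ 2) (g := fun x => beta * x)).
    move=> x; apply: (@continuous_comp _ _ _ sin (fun x : R => x ^+ 2)); 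
      [exact: continuous_sin|exact: exprn_continuous].
  by move=> x; apply: cvgM; [exact: cvg_cst|exact: cvg_id].
have phir th t : `[0, pi / 2]%classic th -> `[0, r]%classic t -> 0 <= phi (th, t) <= r.
  rewrite /= !in_itv/= => _ /andP[t0 tr]; rewrite mulr_ge0 ?expR_ge0//=.
  by rewrite (le_trans _ tr)// ler_piMl// expR_le1 oppr_le0 mulr_ge0 ?sqr_ge0// mulr_ge0// ltW.
rewrite (@Rintegral_swap _ phi _ _ r (@mitv _ _) (@mitv _ _) (finite_itv _ _) (finite_itv _ _) mphi phir).
by apply: eq_Rintegral => t _; apply: eq_Rintegral => th _; rewrite mulrC.
Qed.

(** In [g_L] the angle is the outer variable. After the exchange, the full-circle integral at fixed
    [t] is four times the quarter-circle integral with sin^2. *)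
Lemma exponent_max (pL : R -> R) r : 0 <= r -> pL r = expR (- (beta * r)) ->
  \int[leb]_(theta in `[0, 2 * pi]) \int[leb]_(t in `[0, r])
    (p_LL_maxcorr beta r t theta / pL r * t) = 4 * exponent_low r.
Proof.
move=> r0 ->.
pose phi (x : mR * mR) := expR (- (beta * x.2 / 2)) * expR (beta * x.2 / 2 * cos x.1) * x.2.
transitivity (\int[leb]_(theta in `[0, 2 * pi]) \int[leb]_(t in `[0, r]) phi (theta, t)).
  apply: eq_Rintegral => th _; apply: eq_Rintegral => t; rewrite inE/= in_itv/= => /andP[t0 tr].
  by rewrite maxcorr_ratio_inside.
have mphi : measurable_fun setT phi.
  apply: measurable_funM; last exact: measurable_snd.
  apply: measurable_funM.
    apply: (measurableT_comp mexpR); apply: measurableT_comp => //; apply: measurable_funM => //.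
    by apply: measurable_funM => //; exact: measurable_snd.
  apply: (measurableT_comp mexpR).
  have -> : (fun x : mR * mR => beta * x.2 / 2 * cos x.1) = (fun x : mR * mR => cos x.1 * (beta * x.2 / 2)).
    by apply/funext => x; rewrite mulrC.
  apply: (measurable_cont2 (f := cos) (g := fun t => beta * t / 2)); first exact: continuous_cos.
  by move=> t; apply: cvgM; [apply: cvgM; [exact: cvg_cst|exact: cvg_id]|exact: cvg_cst].
have phir th t : `[0, 2 * pi]%classic th -> `[0, r]%classic t -> 0 <= phi (th, t) <= r.
  rewrite /= !in_itv/= /phi/= => _ /andP[t0 tr]; rewrite !mulr_ge0 ?expR_ge0//=.
  rewrite (le_trans _ tr)// ler_piMl// -expRD expR_le1.
  have bt : 0 <= beta * t / 2 by rewrite divr_ge0// mulr_ge0// ltW.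
  have := cos_le1 th.
  have -> : - (beta * t / 2) + beta * t / 2 * cos th = - (beta * t / 2 * (1 - cos th)) by ring.
  by move=> c1; rewrite oppr_le0 mulr_ge0// subr_ge0.
rewrite (@Rintegral_swap _ phi _ _ r (@mitv _ _) (@mitv _ _) (finite_itv _ _) (finite_itv _ _) mphi phir).
transitivity (\int[leb]_(t in `[0, r]) (2 * pi * radial t)).
  apply: eq_Rintegral => t; rewrite inE/= in_itv/= => /andP[t0 tr].
  rewrite (@eq_Rintegral _ _ _ leb _ (fun th => t * expR (- (beta * t / 2)) * expR (beta * t / 2 * cos th))).
    by rewrite integral_full_exp_cos ?mulr_ge0 ?expR_ge0// /radial; ring.
  by move=> th _; rewrite /phi/=; ring.
rewrite RintegralZl//.
by rewrite exponent_lowE; field.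
Qed.

End maximal_correlation.

(** * Bounds for a general joint probability *)

Section lap_bounds.
Context (R : realType).
Local Notation mR := (measurableTypeR R).
Local Notation leb := (@lebesgue_measure R).
Variables (lambda beta : R) (pL : R -> R) (pLL : R -> R -> R -> R).
Hypothesis lambda0 : 0 < lambda.
Hypothesis beta0 : 0 < beta.
Hypothesis pLE : forall r, 0 <= r -> pL r = expR (- (beta * r)).
Hypothesis pLL_ge0 : forall r1 r2 theta, 0 <= pLL r1 r2 theta.
Hypothesis pLL_le : forall r1 r2 theta, 0 <= r1 -> 0 <= r2 ->
  pLL r1 r2 theta <= p_LL_maxcorr beta r1 r2 theta.

Let finite_itv (x y : R) : (leb `[x, y] < +oo)%E.
Proof. by rewrite lebesgue_measure_itv/=; case: ifP => _; rewrite ?ltry// -EFinB ltry. Qed.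

Let mitv (x y : R) : measurable (`[x, y]%classic : set mR).
Proof. exact: measurable_itv. Qed.

Lemma g_L_low_exponent r :
  g_L_low lambda beta r = expR (- (beta * r)) * expR (- (4 * lambda * exponent_low beta r)).
Proof. by []. Qed.

Lemma g_L_max r : 0 <= r -> g_L lambda pL (p_LL_maxcorr beta) r = g_L_low lambda beta r.
Proof.
move=> r0; rewrite g_L_low_exponent /g_L exponent_max ?pLE//.
by congr (_ * expR (- _)); ring.
Qed.

Let ratio_ge0 r t theta : 0 <= r -> 0 <= pLL r t theta / pL r.
Proof. by move=> r0; rewrite pLE// divr_ge0 ?expR_ge0. Qed.

Let ratio_le r t theta : 0 <= r -> 0 <= t ->
  pLL r t theta / pL r <= p_LL_maxcorr beta r t theta / pL r.
Proof. by move=> r0 t0; rewrite pLE// ler_pM2r ?pLL_le// invr_gt0 expR_gt0. Qed.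

Let ratio_max_le1 r t theta : 0 <= t -> t <= r -> p_LL_maxcorr beta r t theta / pL r <= 1.
Proof.
move=> t0 tr; rewrite pLE ?(le_trans t0)// maxcorr_ratio_inside// -expRD expR_le1.
have -> : - (beta * t / 2) + beta * t / 2 * cos theta = - (beta * t / 2 * (1 - cos theta)) by ring.
by rewrite oppr_le0 mulr_ge0 ?subr_ge0 ?cos_le1// divr_ge0// mulr_ge0// ltW.
Qed.

Let exponent_ge0 r : 0 <= r ->
  0 <= \int[leb]_(theta in `[0, 2 * pi]) \int[leb]_(t in `[0, r]) (pLL r t theta / pL r * t).
Proof.
move=> r0; apply: Rintegral_ge0 => th _; apply: Rintegral_ge0 => t /=.
by rewrite in_itv/= => /andP[t0 _]; rewrite mulr_ge0// ratio_ge0.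
Qed.

Lemma exponent_le r : 0 <= r ->
  \int[leb]_(theta in `[0, 2 * pi]) \int[leb]_(t in `[0, r]) (pLL r t theta / pL r * t) <=
  4 * exponent_low beta r.
Proof.
move=> r0; rewrite -(exponent_max beta0 r0 (pLE r0)).
have maxr th t : `[0, r]%classic t -> 0 <= p_LL_maxcorr beta r t th / pL r * t <= r.
  rewrite /= in_itv/= => /andP[t0 tr].
  rewrite mulr_ge0//=; last by rewrite (le_trans _ (ratio_le _ r0 t0)) ?ratio_ge0.
  by rewrite (le_trans _ tr)// ler_piMl// ratio_max_le1.
apply: ge0_le_Rintegral_nonmeasurable => [th _|th _|].
- apply: Rintegral_ge0 => t /=; rewrite in_itv/= => /andP[t0 _].
  by rewrite mulr_ge0// ratio_ge0.
- apply: ge0_le_Rintegral_nonmeasurable => [t|t|] /=.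
  + by rewrite in_itv/= => /andP[t0 _]; rewrite mulr_ge0// ratio_ge0.
  + by rewrite in_itv/= => /andP[t0 _]; rewrite ler_wpM2r// ratio_le.
  + exact: (integral_bounded_lty (@mitv _ _) (finite_itv _ _) (maxr th)).
(* The integrand is at most [r], which bounds the inner integral uniformly in the angle and makes
   the outer one finite. *)
- apply: (integral_bounded_lty (M := \int[leb]_(t in `[0, r]) (cst r t))
    (@mitv _ _) (finite_itv _ _)) => th _.
  rewrite Rintegral_ge0; last by move=> t /(maxr th)/andP[].
  apply: ge0_le_Rintegral_nonmeasurable => [t /(maxr th)/andP[]//|t /(maxr th)/andP[]//|].
  apply: (integral_bounded_lty (M := r) (@mitv _ _) (finite_itv _ _)) => t _.
  by rewrite r0 lexx.
Qed.

Lemma g_L_ge r : 0 <= r -> g_L_low lambda beta r <= g_L lambda pL pLL r.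
Proof.
move=> r0; rewrite g_L_low_exponent -(pLE r0) /g_L.
apply: ler_wpM2l; first by rewrite pLE// expR_ge0.
rewrite ler_expR lerN2 -mulrA mulrCA ler_wpM2l ?(ltW lambda0)//.
exact: exponent_le.
Qed.

Let g_L_bounds x : 0 <= x -> 0 <= g_L lambda pL pLL x <= expR (- (beta * x)).
Proof.
move=> x0; have pL0 : 0 <= pL x by rewrite pLE// expR_ge0.
rewrite -(pLE x0) /g_L mulr_ge0 ?expR_ge0//= ler_piMr//.
by rewrite expR_le1 oppr_le0 mulr_ge0 ?exponent_ge0// ltW.
Qed.

Let A_L_lowE : A_L_low lambda beta =
  2 * pi * lambda * \int[leb]_(x in `[0, +oo[) (g_L_low lambda beta x * x).
Proof.
rewrite /A_L_low; congr (_ * _); apply: eq_Rintegral => x; rewrite inE/= in_itv/= andbT => x0.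
by rewrite exponent_low_swap// g_L_low_exponent -expRD.
Qed.

Lemma A_L_max : A_L lambda pL (p_LL_maxcorr beta) = A_L_low lambda beta.
Proof.
have E : \int[leb]_(x in `[0, +oo[) (g_L lambda pL (p_LL_maxcorr beta) x * x) =
    \int[leb]_(x in `[0, +oo[) (g_L_low lambda beta x * x).
  by apply: eq_Rintegral => x; rewrite inE/= in_itv/= andbT => /g_L_max ->.
exact: etrans (congr1 (fun z => 2 * pi * lambda * z) E) (esym A_L_lowE).
Qed.

Lemma A_L_ge : A_L_low lambda beta <= A_L lambda pL pLL.
Proof.
have c0 : 0 <= 2 * pi * lambda by rewrite mulr_ge0 ?mulr_ge0 ?pi_ge0 ?(ltW lambda0).
apply: le_trans (ler_wpM2l c0 _); first by rewrite le_eqVlt; apply/orP; left; apply/eqP; exact: A_L_lowE.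
(* The larger side is now the actual [g_L]; its integrability comes from g_L x <= exp (- beta x). *)
have lowgoo : (\int[leb]_(x in `[0%R, +oo[) (g_L lambda pL pLL x * x)%:E < +oo)%E.
  apply: le_lt_trans (integral_linear_exp_lty beta0 (lexx 0)).
  apply: ge0_le_integral_nonmeasurable => x /=; rewrite in_itv/= andbT => x0; rewrite lee_fin.
    by rewrite mulr_ge0//; have /andP[] := g_L_bounds x0.
  by rewrite ler_wpM2r//; have /andP[] := g_L_bounds x0.
have half x : `[0, +oo[%classic x -> 0 <= x by rewrite /= in_itv/= andbT.
apply: ge0_le_Rintegral_nonmeasurable => [x /half x0|x /half x0|]; last exact: lowgoo.
  by apply: (mulr_ge0 (mulr_ge0 _ _) x0); exact: expR_ge0.
by apply: (ler_wpM2r x0); exact: g_L_ge.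
Qed.

Lemma g_L_low_closed r : 0 <= r -> g_L_low lambda beta r =
  expR (- (beta * r) - 3^-1 * (2 * pi * lambda / beta) * r * expR (- (beta * r / 2))
    * (beta * r * besselI 0 (beta * r / 2) + (beta * r + 2) * besselI 1 (beta * r / 2))).
Proof.
move=> r0; rewrite g_L_low_exponent -expRD exponent_low_closed//; congr expR.
by field; rewrite gt_eqF.
Qed.


Variables (ell : R -> R) (r tau : R).
Hypothesis ell_gt0 : forall t, 0 <= t -> 0 < ell t.
Hypothesis ell_nonincreasing : forall s t, 0 <= s -> s <= t -> ell t <= ell s.
Hypothesis r0 : 0 < r.
Hypothesis tau0 : 0 < tau.

Let weight t := lambda / (1 + tau^-1 * ell r / ell t).
Let decay t := lambda * expR (- (beta * t)) / (1 + tau^-1 * ell r / ell t) * t.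
Let decayE t : decay t = weight t * (expR (- (beta * t)) * t).
Proof. by rewrite /decay /weight; ring. Qed.

Let in_ray t : `[r, +oo[%classic t -> r <= t.
Proof. by rewrite /= in_itv/= andbT. Qed.

Let ray_ge0 t : `[r, +oo[%classic t -> 0 <= t.
Proof. by move=> /in_ray; apply: le_trans; exact: ltW. Qed.

Let den_ge1 t : 0 <= t -> 1 <= 1 + tau^-1 * ell r / ell t.
Proof.
by move=> t0; rewrite lerDl divr_ge0 ?mulr_ge0 ?invr_ge0 ?(ltW tau0)// ltW// ell_gt0// ltW.
Qed.

Let weight_ge0 t : 0 <= t -> 0 <= weight t.
Proof. by move=> t0; rewrite divr_ge0 ?(ltW lambda0)// (le_trans _ (den_ge1 t0)). Qed.

Let weight_le t : 0 <= t -> weight t <= lambda.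
Proof.
move=> t0; have d1 := den_ge1 t0; rewrite ler_pdivrMr ?(lt_le_trans ltr01)//.
by rewrite ler_peMr// ltW.
Qed.

Let decay_ge0 t : 0 <= t -> 0 <= decay t.
Proof.
by move=> t0; rewrite decayE (mulr_ge0 (weight_ge0 t0))// (mulr_ge0 (expR_ge0 _) t0).
Qed.

(** Measurability of [ell] is not given; monotonicity replaces it. Since [ell] is monotone on [0,
    +oo[ only, the argument is truncated at 0 to get a function monotone on the whole line. *)
Let measurable_weight : measurable_fun setT (fun t : R => weight (Num.max 0 t)).
Proof.
apply: nonincreasing_measurable => // t s ts.
have t0 : 0 <= Num.max 0 t by rewrite le_max lexx.
have s0 : 0 <= Num.max 0 s by rewrite le_max lexx.
have ms : Num.max 0 t <= Num.max 0 s by rewrite ge_max s0/= le_max ts orbT.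
apply: ler_wpM2l; first exact: ltW.
rewrite lef_pV2 ?posrE ?(lt_le_trans ltr01 (den_ge1 _))// lerD2l.
apply: ler_wpM2l; first by rewrite mulr_ge0 ?invr_ge0 ?(ltW tau0)// ltW// ell_gt0// ltW.
by rewrite lef_pV2 ?posrE ?ell_gt0// ell_nonincreasing.
Qed.

Let measurable_decay : measurable_fun `[r, +oo[ decay.
Proof.
apply: (eq_measurable_fun (fun t : R => weight (Num.max 0 t) * (expR (- (beta * t)) * t))).
  by move=> t /set_mem /ray_ge0 t0; rewrite decayE max_r.
apply: measurable_funTS; apply: measurable_funM; first exact: measurable_weight.
apply: measurable_funM => //; apply: continuous_measurable_fun => t.
apply: (@continuous_comp _ _ _ (fun t : R => - (beta * t)) expR); last exact: continuous_expR.
by apply: cvgN; apply: cvgM; [exact: cvg_cst|exact: cvg_id].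
Qed.

(** This allows the angular constant to be pulled out of the radial integral, and makes the larger
    side finite in the comparison for [kappa_LL]. *)
Let integrable_decay : leb.-integrable `[r, +oo[ (EFin \o decay).
Proof.
have mray : measurable (`[r, +oo[%classic : set mR) by exact: measurable_itv.
apply/integrableP; split; first exact/measurable_EFinP.
pose h t := expR (- (beta * t)) * t.
have h0 t : 0 <= t -> 0 <= h t by move=> t0; exact: (mulr_ge0 (expR_ge0 _) t0).
have hoo := integral_linear_exp_lty beta0 (ltW r0).
apply: (@le_lt_trans _ _ (\int[leb]_(t in `[r, +oo[) (lambda%:E * (h t)%:E))%E).
  apply: ge0_le_integral_nonmeasurable => t /ray_ge0 t0; first exact: abse_ge0.
  rewrite /comp abse_EFin ger0_norm ?decay_ge0// -EFinM lee_fin decayE.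
  by apply: ler_wpM2r; [exact: h0|exact: weight_le].
rewrite ge0_integralZl_EFin//.
- by rewrite lte_mul_pinfty// lee_fin ltW.
- by move=> t /ray_ge0 t0; rewrite lee_fin h0.
- apply/measurable_EFinP/measurable_funTS/measurable_funM => //.
  apply: continuous_measurable_fun => t.
  apply: (@continuous_comp _ _ _ (fun t : R => - (beta * t)) expR); last exact: continuous_expR.
  by apply: cvgN; apply: cvgM; [exact: cvg_cst|exact: cvg_id].
- exact: ltW.
Qed.

Let angular : R := 2 * pi * expR (beta * r / 2) * besselI 0 (beta * r / 2).

Let angular_lowE :
  4 * \int[leb]_(theta in `[0, pi / 2]) expR (beta * r * cos theta ^+ 2) = angular.
Proof.
rewrite (@eq_Rintegral _ _ _ leb _ (fun th => expR (beta * r / 2) * expR (beta * r / 2 * cos (2 * th)))).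
  by rewrite integral_scaled_exp_cos /angular; field.
by move=> th _; rewrite -[in RHS]expRD cos2_half; congr expR; field.
Qed.

Let angular_ge0 : 0 <= angular.
Proof.
by rewrite -angular_lowE; apply: mulr_ge0 => //; apply: Rintegral_ge0 => th _; exact: expR_ge0.
Qed.

Lemma kappa_LL_low_closed : kappa_LL_low lambda beta ell r tau =
  expR (- ((\int[leb]_(t in `[r, +oo[)
      (lambda * expR (- (beta * t)) / (1 + tau^-1 * ell r / ell t) * t))
    * (2 * pi * expR (beta * r / 2) * besselI 0 (beta * r / 2)))).
Proof. by rewrite /kappa_LL_low angular_lowE. Qed.

Let angular_max t : r <= t ->
  \int[leb]_(theta in `[0, 2 * pi]) (p_LL_maxcorr beta r t theta / pL r) =
  expR (- (beta * t)) * angular.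
Proof.
move=> rt; rewrite (@eq_Rintegral _ _ _ leb _
  (fun th => expR (- (beta * t) + beta * r / 2) * expR (beta * r / 2 * cos th))).
  by rewrite integral_full_exp_cos ?expR_ge0// expRD /angular; ring.
by move=> th _; rewrite pLE ?(ltW r0)// maxcorr_ratio_outside.
Qed.

Let integrand_max t : r <= t ->
  weight t * (\int[leb]_(theta in `[0, 2 * pi]) (p_LL_maxcorr beta r t theta / pL r)) * t =
  decay t * angular.
Proof. by move=> rt; rewrite angular_max// decayE; ring. Qed.

Let integral_max : \int[leb]_(t in `[r, +oo[)
    (weight t * (\int[leb]_(theta in `[0, 2 * pi]) (p_LL_maxcorr beta r t theta / pL r)) * t) =
  (\int[leb]_(t in `[r, +oo[) decay t) * angular.
Proof.
rewrite -RintegralZr//; apply: eq_Rintegral => t /set_mem /in_ray; exact: integrand_max.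
Qed.

Lemma kappa_LL_max : kappa_LL lambda ell pL (p_LL_maxcorr beta) r tau =
  kappa_LL_low lambda beta ell r tau.
Proof.
rewrite kappa_LL_low_closed; exact: (congr1 (fun z => expR (- z)) integral_max).
Qed.

Lemma kappa_LL_ge : kappa_LL_low lambda beta ell r tau <= kappa_LL lambda ell pL pLL r tau.
Proof.
have r0' := ltW r0.
rewrite -kappa_LL_max /kappa_LL ler_expR lerN2.
have inner t : 0 <= t -> 0 <= \int[leb]_(theta in `[0, 2 * pi]) (pLL r t theta / pL r).
  by move=> t0; apply: Rintegral_ge0 => th _; exact: ratio_ge0.
apply: ge0_le_Rintegral_nonmeasurable => [t /ray_ge0 t0|t rt|].
- by apply: (mulr_ge0 (mulr_ge0 (weight_ge0 t0) (inner _ t0)) t0).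
- have t0 := ray_ge0 rt; apply: (ler_wpM2r t0); apply: (ler_wpM2l (weight_ge0 t0)).
  apply: ge0_le_Rintegral_nonmeasurable => [th _|th _|].
  + exact: ratio_ge0.
  + exact: ratio_le.
  (* The exponent is - beta t + (beta r / 2) (1 + cos th), at most beta r. *)
  + apply: (integral_bounded_lty (M := expR (beta * r)) (@mitv _ _) (finite_itv _ _)) => th _.
    rewrite (le_trans _ (ratio_le th r0' t0)) ?ratio_ge0//= pLE// maxcorr_ratio_outside; last exact: in_ray.
    rewrite -expRD ler_expR.
    have : beta * r / 2 * cos th <= beta * r / 2.
      by rewrite ler_piMr ?cos_le1// divr_ge0// mulr_ge0// ltW.
    have : 0 <= beta * t by rewrite mulr_ge0// ltW.
    lra.
- have /integrableP[_] : leb.-integrable `[r, +oo[ (EFin \o (fun t => decay t * angular)).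
    rewrite (_ : _ \o _ = (fun t => (decay t)%:E * angular%:E)%E); last first.
      by apply/funext => t; rewrite /comp EFinM.
    exact: integrableZr.
  apply: le_lt_trans; rewrite le_eqVlt; apply/orP; left; apply/eqP.
  apply: eq_integral => t /set_mem rt; rewrite integrand_max ?in_ray//.
  rewrite /comp abse_EFin ger0_norm//; exact: mulr_ge0 (decay_ge0 (ray_ge0 rt)) angular_ge0.
Qed.

End lap_bounds.

Theorem lemma11 (R : realType) (d : measure_display) (Om : measurableType d)
    (P : probability Om R)
    (lambda mu beta : R) (hlambda : 0 < lambda) (hmu : 0 < mu)
    (X : nat -> {RV P >-> (R * R)%type}) (L Phi : nat -> {RV P >-> R})
    (hmodel : boolean_model mu X L Phi)
    (hEL : (0 < 'E_P[L 0%N] < +oo)%E)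
    (hbeta : beta = 2 * mu * fine 'E_P[L 0%N] / pi)
    (psi : R)
    (ell : R -> R)
    (ell_gt0 : forall t, 0 <= t -> 0 < ell t)
    (ell_bounded : exists M, forall t, 0 <= t -> ell t <= M)
    (ell_nonincreasing : forall s t, 0 <= s -> s <= t -> ell t <= ell s) :
  let pL := p_L X L Phi psi in
  let pLL := p_LL X L Phi psi in
  let pLLmax := p_LL_maxcorr beta in
  [/\ forall r, 0 < r ->
        [/\ g_L lambda pL pLL r >= g_L_low lambda beta r,
            g_L_low lambda beta r =
              expR (- (beta * r)
                    - 3^-1 * (2 * pi * lambda / beta) * r * expR (- (beta * r / 2))
                      * (beta * r * besselI 0 (beta * r / 2)
                         + (beta * r + 2) * besselI 1 (beta * r / 2)))
          & g_L lambda pL pLLmax r = g_L_low lambda beta r],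
      A_L lambda pL pLL >= A_L_low lambda beta,
      A_L lambda pL pLLmax = A_L_low lambda beta
    & forall r tau, 0 < r -> 0 < tau ->
        [/\ kappa_LL lambda ell pL pLL r tau >= kappa_LL_low lambda beta ell r tau,
            kappa_LL_low lambda beta ell r tau =
              expR (- ((\int[@lebesgue_measure R]_(t in `[r, +oo[)
                          (lambda * expR (- (beta * t))
                           / (1 + tau^-1 * ell r / ell t) * t))
                       * (2 * pi * expR (beta * r / 2) * besselI 0 (beta * r / 2))))
          & kappa_LL lambda ell pL pLLmax r tau = kappa_LL_low lambda beta ell r tau]].
Proof.
have [EL0 ELoo] := andP hEL.
have beta0 : 0 < beta.
  rewrite hbeta divr_gt0 ?pi_gt0// !mulr_gt0// -lte_fin fineK//.
  by rewrite ge0_fin_numE// ltW.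
have pLE r : 0 <= r -> p_L X L Phi psi r = expR (- (beta * r)).
  exact: p_L_exp hmu hmodel ELoo hbeta psi r.
have pLL0 r1 r2 theta : 0 <= p_LL X L Phi psi r1 r2 theta by exact: fine_ge0.
have pLL_le r1 r2 theta : 0 <= r1 -> 0 <= r2 ->
    p_LL X L Phi psi r1 r2 theta <= p_LL_maxcorr beta r1 r2 theta.
  exact: p_LL_le_maxcorr hmu hmodel ELoo hbeta psi r1 r2 theta.
move=> pL pLL pLLmax; split.
- move=> r /ltW r0; split.
  + exact: g_L_ge.
  + exact: g_L_low_closed.
  + exact: g_L_max.
- exact: A_L_ge.
- exact: A_L_max.
- move=> r tau r0 tau0; split.
  + exact: kappa_LL_ge.
  + exact: kappa_LL_low_closed.
  + exact: kappa_LL_max.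
Qed.
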